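(* Let $n\ge 1$, $m:=n+1$, and let $b\in\mathbb R^n$ have positive entries with $1,b_1,\dots,b_n$ linearly independent over $\mathbb Z$. Let $s_1,\dots,s_{n+1}\in(-1,1)$ be distinct and let $\gamma\in\mathbb Z^{n+1}$ have positive entries with $\gcd(\gamma_1,\dots,\gamma_{n+1})=1$. Let $M\in\mathbb R^{m\times n}$ be the matrix whose first $n$ rows form the identity matrix $I_n$ and whose last row is $-b^T$, and define $\psi:\mathbb R^n\to\mathbb T^m$ by $\psi(x):=[e^{2\pi i (Mx)_1},\dots,e^{2\pi i (Mx)_m}]^T$. For $t\in[0,1]$ define $\varphi_t:\mathbb T\to\mathbb T^m$ by $$\varphi_t(\zeta)_j:=\frac{\zeta^{\gamma_j}-ts_j}{1-ts_j\zeta^{\gamma_j}},\qquad \zeta\in\mathbb T,\ j=1,\dots,m,$$ and set $X_t:=\varphi_t(\mathbb T)$ and $\Lambda_t:=\psi^{-1}(X_t)\subset\mathbb R^n$. Let $\tau\in(0,1]$ be such that for every $t\in[0,\tau]$ the curve $X_t$ is transverse to the foliation of $\mathbb T^m$ whose leaves are the cosets of $\psi(\mathbb R^n)$. Then for every $t\in[0,\tau]$, $\Lambda_t$ is a Fourier quasicrystal, i.e. the measure $\sum_{\lambda\in\Lambda_t}\delta_\lambda$ is a Fourier quasicrystal on $\mathbb R^n$.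
   Context: $\mathbb T:=\{z\in\mathbb C:|z|=1\}$. Transversality of $X_t$ to the foliation means that at every point of $X_t$ the tangent line of the curve is not contained in the tangent space of the leaf through that point. (In the paper $\tau$ is a number whose existence is established beforehand.) A Radon measure on $\mathbb R^n$ is complex-valued, regarded as a continuous linear functional on $C_c(\mathbb R^n)$. A Radon measure $\mu$ is tempered if there is a tempered distribution $T$ with $\langle\mu,h\rangle=\langle T,h\rangle$ for all compactly supported Schwartz functions $h$. A Radon measure is discrete if it equals $\sum_{x\in D}c_x\delta_x$ with $D\subset\mathbb R^n$ discrete (no limit points) and $c_x\in\mathbb C\setminus\{0\}$. The Fourier transform is $\widehat h(y)=\int h(x)e^{-2\pi i x\cdot y}dx$ on Schwartz functions, extended to tempered distributions by duality. A crystalline measure on $\mathbb R^n$ is a discrete tempered Radon measure whose Fourier transform is a discrete Radon measure. A Fourier quasicrystal on $\mathbb R^n$ is a crystalline measure $\mu$ such that both $|\mu|$ and $|\widehat\mu|$ (total variations) are tempered. *)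

(* Defs.v *)
From HB Require Import structures.
From mathcomp Require Import all_boot all_order all_algebra.
From mathcomp Require Import complex.
From mathcomp Require Import all_classical all_reals all_analysis.

Set Implicit Arguments.
Unset Strict Implicit.
Unset Printing Implicit Defensive.

Import Order.TTheory GRing.Theory Num.Theory.
Import numFieldNormedType.Exports.

Local Open Scope classical_set_scope.
Local Open Scope ring_scope.

(* The library has binary products of measures; the n-fold power of a          *)
(* sigma-finite measure on n.-tuple T is obtained by iterating them.           *)
Section ConsMeasure.
Context d (T : measurableType d) (R : realType) (n : nat).

Definition tcons (p : T * n.-tuple T) : n.+1.-tuple T := [tuple of p.1 :: p.2].

Lemma measurable_tcons : measurable_fun [set: T * n.-tuple T] tcons.
Proof. by apply: measurable_cons. Qed.

Variables (m : {sigma_finite_measure set T -> \bar R})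
  (mu : {sigma_finite_measure set (n.-tuple T) -> \bar R}).

Definition cons_measure : set (n.+1.-tuple T) -> \bar R :=
  pushforward (m \x mu)%E tcons.

Let cons_measure0 : (cons_measure set0 = 0)%E.
Proof. by rewrite /cons_measure /pushforward preimage_set0 measure0. Qed.

Let cons_measure_ge0 A : (0 <= cons_measure A)%E.
Proof. by apply: integral_ge0 => x _; exact: measure_ge0. Qed.

Let cons_measure_sigma_additive : semi_sigma_additive cons_measure.
Proof.
have mtcons A : measurable A -> measurable (tcons @^-1` A).
  by move=> mA; rewrite -[X in measurable X]setTI; exact: measurable_tcons.
move=> F mF tF mUF; rewrite /cons_measure /pushforward preimage_bigcup.
apply: measure_semi_sigma_additive.
- by move=> k; exact: mtcons.
- apply/trivIsetP => /= i j _ _ ij; rewrite -preimage_setI.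
  by move/trivIsetP : tF => /(_ _ _ _ _ ij) ->//; rewrite preimage_set0.
- by rewrite -preimage_bigcup; exact: mtcons.
Qed.

HB.instance Definition _ := isMeasure.Build _ _ _ cons_measure
  cons_measure0 cons_measure_ge0 cons_measure_sigma_additive.

Lemma sigma_finite_cons_measure : sigma_finite setT cons_measure.
Proof.
have /sigma_finiteP[F [TF ndF Foo]] := sigma_finiteT m.
have /sigma_finiteP[G [TG ndG Goo]] := sigma_finiteT mu.
pose u (t : n.+1.-tuple T) : T * n.-tuple T := (thead t, [tuple of behead t]).
have uK p : u (tcons p) = p.
  by case: p => x t; rewrite /u /tcons theadE/=; congr pair; apply: val_inj.
have mu_ : measurable_fun setT u.
  by apply: measurable_fun_pair; [exact: measurable_tnth|exact: measurable_behead].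
exists (fun i => u @^-1` (F i `*` G i)).
  apply/esym; rewrite -subTset => t _.
  have [i _ Fi] : (\bigcup_i F i) (u t).1 by rewrite -TF.
  have [j _ Gj] : (\bigcup_i G i) (u t).2 by rewrite -TG.
  exists (maxn i j) => //; split.
    by move: Fi; exact/subsetPset/ndF/leq_maxl.
  by move: Gj; exact/subsetPset/ndG/leq_maxr.
move=> k; have [mF Fk] := Foo k; have [mG Gk] := Goo k; split.
  by rewrite -[X in measurable X]setTI; apply: mu_ => //; exact: measurableX.
rewrite /cons_measure /pushforward -comp_preimage.
rewrite (_ : u \o tcons = id) ?preimage_id; last exact/funext.
by rewrite product_measure1E// lte_mul_pinfty// ge0_fin_numE.
Qed.

HB.instance Definition _ :=
  Measure_isSigmaFinite.Build _ _ _ cons_measure sigma_finite_cons_measure.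

End ConsMeasure.

Fixpoint power_measure d (T : measurableType d) (R : realType)
    (m : {sigma_finite_measure set T -> \bar R}) (n : nat) :
    {sigma_finite_measure set (n.-tuple T) -> \bar R} :=
  if n is n'.+1 then cons_measure m (power_measure m n')
  else @dirac _ (0.-tuple T) [tuple] R.

Section Distributions.
Variables (R : realType) (n : nat).
Local Notation C := R[i].
Local Notation Rn := 'rV[R]_n.
Local Notation Re := (@complex.Re R).
Local Notation Im := (@complex.Im R).
(* The modulus as an element of R; `|z| is the same number seen in R[i].       *)
Local Notation cabs := (@ComplexField.Normc.normc R).

(* Functionals are total functions (Rn -> C) -> C; a Radon measure is          *)
(* constrained only on C_c(R^n), a distribution only on the Schwartz space.    *)
Local Notation functional := ((Rn -> C) -> C).

Definition lebesgue_Rn :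
    {sigma_finite_measure set (n.-tuple (measurableTypeR R)) -> \bar R} :=
  power_measure (@lebesgue_measure R) n.

Definition integral_Rn (f : Rn -> C) : C :=
  Complex (\int[lebesgue_Rn]_u Re (f (\row_i tnth u i)))
          (\int[lebesgue_Rn]_u Im (f (\row_i tnth u i))).

Definition dot (x y : Rn) : R := \sum_i x 0 i * y 0 i.

(* e^{2 pi i x}, by Euler's formula *)
Definition cis (x : R) : C := Complex (cos (2 * pi * x)) (sin (2 * pi * x)).

Definition fourier (h : Rn -> C) : Rn -> C :=
  fun y => integral_Rn (fun x => h x * cis (- dot x y)).

Definition ccontinuous (f : Rn -> C) : Prop :=
  continuous (Re \o f) /\ continuous (Im \o f).

Definition supp (f : Rn -> C) : set Rn := closure [set x | f x != 0].

Definition Cc (f : Rn -> C) : Prop := ccontinuous f /\ compact (supp f).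

Definition pderiv (i : 'I_n) (f : Rn -> C) : Rn -> C := fun x =>
  Complex ('D_(delta_mx 0 i) (Re \o f) x) ('D_(delta_mx 0 i) (Im \o f) x).

(* Iterated partial derivatives, one for each word in the coordinates: by      *)
(* Schwarz's theorem these are the usual ones indexed by multi-indices.        *)
Definition pderivs (s : seq 'I_n) (f : Rn -> C) : Rn -> C := foldr pderiv f s.

Definition smooth (f : Rn -> C) : Prop := forall s : seq 'I_n,
  ccontinuous (pderivs s f) /\
  forall (i : 'I_n) (x : Rn),
    derivable (Re \o pderivs s f) x (delta_mx 0 i) /\
    derivable (Im \o pderivs s f) x (delta_mx 0 i).

Definition monomial (a : 'I_n -> nat) (x : Rn) : R := \prod_i x 0 i ^+ a i.

(* sup_x |x^a (D^s f)(x)| <= B *)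
Definition seminorm_le (a : 'I_n -> nat) (s : seq 'I_n) (f : Rn -> C) (B : R) :
    Prop :=
  forall x, `|monomial a x| * cabs (pderivs s f x) <= B.

Definition schwartz (h : Rn -> C) : Prop :=
  smooth h /\ forall a s, exists B : R, seminorm_le a s h B.

Definition linear_on (P : (Rn -> C) -> Prop) (T : functional) : Prop :=
  forall (a : C) (f g : Rn -> C), P f -> P g ->
    T (fun x => a * f x + g x) = a * T f + T g.

(* Continuity for the inductive limit topology of C_c(R^n), i.e. continuity    *)
(* for the sup norm on each of the subspaces {f | supp f `<=` K}, K compact.   *)
Definition radon (mu : functional) : Prop :=
  linear_on Cc mu /\
  forall (K : set Rn) (f : Rn -> C), compact K -> Cc f -> supp f `<=` K ->
  forall e : R, 0 < e -> exists2 d : R, 0 < d &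
    forall g : Rn -> C, Cc g -> supp g `<=` K ->
      (forall x, cabs (g x - f x) <= d) -> cabs (mu g - mu f) < e.

(* Continuity for the locally convex topology given by all the seminorms       *)
(* sup_x |x^a D^s h(x)|.                                                       *)
Definition tempered_distribution (T : functional) : Prop :=
  linear_on schwartz T /\
  forall f : Rn -> C, schwartz f ->
  forall e : R, 0 < e -> exists N : nat, exists2 d : R, 0 < d &
    forall g : Rn -> C, schwartz g ->
      (forall a s, (\sum_i a i <= N)%N -> (size s <= N)%N ->
        seminorm_le a s (g \- f) d) -> cabs (T g - T f) < e.

(* <mu, h> = <T, h> for all compactly supported Schwartz functions h *)
Definition agree (mu T : functional) : Prop :=
  forall h : Rn -> C, schwartz h -> compact (supp h) -> mu h = T h.

Definition tempered (mu : functional) : Prop :=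
  exists2 T : functional, tempered_distribution T & agree mu T.

(* \sum_(x \in D) is the library's sum over finite supports; it is finite here *)
(* since a closed discrete set meets the compact support of f in a finite set. *)
Definition discrete_measure (mu : functional) : Prop :=
  exists (D : set Rn) (c : Rn -> C),
    [/\ limit_point D = set0,
        forall x, D x -> c x != 0 &
        forall f : Rn -> C, Cc f -> mu f = \sum_(x \in D) c x * f x].

(* |mu|(f) for f >= 0: the supremum of |mu(g)| over g in C_c with |g| <= f.    *)
Definition abs_radon_ge0 (mu : functional) (f : Rn -> R) : R :=
  sup [set cabs (mu g) | g in [set g | Cc g /\ forall x, cabs (g x) <= f x]].

(* |mu|, extended from nonnegative functions by linearity *)
Definition abs_radon (mu : functional) : functional := fun f =>
  let tv := abs_radon_ge0 mu in
  Complex (tv ((Re \o f)^\+) - tv ((Re \o f)^\-))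
          (tv ((Im \o f)^\+) - tv ((Im \o f)^\-)).

(* The distribution Fourier transform <T^, h> = <T, h^> of the tempered        *)
(* distribution T extending mu is the Radon measure nu.                        *)
Definition fourier_transform (mu nu : functional) : Prop :=
  exists T : functional,
    [/\ tempered_distribution T, agree mu T &
        agree nu (fun h => T (fourier h))].

Definition crystalline (mu : functional) : Prop :=
  [/\ radon mu, discrete_measure mu, tempered mu &
      exists nu : functional,
        [/\ radon nu, discrete_measure nu & fourier_transform mu nu]].

(* The Radon measure nu = mu^ below is unique on C_c(R^n).                     *)
Definition fourier_quasicrystal (mu : functional) : Prop :=
  [/\ crystalline mu, tempered (abs_radon mu) &
      exists nu : functional,
        [/\ radon nu, fourier_transform mu nu & tempered (abs_radon nu)]].

Definition dirac_comb (L : set Rn) : functional := fun f => \sum_(x \in L) f x.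

(* The first clause makes \sum_(x in L) delta_x meaningful: without it the     *)
(* finite-support convention of \sum_(x \in L) could yield junk values.        *)
Definition fourier_quasicrystal_set (L : set Rn) : Prop :=
  limit_point L = set0 /\ fourier_quasicrystal (dirac_comb L).

End Distributions.

Section TorusCurve.
Variables (R : realType) (n : nat).
Local Notation C := R[i].
Local Notation m := (n + 1)%N.
Local Notation Re := (@complex.Re R).
Local Notation Im := (@complex.Im R).

Definition unit_circle : set C := [set z | `|z| = 1].

Definition lin_indep_Z (b : 'cV[R]_n) : Prop :=
  forall (k0 : int) (k : 'I_n -> int),
    k0%:~R + \sum_i (k i)%:~R * b i 0 = 0 :> R ->
    k0 = 0 /\ forall i, k i = 0.

Definition Mmat (b : 'cV[R]_n) : 'M[R]_(m, n) := col_mx 1%:M (- b^T).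

Definition psi (b : 'cV[R]_n) (x : 'rV[R]_n) : 'rV[C]_m :=
  \row_j cis ((Mmat b *m x^T) j 0).

Definition phi (s : 'I_m -> R) (gamma : 'I_m -> int) (t : R) (z : C) :
    'rV[C]_m :=
  \row_j ((z ^ gamma j - (t * s j)%:C%C) / (1 - (t * s j)%:C%C * z ^ gamma j)).

Definition curve (s : 'I_m -> R) (gamma : 'I_m -> int) (t : R) :
    set 'rV[C]_m :=
  phi s gamma t @` unit_circle.

Definition Lambda (b : 'cV[R]_n) (s : 'I_m -> R) (gamma : 'I_m -> int) (t : R) :
    set 'rV[R]_n :=
  psi b @^-1` curve s gamma t.

(* w'(0) for a path w in C^m, a real vector space containing the torus *)
Definition velocity (w : R -> 'rV[C]_m) : 'rV[C]_m :=
  \row_j Complex (((fun r => Re (w r 0 j))^`())%classic 0)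
                 (((fun r => Im (w r 0 j))^`())%classic 0).

(* The real line spanned by the velocity at phi_t(z) of the parametrization    *)
(* r |-> phi_t(z e^{2 pi i r}) of X_t.                                         *)
Definition tangent_line (s : 'I_m -> R) (gamma : 'I_m -> int) (t : R) (z : C) :
    set 'rV[C]_m :=
  [set c%:C%C *: velocity (fun r => phi s gamma t (z * cis r)) | c in [set: R]].

(* The tangent space at p of the coset p psi(R^n) (product taken in T^m).      *)
Definition leaf_tangent (b : 'cV[R]_n) (p : 'rV[C]_m) : set 'rV[C]_m :=
  [set velocity (fun r => \row_j (p 0 j * psi b (r *: v) 0 j)) |
    v in [set: 'rV[R]_n]].

Definition transverse (b : 'cV[R]_n) (s : 'I_m -> R) (gamma : 'I_m -> int)
    (t : R) : Prop :=
  forall z, unit_circle z ->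
    ~ (tangent_line s gamma t z `<=` leaf_tangent b (phi s gamma t z)).

End TorusCurve.

(* Main.v *)
(** Put [a_j = t s_j].  The Blaschke factors [(z^g_j - a_j) / (1 - a_j z^g_j)] lift to
    increasing maps [A_j] of the line with [A_j (x + 1) = A_j x + g_j].  As [b > 0], the
    function [F = A_m + sum_i b_i A_i] is a diffeomorphism of the line; with [Theta] its
    inverse and [alpha w = (A_i (Theta w))_i], the set [Lambda_t] consists of the points
    [alpha (j - b.k) + k] with [j] an integer and [k] an integer vector.  Weighting such a
    point by [tent (Theta (j - b.k))] counts each element of [Lambda_t] once, because the
    integer translates of [tent] sum to 1 and, as the [g_j] have gcd 1, [phi_t] is injective.
    Poisson summation over [k], and then over [j], turns the sum of [h^] over [Lambda_t]
    into the sum over [(l, p)] of [c_(l,p) h (p - l b)] with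
    [c_(l,p) = int tent (Theta w) e^(-2 i pi (l A_m + p.A) (Theta w)) dw].
    The substitution [w = F x] exhibits [c_(l,p)] as the integral of [tent x] against
    [e^(2 i pi x)] times an element of the disc algebra (or the conjugate of such a product)
    as soon as [l, p_1, ..., p_n] are all [<= -1] (or all [>= 1]), so that it vanishes.  Since
    [b > 0], all other [(l, p)] are bounded linearly in terms of the point [p - l b]: the dual
    measure is supported on a locally finite set, and both measures and their absolute values
    grow polynomially.  *)

Require Import Defs.
From mathcomp Require Import all_boot all_order all_algebra.
From mathcomp Require Import complex.
From mathcomp Require Import all_classical all_reals all_analysis.
From mathcomp Require Import measurable_realfun.
From mathcomp Require Import ring lra zify.

Set Implicit Arguments.
Unset Strict Implicit.
Unset Printing Implicit Defensive.

Import Order.TTheory GRing.Theory Num.Theory.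
Import numFieldNormedType.Exports.
Local Open Scope classical_set_scope.
Local Open Scope ring_scope.

(** * Unordered sums over lattices *)

Section Modulus.
Context {R : realType}.
Local Notation C := R[i].
Local Notation cabs := (@ComplexField.Normc.normc R).

(** No decay in [l] is established for the dual coefficients: the weight [chiT] is only Lipschitz,
    like the tent. Both Poisson summations therefore go through Fejer means. The kernel is
    nonnegative with mass 1 on every unit interval, which gives bounds in [k] that do not depend on
    the order of the mean, and the limit is harmless because only finitely many dual indices with a
    nonzero coefficient meet the support of [h].

    The vanishing of coefficients rests on [B A' = z B'(z)] for a Blaschke factor [B = e^(2 i pi A)]
    at [z = e^(2 i pi x)]. The density [F'] is a combination of the [A_i'], and when all exponents
    are at least 1 each [A_i'] finds a factor [B_i] to absorb it. The remaining factor [z] kills the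
    integral, since the Fourier transform of the tent vanishes at nonzero integers.

    Total variations require that masses at a common point do not cancel. On the curve side the
    weights are nonnegative; on the dual side linear independence of [1, b_1, ..., b_n] makes
    [(l, p) -> p - l b] injective, so that each point carries a single coefficient. *)

Lemma cabsD (x y : C) : cabs (x + y) <= cabs x + cabs y.
Proof. exact: (@le_normcD R x y). Qed.

Lemma cabsN (x : C) : cabs (- x) = cabs x.
Proof. exact: (@normcN R x). Qed.

Lemma cabs0 : cabs 0 = 0.
Proof. exact: ComplexField.Normc.normc0. Qed.

Lemma cabsM (x y : C) : cabs (x * y) = cabs x * cabs y.
Proof. exact: ComplexField.Normc.normcM. Qed.

Lemma cabs_ge0 (x : C) : 0 <= cabs x.
Proof. by case: x => a b /=; exact: sqrtr_ge0. Qed.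

Lemma cabs_real (x : R) : cabs x%:C%C = `|x|.
Proof. by rewrite /= expr0n addr0 sqrtr_sqr. Qed.

Lemma cabs_sum (I : Type) (r : seq I) (P : pred I) (F : I -> C) :
  cabs (\sum_(i <- r | P i) F i) <= \sum_(i <- r | P i) cabs (F i).
Proof.
elim/big_rec2: _ => [|i x y _ xy]; first by rewrite cabs0.
by apply: le_trans (cabsD _ _) _; rewrite lerD2l.
Qed.

Lemma Re_le_cabs (x : C) : `|complex.Re x| <= cabs x.
Proof.
case: x => a b /=; rewrite -sqrtr_sqr ler_sqrt ?addr_ge0 ?sqr_ge0//.
by rewrite lerDl sqr_ge0.
Qed.

Lemma Im_le_cabs (x : C) : `|complex.Im x| <= cabs x.
Proof.
case: x => a b /=; rewrite -sqrtr_sqr ler_sqrt ?addr_ge0 ?sqr_ge0//.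
by rewrite lerDr sqr_ge0.
Qed.

Lemma cabs_le_ReIm (x : C) : cabs x <= `|complex.Re x| + `|complex.Im x|.
Proof.
case: x => a b /=; rewrite -[leRHS]ger0_norm ?addr_ge0// -sqrtr_sqr.
rewrite ler_sqrt ?sqr_ge0// sqrrD !real_normK ?num_real//.
by rewrite addrAC lerDl mulrn_wge0// mulr_ge0.
Qed.

Lemma eq0_cabs (x : C) : cabs x = 0 -> x = 0.
Proof. exact: ComplexField.Normc.eq0_normc. Qed.

Lemma cabs_le_eq0 (x : C) : (forall e, 0 < e -> cabs x <= e) -> x = 0.
Proof.
move=> h; apply: eq0_cabs; apply/eqP; rewrite eq_le cabs_ge0 andbT.
by apply/ler_addgt0Pr => e e0; rewrite add0r h.
Qed.

Lemma cabsB (x y : C) : cabs (x - y) = cabs (y - x).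
Proof. by rewrite -cabsN opprB. Qed.

Lemma cabs_triangle (z x y : C) : cabs (x - y) <= cabs (x - z) + cabs (z - y).
Proof. by apply: le_trans (cabsD _ _); rewrite addrA subrK. Qed.

Lemma ReD (x y : C) : complex.Re (x + y) = complex.Re x + complex.Re y.
Proof. by case: x y => ? ? []. Qed.

Lemma ImD (x y : C) : complex.Im (x + y) = complex.Im x + complex.Im y.
Proof. by case: x y => ? ? []. Qed.

Lemma ReN (x : C) : complex.Re (- x) = - complex.Re x.
Proof. by case: x. Qed.

Lemma ImN (x : C) : complex.Im (- x) = - complex.Im x.
Proof. by case: x. Qed.

Lemma ReM (x y : C) : complex.Re (x * y) =
  complex.Re x * complex.Re y - complex.Im x * complex.Im y.
Proof. by case: x y => ? ? []. Qed.

Lemma ImM (x y : C) : complex.Im (x * y) =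
  complex.Re x * complex.Im y + complex.Im x * complex.Re y.
Proof. by case: x y => ? ? []. Qed.

Lemma Re_sum (I : Type) (r : seq I) (P : pred I) (F : I -> C) :
  complex.Re (\sum_(i <- r | P i) F i) = \sum_(i <- r | P i) complex.Re (F i).
Proof.
by elim/big_rec2: _ => // i x y _ <-; rewrite ReD.
Qed.

Lemma Im_sum (I : Type) (r : seq I) (P : pred I) (F : I -> C) :
  complex.Im (\sum_(i <- r | P i) F i) = \sum_(i <- r | P i) complex.Im (F i).
Proof.
by elim/big_rec2: _ => // i x y _ <-; rewrite ImD.
Qed.

Lemma cplx_eq (x y : C) : complex.Re x = complex.Re y ->
  complex.Im x = complex.Im y -> x = y.
Proof. by case: x y => ? ? [? ?] /= -> ->. Qed.

Lemma RC_sum (I : Type) (r : seq I) (P : pred I) (F : I -> R) :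
  (\sum_(i <- r | P i) F i)%:C%C = \sum_(i <- r | P i) (F i)%:C%C.
Proof. exact: (rmorph_sum (real_complex R)). Qed.

Lemma RCB (x y : R) : (x - y)%:C%C = x%:C%C - y%:C%C.
Proof. exact: (rmorphB (real_complex R)). Qed.

Lemma RCD (x y : R) : (x + y)%:C%C = x%:C%C + y%:C%C.
Proof. exact: (rmorphD (real_complex R)). Qed.

Lemma RCM (x y : R) : (x * y)%:C%C = x%:C%C * y%:C%C.
Proof. exact: (rmorphM (real_complex R)). Qed.

Lemma RCV (x : R) : (x^-1)%:C%C = (x%:C%C)^-1.
Proof. exact: (fmorphV (real_complex R)). Qed.

End Modulus.

Section UnorderedSums.
Context {R : realType} {I : eqType}.
Local Notation C := R[i].
Local Notation cabs := (@ComplexField.Normc.normc R).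

(** Unconditional summation: the limit along finite sets of indices ordered by inclusion, the finite
    sets being duplicate-free lists [B]. *)
Definition hassum (a : I -> C) (s : C) := forall e : R, 0 < e ->
  exists A : seq I, forall B : seq I, uniq B -> {subset A <= B} ->
    cabs (\sum_(i <- B) a i - s) <= e.

(** Summable majorants. Absolute convergence is always obtained below by comparison with a multiple
    of such a family. *)
Definition weight (w : I -> R) :=
  (forall i, 0 <= w i) /\
  exists M, forall B : seq I, uniq B -> \sum_(i <- B) w i <= M.

Lemma sum_subset (V : zmodType) (F : I -> V) (A B : seq I) :
  uniq A -> uniq B -> {subset A <= B} ->
  \sum_(i <- B) F i = \sum_(i <- A) F i + \sum_(i <- B | i \notin A) F i.
Proof.
move=> uA uB AB; rewrite (bigID (mem A))/=; congr +%R.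
rewrite -big_filter; apply: perm_big; apply: uniq_perm => //.
  exact: filter_uniq.
by move=> i; rewrite mem_filter; case: (boolP (i \in A)) => //= /AB ->.
Qed.

Lemma hassum_unique a s t : hassum a s -> hassum a t -> s = t.
Proof.
move=> hs ht; apply/eqP; rewrite -subr_eq0; apply/eqP/cabs_le_eq0 => e e0.
have e2 : 0 < e / 2 by rewrite divr_gt0.
have [A hA] := hs _ e2; have [B hB] := ht _ e2.
have u := undup_uniq (A ++ B).
have {}hA : cabs (\sum_(i <- undup (A ++ B)) a i - s) <= e / 2.
  by apply: hA => // i iA; rewrite mem_undup mem_cat iA.
have {}hB : cabs (\sum_(i <- undup (A ++ B)) a i - t) <= e / 2.
  by apply: hB => // i iA; rewrite mem_undup mem_cat iA orbT.
apply: le_trans (cabs_triangle (\sum_(i <- undup (A ++ B)) a i) _ _) _.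
by rewrite cabsB [leRHS]splitr lerD.
Qed.

Lemma hassum_lin (c : C) a b s t : hassum a s -> hassum b t ->
  hassum (fun i => c * a i + b i) (c * s + t).
Proof.
move=> hs ht e e0.
have c0 : 0 < cabs c + 1 by rewrite ltr_wpDl ?cabs_ge0.
have [|A hA] := hs (e / 2 / (cabs c + 1)); first by rewrite !divr_gt0.
have [|B hB] := ht (e / 2); first by rewrite divr_gt0.
exists (A ++ B) => D uD sD.
have {}hA : cabs (\sum_(i <- D) a i - s) <= e / 2 / (cabs c + 1).
  by apply: hA => // i iA; apply: sD; rewrite mem_cat iA.
have {}hB : cabs (\sum_(i <- D) b i - t) <= e / 2.
  by apply: hB => // i iA; apply: sD; rewrite mem_cat iA orbT.
rewrite big_split/= -mulr_sumr.
rewrite (_ : _ - _ = c * (\sum_(i <- D) a i - s) + (\sum_(i <- D) b i - t)); last by ring.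
apply: le_trans (cabsD _ _) _; rewrite [leRHS]splitr lerD// cabsM.
apply: (@le_trans _ _ ((cabs c + 1) * (e / 2 / (cabs c + 1)))).
  by apply: ler_pM; rewrite ?cabs_ge0// lerDl.
by rewrite mulrC divfK// gt_eqF.
Qed.

Lemma hassum_finite a (A : seq I) : uniq A -> (forall i, i \notin A -> a i = 0) ->
  hassum a (\sum_(i <- A) a i).
Proof.
move=> uA aA e e0; exists A => B uB AB.
by rewrite (sum_subset _ uA)// addrAC subrr add0r big1 ?cabs0 ?ltW.
Qed.

Lemma hassum_eq a b s : a =1 b -> hassum a s -> hassum b s.
Proof. by move=> /funext ->. Qed.

Lemma hassum0 : hassum (fun=> 0) 0.
Proof. by move=> e e0; exists [::] => B _ _; rewrite big1// subr0 cabs0 ltW. Qed.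

Lemma hassumZ c a s : hassum a s -> hassum (fun i => c * a i) (c * s).
Proof.
move=> hs; rewrite -[c * s]addr0; apply: hassum_eq (hassum_lin c hs hassum0).
by move=> i; rewrite addr0.
Qed.

Lemma hassumD a b s t : hassum a s -> hassum b t ->
  hassum (fun i => a i + b i) (s + t).
Proof.
move=> hs ht; rewrite -[s]mul1r; apply: hassum_eq (hassum_lin 1 hs ht).
by move=> i; rewrite mul1r.
Qed.

Lemma hassum_sum (J : Type) (r : seq J) (a : J -> I -> C) (s : J -> C) :
  (forall j, hassum (a j) (s j)) ->
  hassum (fun i => \sum_(j <- r) a j i) (\sum_(j <- r) s j).
Proof.
move=> h; elim: r => [|j r ih].
  by rewrite big_nil; apply: hassum_eq hassum0 => i; rewrite big_nil.
rewrite big_cons; apply: hassum_eq (hassumD (h j) ih) => i.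
by rewrite big_cons.
Qed.

Lemma weight_tail w : weight w -> forall e, 0 < e -> exists2 A : seq I, uniq A &
  forall B, uniq B -> (forall i, i \in B -> i \notin A) -> \sum_(i <- B) w i <= e.
Proof.
move=> [w0 [M hM]] e e0.
pose S := [set x | exists2 B : seq I, uniq B & x = \sum_(i <- B) w i].
have hS : has_sup S.
  split; first by exists 0, [::] => //; rewrite big_nil.
  by exists M => x [B uB ->]; exact: hM.
have [x [A uA ->] hA] := sup_adherent e0 hS.
exists A => // B uB BA.
have : \sum_(i <- A ++ B) w i <= sup S.
  apply: ub_le_sup; first by case: hS.
  exists (A ++ B) => //; rewrite cat_uniq uA uB andbT/=.
  by apply/hasPn => i /BA.
rewrite big_cat/=; move: hA; lra.
Qed.

(** The finite set [A] depends on the majorant and on [e] alone, not on the family [a]. This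
    uniformity is what allows a sum to be exchanged with an integral or with a limit of Fejer
    means. *)
Lemma hassum_tail w : weight w -> forall e, 0 < e -> exists2 A : seq I, uniq A &
  forall (c : R) a s B, 0 <= c -> hassum a s -> (forall i, cabs (a i) <= c * w i) ->
  uniq B -> {subset A <= B} -> cabs (s - \sum_(i <- B) a i) <= c * e.
Proof.
move=> ww e e0; have [A uA hA] := weight_tail ww e0.
exists A => // c a s B c0 has aw uB AB; apply/ler_addgt0Pr => d d0.
have [D hD] := has _ d0.
set E := undup (D ++ B).
have /hD : {subset D <= E} by move=> i iD; rewrite mem_undup mem_cat iD.
rewrite undup_uniq => /(_ isT) hE.
have BE : {subset B <= E} by move=> i iD; rewrite mem_undup mem_cat iD orbT.
apply: le_trans (cabs_triangle (\sum_(i <- E) a i) _ _) _.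
rewrite [leRHS]addrC; apply: lerD; first by rewrite cabsB.
rewrite (sum_subset _ uB _ BE) ?undup_uniq// addrAC subrr add0r.
apply: le_trans (cabs_sum _ _ _) _.
apply: (@le_trans _ _ (\sum_(i <- E | i \notin B) c * w i)).
  by apply: ler_sum => j _; exact: aw.
rewrite -mulr_sumr ler_wpM2l// -big_filter; apply: hA.
  by rewrite filter_uniq// undup_uniq.
move=> j; rewrite mem_filter => /andP[jB _]; apply: contra jB; exact: AB.
Qed.

Lemma hassum_ex w a : weight w -> (forall i, cabs (a i) <= w i) ->
  exists s, hassum a s.
Proof.
move=> [w0 [M hM]] aw.
have key (u : I -> R) : (forall i, `|u i| <= w i) ->
    exists s, hassum (fun i => (u i)%:C%C) s%:C%C.
  move=> uw.
  have pos (v : I -> R) : (forall i, 0 <= v i <= w i + w i) ->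
      exists s, hassum (fun i => (v i)%:C%C) s%:C%C.
    move=> vw; pose S := [set x | exists2 B : seq I, uniq B & x = \sum_(i <- B) v i].
    have hS : has_sup S.
      split; first by exists 0, [::] => //; rewrite big_nil.
      exists (M + M) => x [B uB ->]; apply: (@le_trans _ _ (\sum_(i <- B) (w i + w i))).
        by apply: ler_sum => i _; have /andP[] := vw i.
      by rewrite big_split/= lerD// hM.
    exists (sup S) => e e0; have [x [A uA ->] hA] := sup_adherent e0 hS.
    exists A => B uB AB; rewrite -RC_sum -RCB cabs_real.
    have : \sum_(i <- B) v i <= sup S.
      by apply: ub_le_sup; [case: hS|exists B].
    have : \sum_(i <- A) v i <= \sum_(i <- B) v i.
      rewrite (sum_subset _ uA uB AB) lerDl sumr_ge0// => i _.
      by have /andP[] := vw i.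
    rewrite ler_norml; move: hA; lra.
  (* Adding the majorant makes a real family nonnegative, and for nonnegative families the sum is
     the supremum of the partial sums; the majorant is subtracted again afterwards. *)
  have [|s hs] := pos (fun i => u i + w i).
    by move=> i; have := uw i; rewrite ler_norml; lra.
  have [|t ht] := pos w; first by move=> i; have := w0 i; lra.
  exists (s - t); have := hassum_lin (-1) ht hs.
  rewrite mulN1r addrC -RCB; apply: hassum_eq => i.
  by rewrite mulN1r addrC -RCB addrK.
have [|s hs] := key (fun i => complex.Re (a i)).
  by move=> i; apply: le_trans (aw i); exact: Re_le_cabs.
have [|t ht] := key (fun i => complex.Im (a i)).
  by move=> i; apply: le_trans (aw i); exact: Im_le_cabs.
exists ('i%C * t%:C%C + s%:C%C); apply: hassum_eq (hassum_lin 'i%C ht hs) => i.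
by rewrite addrC -complexE.
Qed.

Lemma hassum_bound w : weight w -> exists2 M : R, 0 < M & forall c a s, 0 <= c ->
  hassum a s -> (forall i, cabs (a i) <= c * w i) -> cabs s <= c * M.
Proof.
move=> ww; have [A uA hA] := hassum_tail ww ltr01.
have [w0 [M hM]] := ww; exists (`|M| + 1); first by rewrite ltr_wpDl.
move=> c a s c0 has aw; rewrite -(subrK (\sum_(i <- A) a i) s) mulrDr addrC.
apply: le_trans (cabsD _ _) _; apply: lerD; last exact: hA.
apply: le_trans (cabs_sum _ _ _) _.
apply: (@le_trans _ _ (\sum_(i <- A) c * w i)).
  by apply: ler_sum => j _; exact: aw.
by rewrite -mulr_sumr ler_wpM2l// (le_trans (hM _ uA))// ler_norm.
Qed.

(* 0 when the family is not summable. *)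
Definition usum (a : I -> C) : C := xget 0 [set s | hassum a s].

Lemma usumE a s : hassum a s -> usum a = s.
Proof.
by move=> h; rewrite /usum; case: xgetP => [x _ hx|/(_ s)//]; exact: hassum_unique hx h.
Qed.

End UnorderedSums.

(** * Integer vectors in cubes *)

Section Boxes.
Context {T : Type}.

(** Splitting a row into head and tail drives every induction on the dimension: lattice sums,
    Fubini, product kernels. The same splitting later encodes the pairs [(j, k)] and [(l, p)]. *)
Definition consv n (x : T) (u : 'rV[T]_n) : 'rV[T]_n.+1 :=
  \row_i oapp (fun j => u 0 j) x (unlift ord0 i).

Lemma consv0 n (x : T) (u : 'rV[T]_n) : consv x u 0 0 = x.
Proof. by rewrite mxE unlift_none. Qed.

Lemma consvS n (x : T) (u : 'rV[T]_n) i : consv x u 0 (lift ord0 i) = u 0 i.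
Proof. by rewrite mxE liftK. Qed.

Lemma consv_eta n (u : 'rV[T]_n.+1) : u = consv (u 0 0) (\row_i u 0 (lift ord0 i)).
Proof.
apply/rowP => i; case: (unliftP ord0 i) => [j ->|->]; last by rewrite consv0.
by rewrite consvS mxE.
Qed.

Lemma consv_inj n x y (u v : 'rV[T]_n) : consv x u = consv y v -> x = y /\ u = v.
Proof.
move=> h; split; first by have /rowP/(_ ord0) := h; rewrite !consv0.
by apply/rowP => i; have /rowP/(_ (lift ord0 i)) := h; rewrite !consvS.
Qed.

End Boxes.

Definition ibox (P : nat) : seq int := [seq k%:Z - P%:Z | k <- iota 0 (2 * P).+1].

Lemma mem_ibox P (k : int) : (k \in ibox P) = (`|k| <= P)%N.
Proof.
apply/mapP/idP => [[j]|h]; first by rewrite mem_iota => h ->; lia.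
exists (absz (k + P%:Z)); last by lia.
by rewrite mem_iota; lia.
Qed.

Lemma uniq_ibox P : uniq (ibox P).
Proof. by rewrite map_inj_uniq ?iota_uniq// => x y; lia. Qed.

Fixpoint box n (P : nat) : seq 'rV[int]_n :=
  if n is n'.+1 then [seq consv j p | j <- ibox P, p <- box n' P]
  else [:: \row_i 0].

Lemma boxS n P : box n.+1 P = [seq consv j p | j <- ibox P, p <- box n P].
Proof. by []. Qed.

Lemma mem_box n P (p : 'rV[int]_n) : (p \in box n P) = [forall i, `|p ord0 i| <= P]%N.
Proof.
elim: n p => [|n ih] p; last rewrite boxS.
  rewrite inE; apply/eqP/forallP => [_ []//|_]; apply/rowP => -[]//.
apply/allpairsP/forallP => [[[j q]/= [jP qP ->]] i|h].
  case: (unliftP ord0 i) => [k ->|->]; last by rewrite consv0 -mem_ibox.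
  by rewrite consvS; move: qP; rewrite ih => /forallP.
exists (p 0 0, \row_i p 0 (lift ord0 i)) => /=; split; last exact: consv_eta.
  by rewrite mem_ibox.
by rewrite ih; apply/forallP => i; rewrite mxE.
Qed.

Lemma uniq_box n P : uniq (box n P).
Proof.
elim: n => [//|n ih]; rewrite boxS; apply: allpairs_uniq => //; first exact: uniq_ibox.
by move=> [j p] [k q] _ _ /= h; have [-> ->] := consv_inj h.
Qed.

Lemma sum_box_cons (V : nmodType) n P (F : 'rV[int]_n.+1 -> V) :
  \sum_(p <- box n.+1 P) F p = \sum_(j <- ibox P) \sum_(p <- box n P) F (consv j p).
Proof. by rewrite boxS big_allpairs_dep. Qed.

Lemma sub_box n (B : seq 'rV[int]_n) : exists P0, forall P, (P0 <= P)%N ->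
  {subset B <= box n P}.
Proof.
elim: B => [|p B [P0 h]]; first by exists 0%N.
exists (maxn (\max_i `|p ord0 i|)%N P0) => P; rewrite geq_max => /andP[h1 h2] q.
rewrite inE => /orP[/eqP ->|]; last exact: h.
rewrite mem_box; apply/forallP => i; apply: leq_trans h1.
exact: (leq_bigmax_cond (F := fun i => `|p ord0 i|%N)).
Qed.

(** * A summable weight on the integer lattice *)

Section LatticeWeight.
Context {R : realType}.

Definition rho1 (k : int) : R := (1 + (k%:~R) ^+ 2)^-1.

(** As a product of one-variable weights it is summable over the whole lattice, and its inverse is a
    polynomial of degree 2 in each coordinate, so that polynomial decay of high enough order
    dominates it. *)
Definition rho n (p : 'rV[int]_n) : R := \prod_i rho1 (p 0 i).

Lemma rho1_gt0 k : 0 < rho1 k.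
Proof. by rewrite invr_gt0 ltr_wpDr ?sqr_ge0. Qed.

Lemma rho_gt0 n (p : 'rV[int]_n) : 0 < rho p.
Proof. by apply: prodr_gt0 => i _; exact: rho1_gt0. Qed.

Lemma rho1N k : rho1 (- k) = rho1 k.
Proof. by rewrite /rho1 mulrNz sqrrN. Qed.

Lemma sum_rho1_nat N : \sum_(k < N) rho1 k%:Z <= 3.
Proof.
(* The bound telescopes through [1 / (1 + k^2) <= 2 / k - 2 / (k + 1)] for [k >= 1]; at [N = 0] it
   is the equality [1 = 3 - 2]. *)
suff h : \sum_(k < N.+1) rho1 k%:Z <= 3 - 2 / (N.+1)%:R.
  apply: (@le_trans _ _ (\sum_(k < N.+1) rho1 k%:Z)).
    by rewrite big_ord_recr/= lerDl ltW// rho1_gt0.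
  by apply: le_trans h _; rewrite gerBl divr_ge0.
elim: N => [|N ih]; first by rewrite big_ord_recr big_ord0/= /rho1 mulr0z expr0n/= addr0 invr1; lra.
rewrite big_ord_recr/=.
suff h : rho1 N.+1%:Z <= 2 / N.+1%:R - 2 / N.+2%:R.
  apply: le_trans (lerD ih h) _; by rewrite addrA subrK.
rewrite /rho1 -[X in X / _]/(2%:R) [leRHS](_ : _ = 2 / ((N.+1)%:R * N.+2%:R)).
  have h1 : (0 : R) < N.+1%:R * N.+2%:R by rewrite mulr_gt0.
  have h2 : (0 : R) < 1 + (N.+1%:Z)%:~R ^+ 2 by rewrite ltr_wpDr ?sqr_ge0.
  rewrite ler_pdivlMr// mulrC ler_pdivrMr//.
  have : (0 : R) <= N%:R by [].
  rewrite -!natr1 (_ : (N.+1%:Z)%:~R = N%:R + 1 :> R); last by rewrite natr1.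
  by nra.
have h1 : N.+1%:R != 0 :> R by rewrite pnatr_eq0.
have h2 : N.+2%:R != 0 :> R by rewrite pnatr_eq0.
move: h1 h2; rewrite -(natr1 N.+1); move: (N.+1%:R) => x h1 h2.
by field; rewrite h1 h2.
Qed.

Lemma sum_rho1 P : \sum_(k <- ibox P) rho1 k <= 6.
Proof.
have -> : \sum_(k <- ibox P) rho1 k =
    \sum_(k <- [seq k%:Z | k <- iota 0 P.+1]) rho1 k +
    \sum_(k <- [seq - k%:Z | k <- iota 1 P]) rho1 k.
  rewrite -big_cat; apply: perm_big; apply: uniq_perm.
  - exact: uniq_ibox.
  - rewrite cat_uniq !map_inj_uniq ?iota_uniq; last 2 first.
      by move=> x y; lia.
      by move=> x y; lia.
    rewrite andbT andTb; apply/hasPn => x /mapP[y]; rewrite mem_iota => hy ->.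
    by apply/mapP => -[z]; rewrite mem_iota; lia.
  - move=> k; rewrite mem_ibox mem_cat; apply/idP/orP.
      case: k => k h; [left|right]; apply/mapP.
        by exists k => //; rewrite mem_iota; lia.
      by exists k.+1; [rewrite mem_iota; lia|lia].
    by move=> [] /mapP[x]; rewrite mem_iota => h ->; lia.
rewrite !big_map.
have h1 : \sum_(j <- iota 0 P.+1) rho1 j%:Z <= 3.
  by rewrite -[iota 0 P.+1]/(index_iota 0 P.+1) big_mkord sum_rho1_nat.
have h2 : \sum_(j <- iota 1 P) rho1 (- j%:Z) <= 3.
  apply: le_trans h1; rewrite /= big_cons (eq_bigr _ (fun i _ => rho1N _)).
  by rewrite lerDr ltW// rho1_gt0.
lra.
Qed.

Lemma rho_cons n j (p : 'rV[int]_n) : rho (consv j p) = rho1 j * rho p.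
Proof.
rewrite /rho big_ord_recl consv0; congr (_ * _); apply: eq_bigr => i _.
by rewrite consvS.
Qed.

Lemma sum_rho n P : \sum_(p <- box n P) rho p <= 6 ^+ n.
Proof.
elim: n => [|n ih]; first by rewrite /= big_seq1 /rho big_ord0.
rewrite sum_box_cons; under eq_bigr do (under eq_bigr do rewrite rho_cons; rewrite -mulr_sumr).
rewrite -mulr_suml exprS; apply: ler_pM => //; last exact: sum_rho1.
  by apply: sumr_ge0 => i _; rewrite ltW// rho1_gt0.
by apply: sumr_ge0 => i _; rewrite ltW// rho_gt0.
Qed.

Lemma weight_rho n : weight (@rho n).
Proof.
split; first by move=> p; rewrite ltW// rho_gt0.
exists (6 ^+ n) => B uB; have [P hP] := sub_box B.
apply: le_trans (sum_rho n P); rewrite (sum_subset _ uB (uniq_box n P)); last exact: hP.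
by rewrite lerDl sumr_ge0// => i _; rewrite ltW// rho_gt0.
Qed.

End LatticeWeight.

(** * Continuous functions of several variables and their integrals *)

Section RowFunctions.
Context {R : realType}.

Lemma rV_continuousP n (f : 'rV[R]_n -> R) : continuous f <->
  forall (x : 'rV[R]_n) (e : R), 0 < e -> exists2 d : R, 0 < d &
    forall y : 'rV[R]_n, (forall i, `|x 0 i - y 0 i| < d) -> `|f x - f y| <= e.
Proof.
split=> [cf x e e0|h x].
  have /cvgrPdist_le /(_ e e0) := cf x.
  move=> /nbhs_ballP[d /= d0 hd]; exists d => // y hy; apply: hd.
  by split=> // i j; rewrite (ord1 i); exact: hy.
apply/(@cvgrPdist_le _ _ _ (nbhs (x : 'rV[R]_n)) _) => e e0.
have [d d0 hd] := h x e e0.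
apply/nbhs_ballP; exists d => //= y [_ hy]; apply: hd => i.
exact: hy.
Qed.

Definition ucont n (f : 'rV[R]_n -> R) := forall e : R, 0 < e -> exists2 d : R, 0 < d &
  forall x y : 'rV[R]_n, (forall i, `|x 0 i - y 0 i| <= d) -> `|f x - f y| <= e.

Definition boxed n (A : R) (f : 'rV[R]_n -> R) :=
  forall (x : 'rV[R]_n) i, A < `|x 0 i| -> f x = 0.

(** Continuous functions supported in the cube of half-side [A]. The radius is part of the notion
    because slices of a function keep it, and because the convergence statements must be uniform
    over all functions with the same radius. *)
Definition kc n (A : R) (f : 'rV[R]_n -> R) := continuous f /\ boxed A f.

Lemma compact_cube n (A : R) :
  compact [set v : 'rV[R]_n | forall i, `[- A, A]%classic (v ord0 i)].
Proof.
apply: (@rV_compact _ _ (fun=> `[- A, A]%classic)) => i.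
exact: segment_compact.
Qed.

Lemma boxed_notin n A (f : 'rV[R]_n -> R) (x : 'rV[R]_n) : boxed A f ->
  ~ (forall i, `[- A, A]%classic (x ord0 i)) -> f x = 0.
Proof.
move=> bf /existsNP[i hi]; apply: (bf x i); rewrite ltNge; apply/negP => h.
by apply: hi; rewrite /= in_itv/= -ler_norml.
Qed.

(** Heine's theorem in the near-covering form of compactness, the radius [d] running through the
    right neighbourhoods of 0. It serves when one of the two points lies in the cube; when neither
    does, both values are 0. *)
Lemma kc_ucont n A (f : 'rV[R]_n -> R) : kc A f -> ucont f.
Proof.
move=> [cf bf] e e0.
have e2 : 0 < e / 2 by rewrite divr_gt0.
have [d d0 hd] : exists2 d : R, 0 < d & forall x y : 'rV[R]_n,
    (forall i, `[- A, A]%classic (x ord0 i)) ->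
    (forall i, `|x 0 i - y 0 i| < d) -> `|f x - f y| <= e.
  have /compact_near_coveringP := @compact_cube n A.
  move=> /(_ R (0^'+) (fun d x => forall y : 'rV[R]_n,
    (forall i, `|x 0 i - y 0 i| < d) -> `|f x - f y| <= e) _) h.
  have {h} : \forall d \near 0^'+, [set v : 'rV[R]_n |
      forall i, `[- A, A]%classic (v ord0 i)] `<=` (fun x => forall y : 'rV[R]_n,
    (forall i, `|x 0 i - y 0 i| < d) -> `|f x - f y| <= e).
    apply: h => x _.
    have /rV_continuousP/(_ x _ e2)[r r0 hr] := cf.
    have r2 : 0 < r / 2 by rewrite divr_gt0.
    exists (ball x (r / 2), [set d | d < r / 2]) => /=.
      by split; [exact: nbhsx_ballx|exact: nbhs_right_lt].
    move=> [x' d] /= [[_ xx'] dr] y x'y.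
    have h1 : `|f x - f x'| <= e / 2.
      by apply: hr => i; apply: lt_le_trans (xx' _ _) _; lra.
    have h2 : `|f x - f y| <= e / 2.
      apply: hr => i; have := xx' ord0 i; have := x'y i.
      rewrite /ball/= => h3 h4.
      by rewrite -(subrK (x' 0 i) (x 0 i)) -addrA (le_lt_trans (ler_normD _ _))//; lra.
    rewrite -(subrK (f x) (f x')) -addrA (le_trans (ler_normD _ _))//.
    by rewrite [leRHS]splitr lerD// distrC.
  move=> h; have [d [hd d0]] := filter_ex (filterI h (nbhs_right_gt 0)).
  by exists d => // x y xK; exact: hd.
exists (d / 2); first by rewrite divr_gt0.
move=> x y xy.
have [xK|xK] := pselect (forall i, `[- A, A]%classic (x ord0 i)).
  by apply: hd => // i; apply: le_lt_trans (xy i) _; lra.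
have [yK|yK] := pselect (forall i, `[- A, A]%classic (y ord0 i)).
  by rewrite distrC; apply: hd => // i; rewrite distrC; apply: le_lt_trans (xy i) _; lra.
by rewrite (@boxed_notin _ A f x)// (@boxed_notin _ A f y)// subrr normr0 ltW.
Qed.

Lemma kc_bounded n A (f : 'rV[R]_n -> R) : kc A f ->
  exists2 M : R, 0 < M & forall x, `|f x| <= M.
Proof.
move=> [cf bf].
have : bounded_set (f @` [set v : 'rV[R]_n | forall i, `[- A, A]%classic (v ord0 i)]).
  apply: compact_bounded; apply: continuous_compact (@compact_cube n A).
  exact: continuous_subspaceT.
move=> [M [_ hM]]; exists (`|M| + 1); first by rewrite ltr_wpDl.
move=> x; have [xK|xK] := pselect (forall i, `[- A, A]%classic (x ord0 i)).
  apply: hM; last by exists x.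
  by rewrite (le_lt_trans (ler_norm _))// ltrDl.
by rewrite (@boxed_notin _ A f)// normr0 addr_ge0.
Qed.

Definition row_tuple n (u : n.-tuple R) : 'rV[R]_n := \row_i tnth u i.

(** The fibres of the coordinatewise floor are boxes, and there are only countably many of them. *)
Lemma measurable_floor_row n (N : R) (g : 'rV[int]_n -> R) :
  measurable_fun [set: n.-tuple (measurableTypeR R)]
    (fun u => g (\row_i Num.floor (N * tnth u i))).
Proof.
move=> _ Y mY; rewrite setTI.
rewrite (_ : _ @^-1` Y = \bigcup_(p : 'rV[int]_n) [set u : n.-tuple (measurableTypeR R) |
   Y (g p) /\ forall i, Num.floor (N * tnth u i) = p 0 i]); last first.
  apply/seteqP; split => u /=.
    by move=> Yu; exists (\row_i Num.floor (N * tnth u i)) => //; split=> // i; rewrite mxE.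
  move=> [p _ [Yp hp]]; rewrite (_ : \row__ _ = p)//.
  by apply/rowP => i; rewrite mxE.
apply: countable_bigcupT_measurable; first exact: countableP.
move=> p; have [Yp|nYp] := pselect (Y (g p)); last first.
  by rewrite (_ : [set _ | _] = set0)//; apply/seteqP; split => // u [].
rewrite (_ : [set _ | _] = \bigcap_(i in [set: 'I_n])
   ((fun u : n.-tuple (measurableTypeR R) => tnth u i) @^-1`
   ((fun x => N * x) @^-1` `[(p 0 i)%:~R, (p 0 i + 1)%:~R[%classic))); last first.
  apply/seteqP; split => u /=.
    by move=> [_ hu] i _ /=; rewrite in_itv/= -hu floor_itv.
  move=> hu; split=> // i; have := hu i Logic.I; rewrite /= in_itv/= => h.
  exact: floor_def.
apply: fin_bigcap_measurable; first exact: finite_finset.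
move=> i _.
rewrite -[X in measurable X]setTI; apply: measurable_tnth => //.
rewrite -[X in measurable X]setTI.
have h : measurable_fun [set: measurableTypeR R] (fun x : R => N * x).
  exact: mulrl_measurable.
exact: h.
Qed.

(** A continuous function is the pointwise limit of its values at the grid points [floor(N u) / N].
    This gives measurability for the product structure on tuples without comparing it with the Borel
    sets of the row space. *)
Lemma measurable_row n (f : 'rV[R]_n -> R) : continuous f ->
  measurable_fun [set: n.-tuple (measurableTypeR R)] (f \o @row_tuple n).
Proof.
move=> cf.
pose h (N : nat) (u : n.-tuple (measurableTypeR R)) : R :=
  f (\row_i ((Num.floor (N.+1%:R * tnth u i))%:~R / N.+1%:R)).
apply: (@measurable_fun_cvg _ _ _ _ h) => [N|u _].
  have := @measurable_floor_row n N.+1%:R (fun p => f (\row_i ((p 0 i)%:~R / N.+1%:R))).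
  by apply: eq_measurable_fun => u _; congr f; apply/rowP => i; rewrite !mxE.
apply/cvgrPdist_le => e e0.
have /rV_continuousP/(_ (row_tuple u) _ e0)[d d0 hd] := cf.
near=> N; apply: hd => i; rewrite !mxE.
have N0 : 0 < N.+1%:R :> R by [].
have : `|N.+1%:R * tnth u i - (Num.floor (N.+1%:R * tnth u i))%:~R| <= 1.
  have := floor_itv (N.+1%:R * tnth u i); rewrite intrD ler_norml; lra.
move=> h1; rewrite -(ltr_pM2l N0) -{1}(gtr0_norm N0) -normrM mulrBr.
rewrite mulrCA mulfV ?gt_eqF// mulr1; apply: le_lt_trans h1 _.
rewrite mulrC -ltr_pdivrMl// mulr1.
apply: (@lt_le_trans _ _ N%:R); last by rewrite ler_nat.
near: N; exact: nbhs_infty_gtr.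
Unshelve. all: by end_near. Qed.
End RowFunctions.

(** * Integrals over the row space and Fubini's theorem *)

Section RowIntegral.
Context {R : realType}.
Local Notation lam := (@lebesgue_measure R).

Definition intR n (f : 'rV[R]_n -> R) : R :=
  \int[lebesgue_Rn R n]_u f (row_tuple u).

Definition tcube n (A : R) : set (n.-tuple (measurableTypeR R)) :=
  [set u | forall i, `[- A, A]%classic (tnth u i)].

Lemma measurable_tcube n A : measurable (@tcube n A).
Proof.
rewrite (_ : tcube A = \bigcap_(i in [set: 'I_n])
   ((fun u : n.-tuple (measurableTypeR R) => tnth u i) @^-1` `[- A, A]%classic)).
  apply: fin_bigcap_measurable; first exact: finite_finset.
  move=> i _; rewrite -[X in measurable X]setTI; exact: measurable_tnth.
by apply/seteqP; split => u /= h i; [move=> _; exact: h|exact: h].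
Qed.

Lemma tcube_fin n A : (lebesgue_Rn R n (@tcube n A) < +oo)%E.
Proof.
elim: n => [|n ih].
  by rewrite /lebesgue_Rn/= diracE ltry.
have -> : lebesgue_Rn R n.+1 (@tcube n.+1 A) =
    (lam \x lebesgue_Rn R n)%E (`[- A, A]%classic `*` @tcube n A).
  rewrite /= /cons_measure /pushforward; congr (_ _).
  apply/seteqP; split => -[x u] /= h.
    split=> [|i]; first by have := h ord0; rewrite tnth0.
    by have := h (lift ord0 i); rewrite tnthS.
  case: h => hx hu i; case: (unliftP ord0 i) => [j ->|->]; last by rewrite tnth0.
  by rewrite tnthS; exact: hu.
rewrite product_measure1E//; last exact: measurable_tcube.
have E : lam `[- A, A]%classic = _ := lebesgue_measure_itv `[- A, A]%R.
apply: lte_mul_pinfty => //; change (lam `[- A, A]%classic \is a fin_num).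
by rewrite E /=; case: ifP.
Qed.

Definition vcube n (A : R) : R := fine (lebesgue_Rn R n (@tcube n A)).

Lemma kc_integrable n A (f : 'rV[R]_n -> R) : kc A f ->
  (lebesgue_Rn R n).-integrable setT (EFin \o (f \o @row_tuple R n)).
Proof.
move=> kf; have [M M0 hM] := kc_bounded kf; have [cf bf] := kf.
have -> : EFin \o (f \o @row_tuple R n) = (EFin \o (f \o @row_tuple R n)) \_ (tcube A).
  apply/funext => u; rewrite /patch; case: ifPn => // /negP; rewrite inE => h.
  rewrite /= (@boxed_notin _ _ A f)// => h2; apply: h => i.
  by have := h2 i; rewrite mxE.
apply: (iffLR (integrable_mkcond _ _)); first exact: measurable_tcube.
apply: measurable_bounded_integrable; first exact: measurable_tcube.
- exact: tcube_fin.
- by apply: measurable_funTS; exact: measurable_row.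
- by exists M; split; [exact: num_real|move=> x Mx u _ /=; rewrite (le_trans (hM _))// ltW].
Qed.

Lemma intR_lin n A c (f g : 'rV[R]_n -> R) : kc A f -> kc A g ->
  intR (fun x => c * f x + g x) = c * intR f + intR g.
Proof.
move=> /kc_integrable kf /kc_integrable kg.
rewrite /intR RintegralD//=; last exact: (integrableZl measurableT c kf).
by rewrite RintegralZl.
Qed.

Lemma intR_ext n (f g : 'rV[R]_n -> R) : f =1 g -> intR f = intR g.
Proof. by move=> /funext ->. Qed.

Lemma intR_bound n A (M : R) (f : 'rV[R]_n -> R) : kc A f -> (forall x, `|f x| <= M) ->
  `|intR f| <= M * vcube n A.
Proof.
move=> kf hM; have [cf bf] := kf; have ki := kc_integrable kf.
have mT : measurable (@tcube n A) by exact: measurable_tcube.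
have kn : (lebesgue_Rn R n).-integrable setT
  (EFin \o (fun x : n.-tuple (measurableTypeR R) => `|f (row_tuple x)|)).
  exact: (integrable_norm ki).
apply: le_trans (le_normr_Rintegral measurableT ki) _.
rewrite (_ : \int[_]_u _ = \int[lebesgue_Rn R n]_(u in tcube A) `|f (row_tuple u)|).
  rewrite -(@Rintegral_cst _ _ _ (lebesgue_Rn R n) (tcube A) mT M).
  apply: le_Rintegral; first exact: measurable_tcube.
  - by apply: (@integrableS _ _ _ _ setT) kn => //; exact: measurable_tcube.
  - apply: measurable_bounded_integrable; first exact: measurable_tcube.
    + exact: tcube_fin.
    + exact: measurable_cst.
    + by exists `|M|; split; [exact: num_real|move=> x Mx u _ /=; rewrite ltW].
  - by move=> u _.
rewrite [RHS]Rintegral_mkcond; congr (Rintegral _ _ _); apply/funext => u.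
rewrite /patch; case: ifPn => // /negP; rewrite inE => h.
rewrite /= (@boxed_notin _ _ A f)// ?normr0// => h2; apply: h => i.
by have := h2 i; rewrite mxE.
Qed.

Lemma row_tcons n (x : R) (u : n.-tuple R) :
  row_tuple (tcons (x, u) : n.+1.-tuple (measurableTypeR R)) = consv x (row_tuple u).
Proof.
apply/rowP => i; rewrite mxE; case: (unliftP ord0 i) => [j ->|->].
  by rewrite consvS mxE tnthS.
by rewrite consv0 tnth0.
Qed.

Lemma consv_continuous n (x : R) (f : 'rV[R]_n.+1 -> R) : continuous f ->
  continuous (fun u => f (consv x u)).
Proof.
move=> /rV_continuousP cf; apply/rV_continuousP => u e e0.
have [d d0 hd] := cf (consv x u) e e0; exists d => // v uv; apply: hd => i.
case: (unliftP ord0 i) => [j ->|->]; first by rewrite !consvS.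
by rewrite !consv0 subrr normr0.
Qed.

Lemma kc_consv n A x (f : 'rV[R]_n.+1 -> R) : kc A f -> kc A (fun u => f (consv x u)).
Proof.
move=> [cf bf]; split; first exact: consv_continuous.
by move=> u i hi; apply: (bf _ (lift ord0 i)); rewrite consvS.
Qed.

Lemma kc_integrable2 n A (f : 'rV[R]_n.+1 -> R) : kc A f ->
  (lam \x lebesgue_Rn R n)%E.-integrable setT
    (fun p => (f (consv p.1 (row_tuple p.2)))%:E).
Proof.
move=> kf; have [M M0 hM] := kc_bounded kf; have [cf bf] := kf.
pose S : set (measurableTypeR R * n.-tuple (measurableTypeR R)) :=
  @tcons _ (measurableTypeR R) n @^-1` tcube A.
have mS : measurable S.
  by rewrite -[S]setTI; apply: measurable_tcons => //; exact: measurable_tcube.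
have -> : (fun p : R * n.-tuple R => (f (consv p.1 (row_tuple p.2)))%:E) =
    (EFin \o ((f \o @row_tuple R n.+1) \o @tcons _ (measurableTypeR R) n)) \_ S.
  apply/funext => -[x u]; rewrite /patch -row_tcons; case: ifPn => // /negP; rewrite inE => h.
  rewrite /= (@boxed_notin _ _ A f)// => h2; apply: h => i.
  by have := h2 i; rewrite mxE.
apply: (iffLR (integrable_mkcond _ _)); first exact: mS.
apply: measurable_bounded_integrable => //.
- exact: (@tcube_fin n.+1 A).
- apply: measurable_funTS; apply: measurableT_comp; first exact: measurable_row.
  exact: measurable_tcons.
- by exists M; split; [exact: num_real|move=> x Mx u _ /=; rewrite (le_trans (hM _))// ltW].
Qed.

Lemma intR_prod n A (f : 'rV[R]_n.+1 -> R) : kc A f ->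
  intR f = fine (\int[lam \x lebesgue_Rn R n]_p (f (consv p.1 (row_tuple p.2)))%:E)%E.
Proof.
move=> kf; have [cf bf] := kf; rewrite /intR /Rintegral; congr fine.
have := @integral_pushforward _ _ _ _ R _
  (@measurable_tcons _ (measurableTypeR R) n) (lam \x lebesgue_Rn R n)%E setT
  (EFin \o (f \o @row_tuple R n.+1)).
move=> -> //.
- by rewrite preimage_setT; apply: eq_integral => -[x u] _ /=; rewrite row_tcons.
- by apply/measurable_EFinP; exact: measurable_row.
- rewrite preimage_setT; apply: eq_integrable (kc_integrable2 kf) => //.
  by move=> -[x u] _ /=; rewrite row_tcons.
Qed.

Lemma intR_cons n A (f : 'rV[R]_n.+1 -> R) : kc A f ->
  intR f = \int[lam]_x intR (fun u => f (consv x u)).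
Proof.
move=> kf; rewrite (intR_prod kf) /Rintegral; congr fine.
rewrite -(integral12_prod_meas1 (kc_integrable2 kf)); apply: eq_integral => x _.
rewrite /fubini_F /intR /Rintegral fineK//.
exact: (integrable_fin_num measurableT (kc_integrable (kc_consv x kf))).
Qed.

Lemma intR_cons_integrable n A (f : 'rV[R]_n.+1 -> R) : kc A f ->
  lam.-integrable setT (fun x => (intR (fun u => f (consv x u)))%:E).
Proof.
move=> kf; apply: eq_integrable (integrable_fubini_F (kc_integrable2 kf)) => //.
move=> x _; rewrite /fubini_F /intR /Rintegral fineK//.
exact: (integrable_fin_num measurableT (kc_integrable (kc_consv x kf))).
Qed.

Lemma continuous_kc1_integrable A (f : R -> R) : continuous f ->
  (forall x, A < `|x| -> f x = 0) -> lam.-integrable setT (EFin \o f).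
Proof.
move=> cf bf.
have -> : EFin \o f = (EFin \o f) \_ `[- A, A].
  apply/funext => x; rewrite /patch; case: ifPn => // /negP; rewrite inE/= in_itv/= => h.
  by rewrite /= bf// ltNge; apply/negP; rewrite ler_norml.
apply: (iffLR (integrable_mkcond _ _)); first exact: measurable_itv.
apply: continuous_compact_integrable; first exact: segment_compact.
exact: continuous_subspaceT.
Qed.

Lemma consv_continuous1 n (u : 'rV[R]_n) (f : 'rV[R]_n.+1 -> R) : continuous f ->
  continuous (fun x => f (consv x u)).
Proof.
move=> /rV_continuousP cf x; apply/cvgrPdist_le => e e0.
have [d d0 hd] := cf (consv x u) e e0.
near=> y; apply: hd => i.
case: (unliftP ord0 i) => [j ->|->]; first by rewrite !consvS subrr normr0.
rewrite !consv0; near: y; exact: cvgr_dist_lt.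
Unshelve. all: by end_near. Qed.

(** Fubini with the head variable innermost, the order needed to apply the fundamental theorem of
    calculus in that variable. *)
Lemma intR_cons_swap n A (f : 'rV[R]_n.+1 -> R) : kc A f ->
  intR f = intR (fun u => \int[lam]_x f (consv x u)).
Proof.
move=> kf; have [cf bf] := kf; rewrite (intR_prod kf) /intR /Rintegral; congr fine.
rewrite -(integral21_prod_meas1 (kc_integrable2 kf)); apply: eq_integral => u _.
rewrite /fubini_G fineK//; apply: (integrable_fin_num measurableT).
apply: (@continuous_kc1_integrable A); first exact: consv_continuous1.
by move=> x hx; apply: (bf _ ord0); rewrite consv0.
Qed.

End RowIntegral.

(** * Trigonometry *)

Section Trigonometry.
Context {R : realType}.
Local Notation C := R[i].
Local Notation cabs := (@ComplexField.Normc.normc R).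

Lemma cis0 : cis 0 = 1 :> C.
Proof. by rewrite /cis mulr0 cos0 sin0. Qed.

Lemma cisD (x y : R) : cis (x + y) = cis x * cis y.
Proof.
by rewrite /cis mulrDr cosD sinD; apply: cplx_eq => //=; rewrite addrC.
Qed.

Lemma cabs_cis (x : R) : cabs (cis x) = 1.
Proof. by rewrite /= cos2Dsin2 sqrtr1. Qed.

Lemma cisNM (x : R) : cis (- x) * cis x = 1.
Proof. by rewrite -cisD addNr cis0. Qed.

Lemma cis_neq0 (x : R) : cis x != 0.
Proof.
by apply/eqP => h; have := cabs_cis x; rewrite h cabs0 => /esym/eqP; rewrite oner_eq0.
Qed.

Lemma cisV (x : R) : cis (- x) = (cis x)^-1.
Proof. by rewrite -[LHS](mulfK (cis_neq0 x)) cisNM mul1r. Qed.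

Lemma cis_natmul (x : R) (k : nat) : cis (x *+ k) = cis x ^+ k.
Proof. by elim: k => [|k ih]; rewrite ?mulr0n ?cis0// mulrS cisD ih exprS. Qed.

Lemma cis_intmul (x : R) (k : int) : cis (k%:~R * x) = cis x ^ k.
Proof.
rewrite mulrzl; case: k => k; first exact: cis_natmul.
by rewrite -[RHS]/((cis x ^+ k.+1)^-1) NegzE mulrNz cisV cis_natmul.
Qed.

Lemma cis1 : cis 1 = 1 :> C.
Proof. by rewrite /cis mulr1 [2 * pi]mulrC mulr_natr cos2pi sin2pi. Qed.

Lemma cis_int (k : int) : cis k%:~R = 1 :> C.
Proof. by rewrite -[k%:~R]mulr1 cis_intmul cis1 exp1rz. Qed.

(** The fractional part [r] of [x] satisfies [1 = cos (2 pi r) = 1 - 2 sin^2 (pi r)], while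
    [sin (pi r) > 0] for [0 < r < 1]. *)
Lemma cis_eq1 (x : R) : cis x = 1 -> exists k : int, x = k%:~R.
Proof.
move=> h; exists (Num.floor x).
set r := x - (Num.floor x)%:~R.
have hr : cis r = 1 by rewrite /r cisD h mul1r -mulrNz cis_int.
suff : r = 0 by rewrite /r; lra.
have /andP[r0 r1] : 0 <= r < 1 by have := floor_itv x; rewrite /r intrD; lra.
apply/eqP; move: r0; rewrite le_eqVlt => /orP[/eqP <-//|r0].
have : 0 < sin (pi * r) :> R.
  by apply: sin_gt0_pi; rewrite mulr_gt0 ?pi_gt0//= gtr_pMr ?pi_gt0.
have := congr1 (@complex.Re R) hr; rewrite /cis /= -mulrA mulrC mulr_natr.
rewrite cos_mulr2n => h1 h2; have := cos2Dsin2 (pi * r).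
by rewrite expr2 (expr2 (sin _)); move: h1; rewrite mulr2n expr2; nra.
Qed.

Lemma cis_eq (x y : R) : cis x = cis y -> exists k : int, x = y + k%:~R.
Proof.
move=> h; have [|k hk] := @cis_eq1 (x - y).
  by rewrite cisD h mulrC cisNM.
by exists k; rewrite -hk addrC subrK.
Qed.

Lemma cis_surj (z : C) : cabs z = 1 -> exists x : R, z = cis x.
Proof.
case: z => a b /= h.
have ab : a ^+ 2 + b ^+ 2 = 1.
  rewrite -[LHS]sqr_sqrtr ?addr_ge0 ?sqr_ge0//; by rewrite h expr1n.
have a1 : -1 <= a <= 1.
  have := sqr_ge0 b; move: ab; rewrite !expr2; nra.
have twopi : (2 * pi : R) != 0 by rewrite mulf_neq0// gt_eqF// pi_gt0.
have sa : sin (acos a) = `|b|.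
  by rewrite sin_acos// -ab addrAC subrr add0r sqrtr_sqr.
have [b0|b0] := leP 0 b.
  exists (acos a / (2 * pi)); rewrite /cis mulrC divfK// acosK ?in_itv//=.
  by rewrite sa ger0_norm.
exists (- (acos a / (2 * pi))); rewrite /cis mulrN mulrC divfK// cosN sinN.
by rewrite acosK ?in_itv//= sa ltr0_norm// opprK.
Qed.

Lemma is_derive_lin (a x : R) : is_derive x 1 (fun y : R => a * y) a.
Proof.
by apply: is_derive_eq; rewrite ?scaler0 ?addr0 ?add0r//; rewrite /GRing.scale/= mulr1.
Qed.

Lemma is_derive_cosl (a x : R) :
  is_derive x 1 (fun y : R => cos (a * y)) (- (a * sin (a * x))).
Proof.
have h := @is_derive1_comp _ cos (fun y : R => a * y) x _ _
  (is_derive_cos _) (is_derive_lin a x).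
by apply: is_derive_eq h _; rewrite mulNr mulrC.
Qed.

Lemma is_derive_sinl (a x : R) :
  is_derive x 1 (fun y : R => sin (a * y)) (a * cos (a * x)).
Proof.
have h := @is_derive1_comp _ sin (fun y : R => a * y) x _ _
  (is_derive_sin _) (is_derive_lin a x).
by apply: is_derive_eq h _; rewrite mulrC.
Qed.

Lemma is_derive_continuous (f g : R -> R) :
  (forall x : R, is_derive x (1 : R) f (g x)) -> continuous f.
Proof.
move=> h x; apply/differentiable_continuous/derivable1_diffP.
by have [] := h x.
Qed.

Lemma mvt_bound (f g : R -> R) (m M : R) : (forall x : R, is_derive x (1 : R) f (g x)) ->
  (forall x, m <= g x <= M) -> forall x y, x <= y ->
  m * (y - x) <= f y - f x <= M * (y - x).
Proof.
move=> df hg x y; rewrite le_eqVlt => /orP[/eqP ->|xy]; first by rewrite !subrr !mulr0 lexx.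
have [|c _ ->] := @MVT R f g x y xy (fun z _ => df z).
  exact/continuous_subspaceT/is_derive_continuous.
have := hg c; have : 0 < y - x by rewrite subr_gt0.
by nra.
Qed.

Lemma lipschitz_of_deriv (f g : R -> R) (M : R) :
  (forall x : R, is_derive x (1 : R) f (g x)) -> (forall x, `|g x| <= M) ->
  forall x y, `|f x - f y| <= M * `|x - y|.
Proof.
move=> df hg x y.
have hg' z : - M <= g z <= M by rewrite -ler_norml.
have [xy|/ltW xy] := leP x y.
  have := mvt_bound df hg' xy; rewrite distrC (distrC x).
  by rewrite (@ger0_norm _ (y - x)) ?subr_ge0// ler_norml mulNr.
have := mvt_bound df hg' xy.
by rewrite (@ger0_norm _ (x - y)) ?subr_ge0// ler_norml mulNr.
Qed.

Lemma cos_bound (x : R) : `|cos x| <= 1.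
Proof. by rewrite ler_norml cos_geN1 cos_le1. Qed.

Lemma sin_bound (x : R) : `|sin x| <= 1.
Proof. by rewrite ler_norml sin_geN1 sin_le1. Qed.

Lemma cis_lip (x y : R) : cabs (cis x - cis y) <= 4 * pi * `|x - y|.
Proof.
apply: le_trans (cabs_le_ReIm _) _.
have p0 : (0 : R) <= 2 * pi by rewrite mulr_ge0 ?pi_ge0.
rewrite (_ : 4 * pi * _ = 2 * pi * `|x - y| + 2 * pi * `|x - y|); last by ring.
apply: lerD => /=.
  apply: (lipschitz_of_deriv (is_derive_cosl (2 * pi))) => z.
  by rewrite normrN normrM (ger0_norm p0) ler_piMr// sin_bound.
apply: (lipschitz_of_deriv (is_derive_sinl (2 * pi))) => z.
by rewrite normrM (ger0_norm p0) ler_piMr// cos_bound.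
Qed.

Lemma continuous_cosl (a : R) : continuous (fun x : R => cos (a * x)).
Proof. exact: is_derive_continuous (is_derive_cosl a). Qed.

Lemma continuous_sinl (a : R) : continuous (fun x : R => sin (a * x)).
Proof. exact: is_derive_continuous (is_derive_sinl a). Qed.

Lemma Rintegral_deriv (F f : R -> R) (a b : R) : a <= b ->
  (forall x : R, is_derive x (1 : R) F (f x)) -> continuous f ->
  \int[lebesgue_measure]_(x in `[a, b]) f x = F b - F a.
Proof.
rewrite le_eqVlt => /orP[/eqP <- _ _|ab dF cf].
  by rewrite set_itv1 Rintegral_set1 subrr.
have cF := is_derive_continuous dF.
rewrite /Rintegral (@continuous_FTC2 _ f F)//.
- exact: continuous_subspaceT.
- split; first by move=> x _; have [] := dF x.
  + by apply: cvg_at_right_filter; exact: cF.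
  + by apply: cvg_at_left_filter; exact: cF.
- by move=> x _; rewrite derive1E; have [_] := dF x.
Qed.

Lemma Rintegral_kc1 (f : R -> R) (A B : R) : A <= B ->
  (forall x, A < `|x| -> f x = 0) ->
  \int[lebesgue_measure]_x f x = \int[lebesgue_measure]_(x in `[- B, B]) f x.
Proof.
move=> AB bf; rewrite [RHS]Rintegral_mkcond; congr (Rintegral _ _ _); apply/funext => x.
rewrite /patch; case: ifPn => // /negP; rewrite inE/= in_itv/= => h.
rewrite bf//; apply: le_lt_trans AB _; rewrite ltNge; apply/negP.
by rewrite ler_norml.
Qed.

End Trigonometry.

(** * Decay of Fourier transforms *)

Section Decay.
Context {R : realType}.
Local Notation C := R[i].
Local Notation cabs := (@ComplexField.Normc.normc R).
Local Notation Re := (@complex.Re R).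
Local Notation Im := (@complex.Im R).

(** A directional derivative sees only the restriction of the function to a line. Partial
    derivatives on the row space thereby become derivatives on a space of lower dimension or on the
    line itself, and translations come for free. *)
Lemma is_derive_line (V V' : normedModType R) (f : V -> R) (f' : V' -> R)
    (a v : V) (a' v' : V') (d : R) :
  (forall h : R, f (h *: v + a) = f' (h *: v' + a')) ->
  is_derive a v f d -> is_derive a' v' f' d.
Proof.
move=> ff' df.
have E : (fun h : R => h^-1 *: ((f \o shift a) (h *: v) - f a)) =
         (fun h : R => h^-1 *: ((f' \o shift a') (h *: v') - f' a')).
  apply/funext => h /=; have := ff' 0; rewrite !scale0r !add0r => ->.
  by rewrite ff'.
have [df1 df2] := df; split; first by rewrite /derivable -E.
by rewrite -df2 /derive -E.
Qed.

Lemma consv_line n (t h : R) (u v : 'rV[R]_n) :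
  consv t (h *: v + u) = h *: consv 0 v + consv t u.
Proof.
apply/rowP => i; rewrite !mxE; case: unliftP => [j _|_] /=; first by rewrite !mxE.
by rewrite mulr0 add0r.
Qed.

Lemma delta_lift n (i : 'I_n) :
  delta_mx 0 (lift ord0 i) = consv 0 (delta_mx 0 i) :> 'rV[R]_n.+1.
Proof.
apply/rowP => j; rewrite !mxE /=; case: (unliftP ord0 j) => [k ->|->] /=.
  by rewrite mxE eqxx (inj_eq lift_inj).
by [].
Qed.

(** By induction on the dimension: a derivative in a tail variable is integrated over the slices
    first, and one in the head variable integrates to a difference of two boundary values outside
    the support. This replaces integration by parts. *)
Lemma intR_pder0 n A (f g : 'rV[R]_n -> R) (i : 'I_n) : kc A f -> kc A g ->
  (forall x, is_derive x (delta_mx 0 i : 'rV[R]_n) f (g x)) -> intR g = 0.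
Proof.
elim: n f g i => [|n ih] f g i kf kg fg; first by case: (i) => -[].
case: (unliftP ord0 i) fg => [j ->|->] fg.
  rewrite (intR_cons kg) (eq_Rintegral _ (g := fun=> 0)) ?Rintegral0//.
    by rewrite /Rintegral integral0.
  move=> t _; apply: (ih (fun u => f (consv t u)) _ j); try exact: kc_consv.
  move=> u; apply: is_derive_line (fg (consv t u)) => h.
  by rewrite consv_line delta_lift.
rewrite (intR_cons_swap kg) (intR_ext (g := fun=> 0)) ?/intR//.
  by rewrite /Rintegral integral0.
move=> u; have [cf bf] := kf; have [cg bg] := kg.
(* Vanishing is known only where the coordinate exceeds [A] strictly, and [A] may be negative: the
   endpoints [|A| + 1] and its opposite lie outside the support in all cases. *)
rewrite (@Rintegral_kc1 _ _ A (`|A| + 1)); last 2 first.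
- by rewrite (le_trans (ler_norm _))// lerDl.
- by move=> x hx; apply: (bg _ ord0); rewrite consv0.
have h1 : A < `|A| + 1 by rewrite (le_lt_trans (ler_norm _))// ltrDl.
have dF (x : R) : is_derive x (1 : R) (fun x => f (consv x u)) (g (consv x u)).
  apply: is_derive_line (fg (consv x u)) => h.
  congr f; apply/rowP => k; rewrite !mxE /=; case: (unliftP ord0 k) => [l ->|->] /=.
    by rewrite mulr0 add0r.
  by [].
rewrite (Rintegral_deriv _ dF).
- by rewrite !(bf _ ord0) ?subrr// consv0 ?normrN ger0_norm.
- by rewrite (@le_trans _ _ 0)// ?oppr_le0.
- exact: consv_continuous1.
Qed.

Definition ckc n A (f : 'rV[R]_n -> C) := kc A (Re \o f) /\ kc A (Im \o f).

Lemma ckcP n A (f : 'rV[R]_n -> C) : ckc A f <->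
  ccontinuous f /\ forall (x : 'rV[R]_n) i, A < `|x 0 i| -> f x = 0.
Proof.
split=> [[[cr br] [ci bi]]|[[cr ci] b]].
  by split=> // x i hx; apply: cplx_eq; [exact: br hx|exact: bi hx].
by split; split=> // x i hx /=; rewrite (b x i).
Qed.

Lemma kc_mul n A (f g : 'rV[R]_n -> R) : kc A f -> continuous g ->
  kc A (fun x => f x * g x).
Proof.
move=> [cf bf] cg; split=> [x|x i hx]; last by rewrite (bf x i)// mul0r.
by apply: continuousM; [exact: cf|exact: cg].
Qed.

Lemma kc_add n A (f g : 'rV[R]_n -> R) : kc A f -> kc A g ->
  kc A (fun x => f x + g x).
Proof.
move=> [cf bf] [cg bg]; split=> [x|x i hx]; last by rewrite (bf x i)// (bg x i)// addr0.
by apply: continuousD; [exact: cf|exact: cg].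
Qed.

Lemma kc_scale n A c (f : 'rV[R]_n -> R) : kc A f -> kc A (fun x => c * f x).
Proof.
move=> kf; rewrite (_ : (fun _ => _) = (fun x => f x * c)).
  by apply: kc_mul => // x; exact: cst_continuous.
by apply/funext => x; rewrite mulrC.
Qed.

Lemma ckc_mul n A (f g : 'rV[R]_n -> C) : ckc A f -> ccontinuous g ->
  ckc A (fun x => f x * g x).
Proof.
move=> [fr fi] [gr gi]; split.
  rewrite (_ : Re \o _ = fun x => Re (f x) * Re (g x) + (-1) * (Im (f x) * Im (g x))).
    by apply: kc_add; [exact: kc_mul|apply: kc_scale; exact: kc_mul].
  by apply/funext => x /=; rewrite ReM mulN1r.
rewrite (_ : Im \o _ = fun x => Re (f x) * Im (g x) + Im (f x) * Re (g x)).
  by apply: kc_add; exact: kc_mul.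
by apply/funext => x /=; rewrite ImM.
Qed.

Lemma ckc_add n A (f g : 'rV[R]_n -> C) : ckc A f -> ckc A g ->
  ckc A (fun x => f x + g x).
Proof.
move=> [fr fi] [gr gi]; split.
  rewrite (_ : Re \o _ = fun x => Re (f x) + Re (g x)); first exact: kc_add.
  by apply/funext => x /=; rewrite ReD.
rewrite (_ : Im \o _ = fun x => Im (f x) + Im (g x)); first exact: kc_add.
by apply/funext => x /=; rewrite ImD.
Qed.

Lemma ckc_scale n A c (f : 'rV[R]_n -> C) : ckc A f -> ckc A (fun x => c * f x).
Proof.
move=> kf; rewrite (_ : (fun _ => _) = (fun x => f x * c)).
  by apply: ckc_mul => //; split=> x; exact: cst_continuous.
by apply/funext => x; rewrite mulrC.
Qed.

Lemma integral_RnE n (f : 'rV[R]_n -> C) :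
  integral_Rn f = Complex (intR (Re \o f)) (intR (Im \o f)).
Proof. by []. Qed.

Lemma integral_Rn_lin n A c (f g : 'rV[R]_n -> C) : ckc A f -> ckc A g ->
  integral_Rn (fun x => c * f x + g x) = c * integral_Rn f + integral_Rn g.
Proof.
move=> [fr fi] [gr gi]; rewrite !integral_RnE.
have k1 : kc A (fun x => (- Im c) * Im (f x) + Re (g x)).
  by apply: kc_add => //; apply: kc_scale.
have k2 : kc A (fun x => Im c * Re (f x) + Im (g x)).
  by apply: kc_add => //; apply: kc_scale.
rewrite (intR_ext (g := fun x => Re c * Re (f x) + ((- Im c) * Im (f x) + Re (g x)))); last first.
  by move=> x /=; rewrite ReD ReM addrA mulNr.
rewrite (intR_lin _ fr k1) (intR_lin _ fi gr).
rewrite (intR_ext (f := Im \o (fun x => c * f x + g x))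
  (g := fun x => Re c * Im (f x) + (Im c * Re (f x) + Im (g x)))); last first.
  by move=> x /=; rewrite ImD ImM addrA.
rewrite (intR_lin _ fi k2) (intR_lin _ fr gi).
by apply: cplx_eq; rewrite ?ReD ?ImD ?ReM ?ImM /= addrA ?mulNr.
Qed.

Lemma integral_Rn_bound n A (M : R) (f : 'rV[R]_n -> C) : ckc A f ->
  (forall x, cabs (f x) <= M) -> cabs (integral_Rn f) <= M * vcube n A + M * vcube n A.
Proof.
move=> [fr fi] hM; apply: le_trans (cabs_le_ReIm _) _.
rewrite integral_RnE; apply: lerD; apply: intR_bound => // x.
  by apply: le_trans (hM x); exact: Re_le_cabs.
by apply: le_trans (hM x); exact: Im_le_cabs.
Qed.

Lemma ckc_bounded n A (f : 'rV[R]_n -> C) : ckc A f ->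
  exists2 M : R, 0 < M & forall x, cabs (f x) <= M.
Proof.
move=> [/kc_bounded[M M0 hM] /kc_bounded[N N0 hN]]; exists (M + N); first exact: addr_gt0.
move=> x; apply: le_trans (cabs_le_ReIm _) _; apply: lerD; [exact: hM|exact: hN].
Qed.

Lemma dot_line n (h : R) (x y : 'rV[R]_n) (i : 'I_n) :
  dot (h *: delta_mx 0 i + x) y = y 0 i * h + dot x y.
Proof.
rewrite /dot (eq_bigr (fun j => (if j == i then h * y 0 j else 0) + x 0 j * y 0 j)).
  by rewrite big_split/= -big_mkcond big_pred1_eq mulrC.
move=> j _; rewrite !mxE eqxx mulrDl; congr (_ + _).
by case: eqP => _; rewrite ?mulr1// mulr0 mul0r.
Qed.

Lemma dot_diff n (d : R) (x x' y : 'rV[R]_n) : (forall i, `|x 0 i - x' 0 i| <= d) ->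
  `|dot x y - dot x' y| <= d * \sum_i `|y 0 i|.
Proof.
move=> h; rewrite /dot -sumrB mulr_sumr; apply: le_trans (ler_norm_sum _ _ _) _.
by apply: ler_sum => i _; rewrite -mulrBl normrM ler_wpM2r.
Qed.

Lemma dot_continuous n (y : 'rV[R]_n) : continuous (fun x => dot x y).
Proof.
apply/rV_continuousP => x e e0.
have s0 : 0 <= \sum_i `|y 0 i| by exact: sumr_ge0.
have s1 : 0 < \sum_i `|y 0 i| + 1 by rewrite ltr_wpDl.
exists (e / (\sum_i `|y 0 i| + 1)) => [|x' h]; first by rewrite divr_gt0.
apply: le_trans (@dot_diff _ (e / (\sum_i `|y 0 i| + 1)) _ _ _ _) _.
  by move=> i; apply/ltW/h.
by rewrite mulrAC ler_pdivrMr// ler_wpM2l ?(ltW e0)// lerDl.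
Qed.

Lemma ecis_continuous n (y : 'rV[R]_n) :
  ccontinuous (fun x => cis (- dot x y) : C).
Proof.
have c : continuous (fun x : 'rV[R]_n => - dot x y).
  rewrite (_ : (fun x => _) = (fun x => dot x (- y))); first exact: dot_continuous.
  by apply/funext => x; rewrite /dot -sumrN; apply: eq_bigr => i _; rewrite mxE mulrN.
split=> x.
  exact: (@continuous_comp _ _ _ (fun x => - dot x y) _ _ (c x)
    (@continuous_cosl R (2 * pi) _)).
exact: (@continuous_comp _ _ _ (fun x => - dot x y) _ _ (c x)
    (@continuous_sinl R (2 * pi) _)).
Qed.

(** The functions against which [agree] tests a measure: compact support makes any decay condition
    on the derivatives automatic. *)
Definition testfun n (h : 'rV[R]_n -> C) := smooth h /\ exists A, ckc A h.

Lemma pderivs_rcons n (s : seq 'I_n) i (f : 'rV[R]_n -> C) :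
  pderivs s (pderiv i f) = pderivs (rcons s i) f.
Proof. by rewrite /pderivs foldr_rcons. Qed.

Lemma derive_boxed n A (f : 'rV[R]_n -> R) (v x : 'rV[R]_n) i : boxed A f ->
  A < `|x 0 i| -> 'D_v f x = 0.
Proof.
move=> bf hx; apply: (@cvg_lim R) => //; apply: cvg_near_cst.
have A0 : 0 < (`|x 0 i| - A) / (`|v 0 i| + 1).
  by rewrite divr_gt0 ?subr_gt0// ltr_wpDl.
near=> h; rewrite /= (bf x i)// subr0 (bf _ i) ?scaler0// !mxE.
have h1 : `|h| < (`|x 0 i| - A) / (`|v 0 i| + 1).
  near: h; apply: dnbhs0_lt; exact: A0.
have h2 : `|h * v 0 i| < `|x 0 i| - A.
  have v1 : 0 < `|v 0 i| + 1 by rewrite ltr_wpDl.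
  move: h1; rewrite (ltr_pdivlMr _ _ v1) => h1; rewrite normrM; apply: le_lt_trans h1.
  by rewrite ler_wpM2l// lerDl.
have := lerB_normD (x 0 i) (h * v 0 i); rewrite (addrC (x 0 i)).
by move: h2; lra.
Unshelve. all: by end_near. Qed.

Lemma testfun_pderiv n i (h : 'rV[R]_n -> C) : testfun h -> testfun (pderiv i h).
Proof.
move=> [sh [A kh]]; split.
  by move=> s; rewrite pderivs_rcons; exact: sh.
exists A; have [[_ bh] [_ bh']] := kh.
have [[c1 c2] _] := sh [:: i]; split; split=> // x j hx /=.
  exact: (derive_boxed _ bh hx).
exact: (derive_boxed _ bh' hx).
Qed.

Lemma testfun_is_derive n i (h : 'rV[R]_n -> C) x : testfun h ->
  is_derive x (delta_mx 0 i) (Re \o h) (Re (pderiv i h x)) /\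
  is_derive x (delta_mx 0 i) (Im \o h) (Im (pderiv i h x)).
Proof. by move=> [/(_ [::])[_ /(_ i x)[h1 h2]] _]. Qed.

Lemma is_derive_cosdot n i (x y : 'rV[R]_n) :
  is_derive x (delta_mx 0 i : 'rV[R]_n) (fun x => cos (2 * pi * - dot x y))
    (2 * pi * y 0 i * sin (2 * pi * - dot x y)).
Proof.
pose g (t : R) : R := cos ((- (2 * pi * y 0 i)) * t + (2 * pi * - dot x y)).
have dg : is_derive (0 : R) (1 : R) g (2 * pi * y 0 i * sin (2 * pi * - dot x y)).
  have h := @is_derive1_comp _ cos
    (fun t : R => (- (2 * pi * y 0 i)) * t + (2 * pi * - dot x y)) 0 _ _
    (is_derive_cos _) (is_deriveD (is_derive_lin _ _) (is_derive_cst _ _ _)).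
  by apply: is_derive_eq h _; rewrite mulr0 add0r addr0 mulrNN mulrC.
apply: is_derive_line dg => t; rewrite /g dot_line; congr cos.
rewrite addr0 /GRing.scale/=; ring.
Qed.

Lemma is_derive_sindot n i (x y : 'rV[R]_n) :
  is_derive x (delta_mx 0 i : 'rV[R]_n) (fun x => sin (2 * pi * - dot x y))
    (- (2 * pi * y 0 i) * cos (2 * pi * - dot x y)).
Proof.
pose g (t : R) : R := sin ((- (2 * pi * y 0 i)) * t + (2 * pi * - dot x y)).
have dg : is_derive (0 : R) (1 : R) g (- (2 * pi * y 0 i) * cos (2 * pi * - dot x y)).
  have h := @is_derive1_comp _ sin
    (fun t : R => (- (2 * pi * y 0 i)) * t + (2 * pi * - dot x y)) 0 _ _
    (is_derive_sin _) (is_deriveD (is_derive_lin _ _) (is_derive_cst _ _ _)).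
  by apply: is_derive_eq h _; rewrite mulr0 add0r addr0 mulrC.
apply: is_derive_line dg => t; rewrite /g dot_line; congr sin.
rewrite addr0 /GRing.scale/=; ring.
Qed.

(** The partial derivative of [h(x) e^(-2 i pi x.y)] has integral 0, and the product rule splits it
    into the two sides. *)
Lemma fourier_pderiv n i (h : 'rV[R]_n -> C) y : testfun h ->
  fourier (pderiv i h) y = Complex 0 (2 * pi * y 0 i) * fourier h y.
Proof.
move=> th; have [sh [A kh]] := th; have [_ [A' kh']] := testfun_pderiv i th.
pose B := Num.max A A'.
have wid (f : 'rV[R]_n -> C) D : D <= B -> ckc D f -> ckc B f.
  move=> DB [[c1 b1] [c2 b2]]; split; split => // x j hx.
    by apply: (b1 x j); exact: le_lt_trans hx.
  by apply: (b2 x j); exact: le_lt_trans hx.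
have {}kh : ckc B h by apply: wid kh; rewrite le_max lexx.
have {}kh' : ckc B (pderiv i h) by apply: wid kh'; rewrite le_max lexx orbT.
have ke := ckc_mul kh (ecis_continuous y).
have ke' := ckc_mul kh' (ecis_continuous y).
pose c : C := - Complex 0 (2 * pi * y 0 i).
suff : c * fourier h y + fourier (pderiv i h) y = 0.
  by rewrite /c mulNr addrC => /eqP; rewrite subr_eq0 => /eqP.
rewrite /fourier -(integral_Rn_lin _ ke ke').
have kc' := ckc_add (ckc_scale c ke) ke'.
have D1 x : is_derive x (delta_mx 0 i : 'rV[R]_n) (Re \o (fun x => h x * cis (- dot x y)))
    ((Re \o (fun x => c * (h x * cis (- dot x y)) + pderiv i h x * cis (- dot x y))) x).
  have [d1 d2] := testfun_is_derive i x th.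
  rewrite (_ : Re \o (fun x => h x * _) = (Re \o h) * (fun x => cos (2 * pi * - dot x y)) -
     (Im \o h) * (fun x => sin (2 * pi * - dot x y))); last first.
    by apply/funext => z /=; rewrite ReM.
  apply: is_derive_eq (is_deriveB (is_deriveM d1 (is_derive_cosdot i x y))
     (is_deriveM d2 (is_derive_sindot i x y))) _.
  rewrite /c /= !ReD !ReM !ImM /GRing.scale/=; ring.
have D2 x : is_derive x (delta_mx 0 i : 'rV[R]_n) (Im \o (fun x => h x * cis (- dot x y)))
    ((Im \o (fun x => c * (h x * cis (- dot x y)) + pderiv i h x * cis (- dot x y))) x).
  have [d1 d2] := testfun_is_derive i x th.
  rewrite (_ : Im \o (fun x => h x * _) = (Re \o h) * (fun x => sin (2 * pi * - dot x y)) +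
     (Im \o h) * (fun x => cos (2 * pi * - dot x y))); last first.
    by apply/funext => z /=; rewrite ImM.
  apply: is_derive_eq (is_deriveD (is_deriveM d1 (is_derive_sindot i x y))
     (is_deriveM d2 (is_derive_cosdot i x y))) _.
  rewrite /c /= !ImD !ImM !ReM /GRing.scale/=; ring.
by rewrite integral_RnE (intR_pder0 ke.1 kc'.1 D1) (intR_pder0 ke.2 kc'.2 D2).
Qed.

Lemma fourier_bounded n (h : 'rV[R]_n -> C) : testfun h ->
  exists M : R, forall y, cabs (fourier h y) <= M.
Proof.
move=> [sh [A kh]]; have [M M0 hM] := ckc_bounded kh.
exists (M * vcube n A + M * vcube n A) => y; apply: integral_Rn_bound.
  exact: ckc_mul kh (ecis_continuous y).
by move=> x; rewrite cabsM cabs_cis mulr1.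
Qed.

Lemma fourier_decay1 n (i : 'I_n) r (h : 'rV[R]_n -> C) : testfun h ->
  exists M : R, forall y : 'rV[R]_n, `|y 0 i| ^+ r * cabs (fourier h y) <= M.
Proof.
elim: r h => [|r ih] h th.
  have [M hM] := fourier_bounded th.
  by exists M => y; rewrite expr0 mul1r.
have [M hM] := ih _ (testfun_pderiv i th); exists M => y; apply: le_trans (hM y).
rewrite (fourier_pderiv i y th) cabsM mulrA ler_wpM2r ?cabs_ge0// exprSr ler_wpM2l//.
rewrite /= expr0n add0r sqrtr_sqr normrM ler_peMl// ger0_norm ?mulr_ge0 ?pi_ge0//.
have := @pi_ge2 R; lra.
Qed.

(** A substitute for [1 + |x|^r] built from pure powers of single coordinates, so that decay against
    it follows from one-coordinate estimates, be they Fourier decay or Schwartz seminorms. *)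
Definition growth n (r : nat) (x : 'rV[R]_n) : R := 1 + \sum_i `|x 0 i| ^+ r.

Lemma growth_gt0 n r (x : 'rV[R]_n) : 0 < growth r x.
Proof. by rewrite ltr_wpDr// sumr_ge0// => i _; rewrite exprn_ge0. Qed.

Lemma fourier_decay n r (h : 'rV[R]_n -> C) : testfun h ->
  exists2 M : R, 0 <= M & forall y, cabs (fourier h y) <= M / growth r y.
Proof.
move=> th; have [M0 hM0] := fourier_bounded th.
have /choice[M hM] : forall i : 'I_n, exists M : R, forall y : 'rV[R]_n,
  `|y 0 i| ^+ r * cabs (fourier h y) <= M by move=> i; exact: fourier_decay1.
have M00 : 0 <= M0 by apply: le_trans (hM0 0); exact: cabs_ge0.
have Mi0 i : 0 <= M i by apply: le_trans (hM i 0); rewrite mulr_ge0 ?exprn_ge0 ?cabs_ge0.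
exists (M0 + \sum_i M i); first by rewrite addr_ge0// sumr_ge0.
move=> y; rewrite ler_pdivlMr ?growth_gt0// mulrC mulrDl mul1r lerD//.
by rewrite mulr_suml ler_sum.
Qed.

End Decay.

(** * The Fejer kernel *)

Section FejerKernel.
Context {R : realType}.
Local Notation C := R[i].
Local Notation cabs := (@ComplexField.Normc.normc R).
Local Notation Re := (@complex.Re R).
Local Notation Im := (@complex.Im R).

Definition dirichlet (N : nat) (x : R) : C := \sum_(i < N) cis (i%:R * x).

(** [|D|^2 / N] for the one-sided geometric sum [D] with [N] terms: nonnegativity is then visible,
    and the Fourier expansion comes from counting pairs with a given difference. *)
Definition fejer (N : nat) (x : R) : R :=
  N%:R^-1 * (Re (dirichlet N x) ^+ 2 + Im (dirichlet N x) ^+ 2).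

(** The coefficient [max(0, 1 - |k| / N)], the truncation being that of subtraction on natural
    numbers. *)
Definition fweight (N : nat) (k : int) : R := (N - `|k|)%:R / N%:R.

Lemma fejer_ge0 N x : 0 <= fejer N x.
Proof. by rewrite mulr_ge0 ?invr_ge0// addr_ge0 ?sqr_ge0. Qed.

Lemma fejer_double N x : (fejer N x)%:C%C =
  (N%:R^-1)%:C%C * \sum_(i < N) \sum_(j < N) cis ((i%:Z - j%:Z)%:~R * x).
Proof.
rewrite RCM; congr (_ * _).
under eq_bigr => i _.
  under eq_bigr => j _ do rewrite intrB mulrBl cisD -mulNr.
  rewrite -mulr_sumr; over.
rewrite -mulr_suml -/(dirichlet N x).
have -> : \sum_(j < N) cis (- j%:~R * x) =
    Complex (Re (dirichlet N x)) (- Im (dirichlet N x)).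
  apply: cplx_eq => /=; rewrite ?Re_sum ?Im_sum ?Re_sum ?Im_sum.
    by apply: eq_bigr => j _; rewrite /cis /= mulNr mulrN cosN.
  by rewrite -sumrN; apply: eq_bigr => j _; rewrite /cis /= mulNr mulrN sinN.
by case: (dirichlet N x) => a b; apply: cplx_eq => /=; ring.
Qed.

Lemma ibox_sum (V : nmodType) P (F : int -> V) :
  \sum_(k <- ibox P) F k = \sum_(i < (2 * P).+1) F (i%:Z - P%:Z).
Proof.
by rewrite big_map -[iota _ _]/(index_iota 0 (2 * P).+1) big_mkord.
Qed.

Lemma ibox_sub (V : zmodType) (N P : nat) (F : int -> V) : (N <= P)%N ->
  \sum_(k <- ibox P | (`|k| <= N)%N) F k = \sum_(k <- ibox N) F k.
Proof.
move=> NP; rewrite -big_filter; apply: perm_big; apply: uniq_perm.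
- by rewrite filter_uniq// uniq_ibox.
- exact: uniq_ibox.
- move=> k; rewrite mem_filter !mem_ibox; apply/andP/idP => [[]//|h]; split=> //.
  exact: leq_trans NP.
Qed.

(** Passing from the square of side [N] to that of side [N + 1] adds a column with the differences
    [-N, ..., -1] and a row with [0, ..., N]: every integer of absolute value at most [N] exactly
    once. *)
Lemma cis_double_sum N P (x : R) : (N <= P)%N ->
  \sum_(i < N) \sum_(j < N) cis ((i%:Z - j%:Z)%:~R * x) =
  \sum_(k <- ibox P) (N - `|k|)%:R * cis (k%:~R * x) :> C.
Proof.
elim: N => [|N ih] NP.
  by rewrite big_ord0 big1// => k _; rewrite sub0n mul0r.
rewrite big_ord_recr/=; under eq_bigr do rewrite big_ord_recr/=.
rewrite big_split/= (ih (ltnW NP)) -addrA.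
have -> : \sum_(k <- ibox P) (N.+1 - `|k|)%:R * cis (k%:~R * x) =
   \sum_(k <- ibox P) (N - `|k|)%:R * cis (k%:~R * x) +
   \sum_(k <- ibox N) cis (k%:~R * x) :> C.
  rewrite -(@ibox_sub _ N P _ (ltnW NP)) [X in _ = _ + X]big_mkcond -big_split/=.
  apply: eq_bigr => k _; case: ifPn => [h|].
    by rewrite subSn// -natr1 mulrDl mul1r.
  by rewrite -ltnNge => h; rewrite addr0; congr (_%:R * _); lia.
congr (_ + _); rewrite ibox_sum.
rewrite (_ : (2 * N).+1 = (N + N.+1)%N); last by lia.
rewrite big_split_ord/=; congr (_ + _).
rewrite (reindex_inj rev_ord_inj)/=; apply: eq_bigr => j _.
by congr (cis (_%:~R * _)); have := ltn_ord j; lia.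
Qed.

Lemma fejerE N (x : R) :
  (fejer N x)%:C%C = \sum_(k <- ibox N) (fweight N k)%:C%C * cis (k%:~R * x).
Proof.
rewrite fejer_double (cis_double_sum _ (leqnn N)) mulr_sumr; apply: eq_bigr => k _.
rewrite /fweight RCM (rmorph_nat (real_complex R)); ring.
Qed.

Lemma fejer_cos N (x : R) :
  fejer N x = \sum_(k <- ibox N) fweight N k * cos (2 * pi * k%:~R * x).
Proof.
rewrite -[LHS]/(Re (fejer N x)%:C%C) fejerE Re_sum.
by apply: eq_bigr => k _; rewrite /cis ReM /= mul0r subr0 mulrA.
Qed.

Lemma fweight_ge0 N k : 0 <= fweight N k.
Proof. by rewrite divr_ge0. Qed.

Lemma fweight_le1 N k : fweight N k <= 1.
Proof.
case: N => [|N]; first by rewrite /fweight invr0 mulr0.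
by rewrite ler_pdivrMr// mul1r ler_nat leq_subr.
Qed.

Lemma fweight0 N : (0 < N)%N -> fweight N 0 = 1.
Proof. by move=> N0; rewrite /fweight subn0 divff// pnatr_eq0 -lt0n. Qed.

Lemma fweight_cvg k (e : R) : 0 < e -> exists N0, forall N, (N0 <= N)%N ->
  1 - e <= fweight N k.
Proof.
move=> e0; exists (maxn (Num.truncn (`|k|%:R / e)).+1 `|k|%N) => N.
rewrite geq_max => /andP[h1 h2].
have N0 : 0 < N%:R :> R by rewrite ltr0n; apply: leq_ltn_trans h1.
rewrite /fweight natrB// mulrBl divff ?gt_eqF// lerD2l lerN2.
rewrite ler_pdivrMr// mulrC -ler_pdivrMr//.
by apply/ltW; apply: lt_le_trans (truncnS_gt _) _; rewrite ler_nat.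
Qed.

(** The factor [2 - 2 cos (2 pi x)] is [|e^(2 i pi x) - 1|^2], which telescopes the geometric sum to
    [e^(2 i pi N x) - 1], of modulus at most 2. *)
Lemma fejer_small N (x : R) : (0 < N)%N ->
  fejer N x * (2 - 2 * cos (2 * pi * x)) <= 4 / N%:R.
Proof.
move=> N0; have N1 : 0 < N%:R :> R by rewrite ltr0n.
have tel : (cis x - 1) * dirichlet N x = cis (N%:R * x) - 1.
  rewrite /dirichlet; elim: (N) => [|n ih]; first by rewrite big_ord0 mulr0 mul0r cis0 subrr.
  rewrite big_ord_recr/= mulrDr ih (_ : n.+1%:R * x = x + n%:R * x) ?cisD; first by ring.
  by rewrite -natr1; ring.
have sq (z : C) : cabs z ^+ 2 = Re z ^+ 2 + Im z ^+ 2.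
  by case: z => a b /=; rewrite sqr_sqrtr// addr_ge0 ?sqr_ge0.
have h1 : cabs (cis x - 1) ^+ 2 = 2 - 2 * cos (2 * pi * x).
  rewrite sq /cis ReD ImD /=; have := cos2Dsin2 (2 * pi * x).
  by rewrite !expr2; lra.
rewrite /fejer -sq -h1 -mulrA -exprMn mulrC (mulrC (cabs _)) -cabsM tel ler_pM2r ?invr_gt0//.
have : cabs (cis (N%:R * x) - 1) <= 2.
  apply: le_trans (cabsD _ _) _; rewrite cabs_cis cabsN.
  by rewrite ComplexField.Normc.normc1.
have := cabs_ge0 (cis (N%:R * x) - 1); rewrite expr2; nra.
Qed.

Lemma is_derive_bigsum (I : Type) (r : seq I) (F f : I -> R -> R) (x : R) :
  (forall i, is_derive x (1 : R) (F i) (f i x)) ->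
  is_derive x (1 : R) (fun y => \sum_(i <- r) F i y) (\sum_(i <- r) f i x).
Proof.
move=> h; elim: r => [|i r ih].
  rewrite big_nil (_ : (fun _ => _) = cst 0); first exact: is_derive_cst.
  by apply/funext => y; rewrite big_nil.
rewrite big_cons (_ : (fun _ => _) = F i + (fun y => \sum_(i <- r) F i y)).
  exact: is_deriveD.
by apply/funext => y; rewrite big_cons.
Qed.

Lemma is_derive_shift (f : R -> R) (d a x : R) :
  is_derive (x + a) (1 : R) f d -> is_derive x (1 : R) (fun y => f (y + a)) d.
Proof. by apply: is_derive_line => h; rewrite addrA. Qed.

(** In the explicit primitive the frequency 0 contributes a linear term of slope 1 and all the
    others are 1-periodic; hence the mass 1 on each unit interval, wherever it starts. *)
Lemma fejer_shift_deriv N (a : R) : exists F : R -> R,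
  [/\ forall x : R, is_derive x (1 : R) F (fejer N (x + a)) &
      forall c, (0 < N)%N -> F (c + 1) - F c = 1].
Proof.
pose G (k : int) (y : R) : R := if k == 0 then fweight N k * y
  else fweight N k / (2 * pi * k%:~R) * sin (2 * pi * k%:~R * y).
exists (fun y => \sum_(k <- ibox N) G k (y + a)); split => [x|c N0].
  rewrite fejer_cos.
  apply: (@is_derive_bigsum int (ibox N) (fun k y => G k (y + a))
    (fun k y => fweight N k * cos (2 * pi * k%:~R * (y + a)))) => k.
  apply: is_derive_shift; rewrite /G; case: eqP => [->|/eqP k0].
    by rewrite mulr0z mulr0 mul0r cos0 mulr1; exact: is_derive_lin.
  have h := @is_deriveZ _ _ _ _ (fweight N k / (2 * pi * k%:~R)) _ _ _
    (is_derive_sinl (2 * pi * k%:~R) (x + a)).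
  apply: is_derive_eq h _; rewrite /GRing.scale/= mulrA divfK//.
  by rewrite !mulf_neq0 ?intr_eq0// gt_eqF// pi_gt0.
rewrite -sumrB (bigD1_seq 0) ?uniq_ibox ?mem_ibox//= big1 => [|k k0].
  by rewrite /G eqxx fweight0//; ring.
rewrite /G (negbTE k0) -mulrBr.
have -> : sin (2 * pi * k%:~R * (c + 1 + a)) = sin (2 * pi * k%:~R * (c + a)) :> R.
  have := congr1 (@complex.Im R) (cisD (k%:~R * (c + a)) k%:~R).
  rewrite cis_int mulr1 /cis /= !mulrA => <-; congr sin; ring.
by rewrite subrr mulr0.
Qed.

Lemma fejer_continuous N (a : R) : continuous (fun x => fejer N (x + a)).
Proof.
rewrite (_ : (fun x => _) = (fun x => \sum_(k <- ibox N)
   fweight N k * cos (2 * pi * k%:~R * (x + a)))).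
  apply: is_derive_continuous => x.
  apply: (@is_derive_bigsum int (ibox N)
    (fun k y => fweight N k * cos (2 * pi * k%:~R * (y + a)))
    (fun k y => fweight N k * - (2 * pi * k%:~R * sin (2 * pi * k%:~R * (y + a))))) => k.
  apply: is_deriveZ; exact: (is_derive_shift (is_derive_cosl _ _)).
by apply/funext => x; exact: fejer_cos.
Qed.

End FejerKernel.

(** * Fejer summation in one variable *)

Section FejerConvergence1.
Context {R : realType}.
Local Notation lam := (@lebesgue_measure R).

Lemma contM (f g : R -> R) : continuous f -> continuous g ->
  continuous (fun x => f x * g x).
Proof. by move=> cf cg x; apply: cvgM; [exact: cf|exact: cg]. Qed.

Lemma contD (f g : R -> R) : continuous f -> continuous g ->
  continuous (fun x => f x + g x).
Proof. by move=> cf cg x; apply: cvgD; [exact: cf|exact: cg]. Qed.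

Lemma cont_cst (c : R) : continuous (fun _ : R => c).
Proof. by move=> x; exact: cst_continuous. Qed.

Lemma cont_sum (I : Type) (r : seq I) (F : I -> R -> R) : (forall i, continuous (F i)) ->
  continuous (fun x => \sum_(i <- r) F i x).
Proof.
move=> cF; elim: r => [|i r ih].
  by under eq_fun do rewrite big_nil; exact: cont_cst.
by under eq_fun do rewrite big_cons; exact: contD.
Qed.

Lemma continuous_itv_integrable (f : R -> R) (a b : R) : continuous f ->
  lam.-integrable `[a, b] (EFin \o f).
Proof.
move=> cf; apply: continuous_compact_integrable; first exact: segment_compact.
exact: continuous_subspaceT.
Qed.

Lemma Rintegral_chasles (f : R -> R) (a x b : R) : continuous f -> a <= x -> x <= b ->
  \int[lam]_(t in `[a, b]) f t =
  \int[lam]_(t in `[a, x]) f t + \int[lam]_(t in `[x, b]) f t.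
Proof.
move=> cf ax xb.
have := @Rintegral_itvB R f (BLeft a) (BRight b) x (continuous_itv_integrable _ _ cf).
rewrite !bnd_simp => /(_ ax xb) h.
have h2 : \int[lam]_(t in `]x, b]) f t = \int[lam]_(t in `[x, b]) f t.
  apply: Rintegral_itv_obnd_cbnd.
  apply: integrableS (@continuous_itv_integrable f x b cf) => //.
  by apply: subset_itvr; rewrite bnd_simp.
by rewrite -h2 -h addrC subrK.
Qed.

Lemma Rintegral_split_unit (f : R -> R) (c : R) (m : nat) : continuous f ->
  \int[lam]_(t in `[c, c + m%:R]) f t =
  \sum_(i < m) \int[lam]_(t in `[c + i%:R, c + i%:R + 1]) f t.
Proof.
move=> cf; elim: m => [|m ih]; first by rewrite big_ord0 addr0 set_itv1 Rintegral_set1.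
rewrite big_ord_recr/= -ih (@Rintegral_chasles _ _ (c + m%:R))//.
- by rewrite -natr1 addrA.
- by rewrite lerDl.
- by rewrite lerD2l ler_nat.
Qed.

Lemma Rintegral_cst_itv (a b r : R) : a <= b ->
  \int[lam]_(x in `[a, b]) r = r * (b - a).
Proof.
move=> ab; rewrite (Rintegral_deriv ab (is_derive_lin r)) ?mulrBr//.
by move=> x; exact: cst_continuous.
Qed.

Lemma Rintegral_fejer (N : nat) (a c : R) : (0 < N)%N ->
  \int[lam]_(x in `[c, c + 1]) fejer N (x + a) = 1.
Proof.
move=> N0; have [F [dF hF]] := fejer_shift_deriv N a.
rewrite (Rintegral_deriv _ dF) ?hF//; first by rewrite lerDl.
exact: fejer_continuous.
Qed.

Lemma Rintegral_fejer_nat (N m : nat) (a c : R) : (0 < N)%N ->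
  \int[lam]_(x in `[c, c + m%:R]) fejer N (x + a) = m%:R.
Proof.
move=> N0; rewrite Rintegral_split_unit; last exact: fejer_continuous.
by rewrite (eq_bigr (fun=> 1)) ?sumr_const ?card_ord// => i _; rewrite Rintegral_fejer.
Qed.

Lemma continuous_mul_fejer N (f : R -> R) (a : R) : continuous f ->
  continuous (fun x => f x * fejer N (x + a)).
Proof. by move=> cf; apply: contM => //; exact: fejer_continuous. Qed.

(** As the kernel has mass 1 on the interval, the value at the centre can be moved inside the
    integral. The hypothesis accommodates both regimes: oscillation at most [eta] near the peak,
    product at most [kap] away from it. *)
Lemma fejer_unit_itv N (f : R -> R) (a c eta kap : R) : (0 < N)%N -> continuous f ->
  (forall x, c - 2^-1 <= x <= c + 2^-1 ->
    `|f x - f c| * fejer N (x + a) <= eta * fejer N (x + a) + kap) ->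
  `|\int[lam]_(x in `[c - 2^-1, c - 2^-1 + 1]) (f x * fejer N (x + a)) - f c| <= eta + kap.
Proof.
move=> N0 cf h; have cfc : continuous (fun x => f x - f c).
  by apply: contD => //; exact: cont_cst.
have cK := @fejer_continuous R N a.
have c1 := @continuous_mul_fejer N _ a cf.
have cc : continuous (fun x => f c * fejer N (x + a)).
  by apply: contM => //; exact: cont_cst.
have -> : \int[lam]_(x in `[c - 2^-1, c - 2^-1 + 1]) (f x * fejer N (x + a)) - f c =
    \int[lam]_(x in `[c - 2^-1, c - 2^-1 + 1]) ((f x - f c) * fejer N (x + a)).
  under [RHS]eq_Rintegral => x _ do rewrite mulrBl.
  rewrite RintegralB//; [|exact: continuous_itv_integrable..].
  rewrite RintegralZl//; last exact: continuous_itv_integrable.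
  by rewrite Rintegral_fejer// mulr1.
have c2 := @continuous_mul_fejer N _ a cfc.
apply: le_trans (le_normr_Rintegral _ (@continuous_itv_integrable _ _ _ c2)) _ => //.
have c3 : continuous (fun x => eta * fejer N (x + a) + kap).
  apply: contD; last exact: cont_cst.
  by apply: contM => //; exact: cont_cst.
have c4 : continuous (fun x => eta * fejer N (x + a)).
  by apply: contM => //; exact: cont_cst.
apply: (@le_trans _ _ (\int[lam]_(x in `[c - 2^-1, c - 2^-1 + 1]) (eta * fejer N (x + a) + kap))).
  apply: le_Rintegral => //.
  - exact: (integrable_norm (@continuous_itv_integrable _ _ _ c2)).
  - exact: continuous_itv_integrable.
  - move=> x /=; rewrite in_itv/= => hx; rewrite normrM (ger0_norm (fejer_ge0 _ _)).
    by apply: h; move: hx; lra.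
rewrite RintegralD//; [|exact: continuous_itv_integrable|].
  rewrite RintegralZl//; last exact: continuous_itv_integrable.
  rewrite Rintegral_fejer// mulr1 Rintegral_cst_itv; last by rewrite lerDl.
  by rewrite addrAC subrr add0r mulr1.
by apply: continuous_itv_integrable => x; exact: cst_continuous.
Qed.

Lemma cos_sep (d y : R) : 0 < d -> d <= y -> y <= 2^-1 ->
  cos (2 * pi * y) <= cos (2 * pi * d).
Proof.
move=> d0 dy y2; have pi0 := @pi_gt0 R.
move: dy; rewrite le_eqVlt => /orP[/eqP ->//|dy].
apply: ltW; rewrite ltr_cos ?in_itv/=.
- by rewrite ltr_pM2l// mulr_gt0.
- apply/andP; split; nra.
- apply/andP; split; nra.
Qed.

(** Each point [j - a] is the centre of a unit interval on which the kernel peaks. [N0] is fixed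
    before [f]: it depends only on the support, the bound [M] and the modulus of continuity [w], a
    uniformity on which the induction on the dimension relies. *)
Lemma fejer_sum_cvg (A M : R) (w : R -> R) (a : R) (P : nat) :
  (forall e, 0 < e -> 0 < w e) -> A + `|a| <= P%:R -> forall e : R, 0 < e ->
  exists N0 : nat, forall N, (N0 <= N)%N -> forall f : R -> R, continuous f ->
    (forall x, A < `|x| -> f x = 0) -> (forall x, `|f x| <= M) ->
    (forall e x y, 0 < e -> `|x - y| <= w e -> `|f x - f y| <= e) ->
    `|\int[lam]_x (f x * fejer N (x + a)) - \sum_(j <- ibox P) f (j%:~R - a)| <= e.
Proof.
move=> w0 AP e e0.
pose m := (2 * P).+1.
have m0 : 0 < m%:R :> R by [].
pose eta := e / (2 * m%:R).
have eta0 : 0 < eta by rewrite divr_gt0// mulr_gt0.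
(* The radius of the peak. Being at most 1/4 it keeps [2 pi d] inside [0, pi], where the cosine
   decreases, so [s] below is positive. *)
pose d := Num.min (w eta) 4^-1.
have d0 : 0 < d by rewrite lt_min w0//= invr_gt0.
have dw : d <= w eta by rewrite ge_min lexx.
have d4 : d <= 4^-1 by rewrite ge_min lexx orbT.
pose s := 2 - 2 * cos (2 * pi * d).
have s0 : 0 < s.
  have pi0 := @pi_gt0 R.
  suff : cos (2 * pi * d) < cos 0 :> R by rewrite cos0 /s; lra.
  rewrite ltr_cos ?in_itv/= ?mulr_gt0//; apply/andP; split; nra.
(* Away from the peak the integrand is at most [2 |M|] times [4 / (N s)]; this choice brings it
   below [eta]. *)
pose N0 := (Num.truncn (8 * `|M| / s / eta)).+1.
exists N0 => N NN f cf bf Mf wf.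
have Npos : (0 < N)%N by apply: leq_trans NN.
have NR : 0 < N%:R :> R by rewrite ltr0n.
have kap : 8 * `|M| / s / N%:R <= eta.
  rewrite ler_pdivrMr// [eta * _]mulrC -ler_pdivrMr//; apply/ltW.
  by apply: lt_le_trans (truncnS_gt _) _; rewrite ler_nat.
have cfK := @continuous_mul_fejer N _ a cf.
rewrite ibox_sum -/m.
(* Half a unit to the left of the leftmost point [-P - a]: the [m] consecutive unit intervals are
   then centred at the points of the sum and cover the support. *)
pose c0 : R := - P%:R - a - 2^-1.
have -> : \int[lam]_x (f x * fejer N (x + a)) =
    \int[lam]_(x in `[c0, c0 + m%:R]) (f x * fejer N (x + a)).
  rewrite [RHS]Rintegral_mkcond; congr (Rintegral _ _ _); apply/funext => x.
  rewrite /patch; case: ifPn => // /negP; rewrite inE/= in_itv/= => h.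
  rewrite bf ?mul0r// ltNge; apply/negP => xA; apply: h.
  have : m%:R = 2 * P%:R + 1 :> R by rewrite /m -natr1 natrM.
  move: xA AP; rewrite ler_norml /c0 => /andP[x1 x2] AP ->.
  have := ler_norm a; have := ler_norm (- a); rewrite normrN; lra.
rewrite Rintegral_split_unit// -sumrB.
apply: le_trans (ler_norm_sum _ _ _) _.
apply: (@le_trans _ _ (\sum_(i < m) (eta + eta))); last first.
  rewrite sumr_const card_ord -mulr_natr /eta.
  rewrite (_ : (_ + _) * _ = e)//; by field; rewrite gt_eqF.
apply: ler_sum => i _.
have -> : c0 + i%:R = (i%:Z - P%:Z)%:~R - a - 2^-1 by rewrite /c0 intrB; ring.
apply: fejer_unit_itv => // x hx.
set c := (i%:Z - P%:Z)%:~R - a in hx *.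
have [xd|xd] := leP `|x - c| d.
  apply: ler_wpDr; first exact: ltW.
  apply: ler_wpM2r; first exact: fejer_ge0.
  by apply: wf => //; exact: le_trans dw.
apply: ler_wpDl; first by rewrite mulr_ge0 ?fejer_ge0// ltW.
apply: le_trans kap.
have h1 : fejer N (x + a) * s <= 4 / N%:R.
  apply: le_trans (fejer_small (x + a) Npos).
  apply: ler_wpM2l; first exact: fejer_ge0.
  have -> : cos (2 * pi * (x + a)) = cos (2 * pi * `|x - c|) :> R.
    have E : x + a = (x - c) + (i%:Z - P%:Z)%:~R by rewrite /c; ring.
    have := congr1 (@complex.Re R) (cisD (x - c) (i%:Z - P%:Z)%:~R).
    rewrite -E cis_int mulr1 /cis/= => ->.
    by case: (ger0P (x - c)) => // _; rewrite mulrN cosN.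
  rewrite /s lerD2l lerN2 ler_pM2l//; apply: cos_sep => //; first exact: ltW.
  by rewrite ler_norml; move: hx; lra.
have h2 : `|f x - f c| <= 2 * `|M|.
  apply: le_trans (ler_normB _ _) _.
  have := Mf x; have := Mf c; have := ler_norm M; lra.
have -> : 8 * `|M| / s / N%:R = (2 * `|M|) * ((4 / N%:R) / s).
  by field; rewrite !gt_eqF.
by apply: ler_pM => //; [exact: fejer_ge0|rewrite ler_pdivlMr].
Qed.

End FejerConvergence1.

(** * Fejer summation in several variables *)

Section FejerConvergence.
Context {R : realType}.
Local Notation lam := (@lebesgue_measure R).

Definition fejer_prod n N (a x : 'rV[R]_n) : R := \prod_i fejer N (x 0 i + a 0 i).

Definition latpt n (p : 'rV[int]_n) (a : 'rV[R]_n) : 'rV[R]_n :=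
  \row_i ((p 0 i)%:~R - a 0 i).

Lemma fejer_prod_cons n N (a : 'rV[R]_n.+1) x u :
  fejer_prod N a (consv x u) =
  fejer N (x + a 0 0) * fejer_prod N (\row_i a 0 (lift ord0 i)) u.
Proof.
rewrite /fejer_prod big_ord_recl consv0; congr (_ * _).
by apply: eq_bigr => i _; rewrite consvS mxE.
Qed.

Lemma latpt_cons n j (p : 'rV[int]_n) (a : 'rV[R]_n.+1) :
  latpt (consv j p) a = consv (j%:~R - a 0 0) (latpt p (\row_i a 0 (lift ord0 i))).
Proof.
apply/rowP => i; rewrite mxE; case: (unliftP ord0 i) => [k ->|->].
  by rewrite !consvS !mxE.
by rewrite !consv0.
Qed.

Lemma rV_contM n (f g : 'rV[R]_n -> R) : continuous f -> continuous g ->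
  continuous (fun x => f x * g x).
Proof. by move=> cf cg x; apply: continuousM; [exact: cf|exact: cg]. Qed.

Lemma fejer_prod_continuous n N (a : 'rV[R]_n) : continuous (fejer_prod N a).
Proof.
rewrite /fejer_prod; elim: (index_enum _) => [|i r ih].
  rewrite (_ : (fun _ => _) = fun=> 1); first by move=> x; exact: cst_continuous.
  by apply/funext => x; rewrite big_nil.
rewrite (_ : (fun _ => _) = (fun x : 'rV[R]_n => fejer N (x 0 i + a 0 i) *
    \prod_(j <- r) fejer N (x 0 j + a 0 j))); last first.
  by apply/funext => x; rewrite big_cons.
apply: rV_contM => // x.
exact: (@continuous_comp _ _ _ (fun x : 'rV[R]_n => x 0 i) (fun t => fejer N (t + a 0 i)) x
  (@coord_continuous R 1 n ord0 i x) (@fejer_continuous R N (a 0 i) _)).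
Qed.

Lemma kc_fejer n A N a (g : 'rV[R]_n -> R) : kc A g ->
  kc A (fun x => g x * fejer_prod N a x).
Proof. by move=> kg; apply: kc_mul => //; exact: fejer_prod_continuous. Qed.

(** The induction hypothesis is applied to all slices of [g] at once, so the order of the kernel
    must not depend on the slice; this is why the bound and the modulus are quantified before the
    function. *)
Lemma fejer_prod_cvg n (A M : R) (w : R -> R) (a : 'rV[R]_n) (P : nat) :
  (forall e, 0 < e -> 0 < w e) -> (forall i, A + `|a 0 i| <= P%:R) ->
  forall e : R, 0 < e ->
  exists N0 : nat, forall N, (N0 <= N)%N -> forall g : 'rV[R]_n -> R, kc A g ->
    (forall x, `|g x| <= M) ->
    (forall e (x y : 'rV[R]_n), 0 < e -> (forall i, `|x 0 i - y 0 i| <= w e) ->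
      `|g x - g y| <= e) ->
    `|intR (fun x => g x * fejer_prod N a x) - \sum_(p <- box n P) g (latpt p a)| <= e.
Proof.
move=> w0; elim: n a => [|n ih] a aP e e0.
  exists 0%N => N _ g kg _ _; rewrite /= big_seq1.
  rewrite /intR /Rintegral /lebesgue_Rn/= integral_dirac//=; last first.
    by apply/measurable_EFinP; exact: (measurable_row (kc_fejer N a kg).1).
  rewrite indicE mem_set// mul1r /fejer_prod big_ord0 mulr1.
  rewrite (_ : latpt _ _ = row_tuple [tuple]) ?subrr ?normr0 ?ltW//.
  by apply/rowP => -[].
set a' : 'rV[R]_n := \row_i a 0 (lift ord0 i).
have e20 : 0 < e / 2 by rewrite divr_gt0.
(* The inner error is integrated against a kernel of mass [2 P] on [-P, P]; the added 1 keeps the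
   denominator positive if [P = 0]. *)
pose e1 := e / 2 / (2 * P%:R + 1).
have P1 : 0 < 2 * P%:R + 1 :> R by rewrite ltr_wpDl// mulr_ge0.
have e10 : 0 < e1 by rewrite divr_gt0.
have [|N1 hN1] := ih a' _ e1 e10; first by move=> i; rewrite mxE.
(* [B] exceeds the number of terms of the inner sum [S] below, which thus inherits from [g] the
   bound [B M] and the modulus [w (e / B)]. *)
pose B : R := (size (box n P))%:R + 1.
have B0 : 0 < B by rewrite ltr_wpDl.
have sumB (F : 'rV[int]_n -> R) c : 0 <= c -> (forall p, `|F p| <= c) ->
    `|\sum_(p <- box n P) F p| <= B * c.
  move=> c0 hF; apply: le_trans (ler_norm_sum _ _ _) _.
  apply: (@le_trans _ _ (\sum_(p <- box n P) c)); first exact: ler_sum.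
  rewrite big_const_seq count_predT iter_addr addr0 -mulr_natl.
  by apply: ler_wpM2r => //; rewrite lerDl.
pose w' (e : R) := w (e / B).
have [|N2 hN2] := @fejer_sum_cvg R A (B * M) w' (a 0 0) P _ (aP ord0) _ e20.
  by move=> c c0; apply: w0; rewrite divr_gt0.
exists (maxn 1 (maxn N1 N2)) => N; rewrite !geq_max => /and3P[N0 NN1 NN2] g kg gM gw.
have M0 : 0 <= M by apply: le_trans (gM 0).
have [cg bg] := kg.
pose S x := \sum_(p <- box n P) g (consv x (latpt p a')).
pose I x := intR (fun u => g (consv x u) * fejer_prod N a' u).
have IS x : `|I x - S x| <= e1.
  apply: hN1 => //; first exact: kc_consv.
  move=> c u v c0 uv; apply: gw => // i; case: (unliftP ord0 i) => [j ->|->].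
    by rewrite !consvS.
  by rewrite !consv0 subrr normr0 ltW// w0.
have Sc : continuous S.
  rewrite /S; elim: (box n P) => [|p r ihr].
    rewrite (_ : (fun _ => _) = fun=> 0); first exact: cont_cst.
    by apply/funext => x; rewrite big_nil.
  rewrite (_ : (fun _ => _) = (fun x => g (consv x (latpt p a')) +
    \sum_(q <- r) g (consv x (latpt q a')))); last first.
    by apply/funext => x; rewrite big_cons.
  by apply: contD => //; exact: consv_continuous1.
have g0 x u : A < `|x| -> g (consv x u) = 0.
  by move=> hx; apply: (bg _ ord0); rewrite consv0.
have S0 x : A < `|x| -> S x = 0 by move=> hx; rewrite /S big1// => p _; exact: g0.
have I0 x : A < `|x| -> I x = 0.
  move=> hx; rewrite /I (intR_ext (g := fun=> 0)); last by move=> u; rewrite g0// mul0r.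
  by rewrite /intR /Rintegral integral0.
have kgf := kc_fejer N a kg.
have Ex x : intR (fun u => g (consv x u) * fejer_prod N a (consv x u)) =
    I x * fejer N (x + a 0 0).
  have kI := kc_fejer N a' (kc_consv x kg).
  have k0 : kc A (fun _ : 'rV[R]_n => 0 : R) by split=> // y; exact: cst_continuous.
  rewrite (intR_ext (g := fun u => fejer N (x + a 0 0) *
    (g (consv x u) * fejer_prod N a' u) + 0)); last first.
    by move=> u; rewrite fejer_prod_cons; ring.
  rewrite (intR_lin _ kI k0) mulrC; rewrite -[RHS]addr0; congr (_ + _).
  by rewrite /intR /Rintegral integral0.
rewrite (intR_cons kgf) sum_box_cons.
have -> : \sum_(j <- ibox P) \sum_(p <- box n P) g (latpt (consv j p) a) =
    \sum_(j <- ibox P) S (j%:~R - a 0 0).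
  by apply: eq_bigr => j _; apply: eq_bigr => p _; rewrite latpt_cons.
rewrite (funext Ex).
have iI : lam.-integrable setT (fun x => (I x * fejer N (x + a 0 0))%:E).
  apply: eq_integrable (intR_cons_integrable kgf) => //.
  by move=> x _; rewrite Ex.
have iS : lam.-integrable setT (fun x => (S x * fejer N (x + a 0 0))%:E).
  apply: (@continuous_kc1_integrable _ A); first exact: continuous_mul_fejer.
  by move=> x hx; rewrite S0// mul0r.
have h2 : `|\int[lam]_x (S x * fejer N (x + a 0 0)) -
    \sum_(j <- ibox P) S (j%:~R - a 0 0)| <= e / 2.
  apply: hN2 => //.
  - by move=> x; apply: sumB => // p; exact: gM.
  - move=> c x y c0 xy; rewrite -sumrB.
    rewrite (_ : c = B * (c / B)); last by rewrite mulrC divfK// gt_eqF.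
    apply: sumB => [|p]; first by rewrite divr_ge0 ?ltW.
    apply: gw; first by rewrite divr_gt0.
    move=> i; case: (unliftP ord0 i) => [j ->|->]; last by rewrite !consv0.
    by rewrite !consvS subrr normr0 ltW// w0// divr_gt0.
have h1 : `|\int[lam]_x (I x * fejer N (x + a 0 0)) -
    \int[lam]_x (S x * fejer N (x + a 0 0))| <= e / 2.
  rewrite -RintegralB//.
  have iIS := integrableB measurableT iI iS.
  apply: le_trans (le_normr_Rintegral measurableT iIS) _.
  have AP : A <= P%:R by apply: le_trans (aP ord0); rewrite lerDl.
  rewrite (Rintegral_kc1 AP); last first.
    by move=> x hx; rewrite I0// S0// !mul0r subrr normr0.
  apply: (@le_trans _ _ (\int[lam]_(x in `[- P%:R, P%:R]) (e1 * fejer N (x + a 0 0)))).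
    apply: le_Rintegral => //.
    - by apply: (@integrableS _ _ _ _ setT) => //; exact: (integrable_norm iIS).
    - by apply: continuous_itv_integrable; apply: contM; [exact: cont_cst|exact: fejer_continuous].
    - move=> x _; rewrite -mulrBl normrM (ger0_norm (fejer_ge0 _ _)).
      by apply: ler_wpM2r; rewrite ?fejer_ge0.
  rewrite RintegralZl//; last by apply: continuous_itv_integrable; exact: fejer_continuous.
  have := @Rintegral_fejer_nat R N (2 * P) (a 0 0) (- P%:R) N0.
  rewrite (_ : - P%:R + (2 * P)%:R = P%:R); last by rewrite natrM; ring.
  move=> ->; rewrite /e1 mulrAC ler_pdivrMr// natrM.
  by apply: ler_wpM2l; [exact: ltW|rewrite lerDl].
rewrite -(subrK (\int[lam]_x (S x * fejer N (x + a 0 0))) (\int[lam]_x (I x * _))).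
by rewrite -addrA (le_trans (ler_normD _ _))// [leRHS]splitr lerD.
Qed.

End FejerConvergence.

(** * Poisson summation *)

Section Poisson.
Context {R : realType}.
Local Notation C := R[i].
Local Notation cabs := (@ComplexField.Normc.normc R).
Local Notation Re := (@complex.Re R).
Local Notation Im := (@complex.Im R).

Definition boxweight n N (k : 'rV[int]_n) : R := \prod_i fweight N (k 0 i).

Definition intv n (k : 'rV[int]_n) : 'rV[R]_n := \row_i (k 0 i)%:~R.

Lemma fejerN N (x : R) : fejer N (- x) = fejer N x.
Proof. by rewrite !fejer_cos; apply: eq_bigr => k _; rewrite mulrN cosN. Qed.

Lemma dot_cons n x y (u v : 'rV[R]_n) : dot (consv x u) (consv y v) = x * y + dot u v.
Proof.
by rewrite /dot big_ord_recl !consv0; congr (_ + _); apply: eq_bigr => i _; rewrite !consvS.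
Qed.

Lemma intv_cons n j (k : 'rV[int]_n) : intv (consv j k) = consv j%:~R (intv k).
Proof.
apply/rowP => i; rewrite mxE; case: (unliftP ord0 i) => [l ->|->].
  by rewrite !consvS mxE.
by rewrite !consv0.
Qed.

Lemma dotC n (x y : 'rV[R]_n) : dot x y = dot y x.
Proof. by rewrite /dot; apply: eq_bigr => i _; rewrite mulrC. Qed.

Lemma dotDl n (x y z : 'rV[R]_n) : dot (x + y) z = dot x z + dot y z.
Proof. by rewrite /dot -big_split; apply: eq_bigr => i _; rewrite mxE mulrDl. Qed.

Lemma dotDr n (x y z : 'rV[R]_n) : dot z (x + y) = dot z x + dot z y.
Proof. by rewrite dotC dotDl !(dotC z). Qed.

Lemma fejer_prodE n N (a x : 'rV[R]_n) : (fejer_prod N a x)%:C%C =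
  \sum_(k <- box n N) (boxweight N k)%:C%C * cis (- dot (intv k) (x + a)).
Proof.
elim: n a x => [|n ih] a x.
  rewrite /= big_seq1 /fejer_prod /boxweight !big_ord0 mul1r.
  by rewrite /dot big_ord0 oppr0 cis0.
rewrite {1}(consv_eta x) fejer_prod_cons RCM ih -fejerN fejerE sum_box_cons mulr_suml.
apply: eq_bigr => j _; rewrite mulr_sumr; apply: eq_bigr => k _.
rewrite /boxweight big_ord_recl consv0 RCM.
have -> : \prod_(i < n) fweight N (consv j k 0 (lift ord0 i)) =
    \prod_i fweight N (k 0 i) :> R by apply: eq_bigr => i _; rewrite consvS.
rewrite intv_cons (consv_eta (x + a)) dot_cons [- (_ * _ + _)]opprD cisD.
rewrite (_ : \row_i (x + a) 0 (lift ord0 i) =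
  (\row_i x 0 (lift ord0 i)) + (\row_i a 0 (lift ord0 i))); last first.
  by apply/rowP => i; rewrite !mxE.
by rewrite mxE mulrN; ring.
Qed.

Lemma prod_fweight n N (r : seq 'I_n) (k : 'rV[int]_n) :
  0 <= (\prod_(i <- r) fweight N (k 0 i) : R) <= 1.
Proof.
elim: r => [|i r /andP[ih1 ih2]]; first by rewrite big_nil ler01 lexx.
rewrite big_cons mulr_ge0 ?fweight_ge0//=.
by rewrite mulr_ile1 ?fweight_ge0 ?fweight_le1.
Qed.

Lemma boxweight_bound n N (k : 'rV[int]_n) : 0 <= boxweight N k <= 1.
Proof. exact: prod_fweight. Qed.

Lemma boxweight_cvg n (k : 'rV[int]_n) (e : R) : 0 < e -> exists N0, forall N,
  (N0 <= N)%N -> 1 - e <= boxweight N k.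
Proof.
rewrite /boxweight; elim: (index_enum _) e => [|i r ih] e e0.
  by exists 0%N => N _; rewrite big_nil gerBl ltW.
have e20 : 0 < e / 2 by rewrite divr_gt0.
have [N1 h1] := ih _ e20; have [N2 h2] := @fweight_cvg R (k 0 i) _ e20.
exists (maxn N1 N2) => N; rewrite geq_max => /andP[/h1 {}h1 /h2 {}h2].
rewrite big_cons; have /andP[p0 p1] := prod_fweight N r k.
have f0 := @fweight_ge0 R N (k 0 i); have f1 := @fweight_le1 R N (k 0 i).
by move: h1 h2 p0 p1 f0 f1; nra.
Qed.

Lemma boxweight_cvg_seq n (A : seq 'rV[int]_n) (e : R) : 0 < e -> exists N0, forall N,
  (N0 <= N)%N -> forall k, k \in A -> 1 - e <= boxweight N k.
Proof.
move=> e0; elim: A => [|k A [N1 h1]]; first by exists 0%N.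
have [N2 h2] := boxweight_cvg k e0.
exists (maxn N1 N2) => N; rewrite geq_max => /andP[/h1 {}h1 /h2 {}h2] l.
by rewrite inE => /orP[/eqP ->|/h1].
Qed.

(** Cesaro means of an absolutely convergent lattice series tend to its sum. Three errors of size
    [e / 3]: the weights on a large finite set, close to 1; the tail of the series; the weighted
    tail, as the weights lie between 0 and 1. *)
Lemma hassum_fejer n (a : 'rV[int]_n -> C) s w c : weight w -> hassum a s ->
  (forall k, cabs (a k) <= c * w k) -> 0 <= c -> forall e : R, 0 < e ->
  exists N0, forall N, (N0 <= N)%N ->
  cabs (\sum_(k <- box n N) (boxweight N k)%:C%C * a k - s) <= e.
Proof.
move=> ww has aw c0 e e0.
have c1 : 0 < c + 1 by rewrite ltr_wpDl.
pose e1 := e / 3 / (c + 1).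
have e10 : 0 < e1 by rewrite !divr_gt0.
have [A1 uA1 h1] := hassum_tail ww e10.
have [A2 uA2 h2] := weight_tail ww e10.
have [w0 [W hW]] := ww.
pose A := undup (A1 ++ A2).
have uA : uniq A by exact: undup_uniq.
have W1 : 0 < `|W| + 1 by rewrite ltr_wpDl.
have e20 : 0 < e1 / (`|W| + 1) by rewrite divr_gt0.
have [N1 hN1] := boxweight_cvg_seq A e20.
have [N2 hN2] := sub_box A.
exists (maxn N1 N2) => N; rewrite geq_max => /andP[/hN1 {}hN1 /hN2 {}hN2].
rewrite (sum_subset _ uA (uniq_box n N) hN2).
have E : \sum_(k <- A) (boxweight N k)%:C%C * a k =
    \sum_(k <- A) (boxweight N k - 1)%:C%C * a k + \sum_(k <- A) a k.
  by rewrite -big_split/=; apply: eq_bigr => k _; rewrite RCB mulrBl mul1r subrK.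
rewrite E.
set X := \sum_(k <- A) (_ - 1)%:C%C * _; set Y := \sum_(k <- A) a k.
set Z := \sum_(k <- _ | _) _.
have -> : X + Y + Z - s = X + Z + (Y - s) by ring.
have ce : c * e1 <= e / 3.
  rewrite /e1 mulrC mulrAC ler_pdivrMr// ler_wpM2l ?lerDl// ltW// divr_gt0//.
have hX : cabs X <= e / 3.
  apply: le_trans ce; apply: le_trans (cabs_sum _ _ _) _.
  apply: (@le_trans _ _ (\sum_(k <- A) (e1 / (`|W| + 1)) * (c * w k))).
    rewrite big_seq [leRHS]big_seq; apply: ler_sum => k kA.
    rewrite cabsM cabs_real; apply: ler_pM => //; first exact: cabs_ge0.
    have := hN1 k kA; have /andP[_ b1] := boxweight_bound N k.
    by rewrite ler_norml; move: b1; lra.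
  rewrite -!mulr_sumr mulrC -mulrA ler_wpM2l// mulrA.
  rewrite ler_pdivrMr// mulrC; apply: ler_wpM2l; first exact: ltW.
  by apply: le_trans (hW _ uA) _; rewrite (le_trans (ler_norm _))// lerDl.
have hY : cabs (Y - s) <= e / 3.
  rewrite cabsB; apply: le_trans ce; apply: h1 => //.
  by move=> k kA; rewrite mem_undup mem_cat kA.
have hZ : cabs Z <= e / 3.
  apply: le_trans ce; apply: le_trans (cabs_sum _ _ _) _.
  apply: (@le_trans _ _ (\sum_(k <- box n N | k \notin A) c * w k)).
    apply: ler_sum => k _; rewrite cabsM cabs_real.
    have /andP[b0 b1] := boxweight_bound N k.
    by rewrite ger0_norm// -[leRHS]mul1r; apply: ler_pM => //; exact: cabs_ge0.
  rewrite -mulr_sumr ler_wpM2l// -big_filter; apply: h2.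
    by rewrite filter_uniq// uniq_box.
  move=> k; rewrite mem_filter => /andP[kA _]; apply: contra kA => kA2.
  by rewrite mem_undup mem_cat kA2 orbT.
apply: le_trans (cabsD _ _) _; have := cabsD X Z; move: hX hY hZ; lra.
Qed.

Lemma fejer_prod_cvgC n (A : R) (a : 'rV[R]_n) (P : nat) (h : 'rV[R]_n -> C) :
  ckc A h -> (forall i, A + `|a 0 i| <= P%:R) -> forall e : R, 0 < e ->
  exists N0 : nat, forall N, (N0 <= N)%N ->
    cabs (integral_Rn (fun x => h x * (fejer_prod N a x)%:C%C) -
          \sum_(p <- box n P) h (latpt p a)) <= e.
Proof.
move=> kh aP e e0.
have key (g : 'rV[R]_n -> R) : kc A g -> exists N0 : nat, forall N, (N0 <= N)%N ->
    `|intR (fun x => g x * fejer_prod N a x) - \sum_(p <- box n P) g (latpt p a)| <= e / 2.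
  move=> kg; have [M M0 hM] := kc_bounded kg.
  have /choice[w hw] : forall d : R, exists w : R, 0 < d -> 0 < w /\
      forall x y : 'rV[R]_n, (forall i, `|x 0 i - y 0 i| <= w) -> `|g x - g y| <= d.
    move=> d; have [d0|] := ltP 0 d; last by exists 0.
    by have [w w0 hw] := kc_ucont kg d0; exists w.
  have [||N0 h0] := @fejer_prod_cvg R n A M w a P _ aP (e / 2) _.
  - by move=> d /hw[].
  - by rewrite divr_gt0.
  exists N0 => N NN; apply: h0 => // d x y d0 xy.
  by have [_ h1] := hw d d0; exact: h1.
have [kr ki] := kh.
have [N1 h1] := key _ kr; have [N2 h2] := key _ ki.
exists (maxn N1 N2) => N; rewrite geq_max => /andP[/h1 {}h1 /h2 {}h2].
apply: le_trans (cabs_le_ReIm _) _; rewrite [leRHS]splitr integral_RnE.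
rewrite ReD ImD ReN ImN.
rewrite Re_sum Im_sum /=; apply: lerD.
  rewrite (intR_ext (g := fun x => (Re \o h) x * fejer_prod N a x)); first exact: h1.
  by move=> x /=; rewrite ReM /= mulr0 subr0.
rewrite (intR_ext (g := fun x => (Im \o h) x * fejer_prod N a x)); first exact: h2.
by move=> x /=; rewrite ImM /= mulr0 add0r.
Qed.

Lemma integral_Rn_sum n A (I : Type) (r : seq I) (c : I -> C) (f : I -> 'rV[R]_n -> C) :
  (forall i, ckc A (f i)) ->
  integral_Rn (fun x => \sum_(i <- r) c i * f i x) = \sum_(i <- r) c i * integral_Rn (f i).
Proof.
move=> kf; elim: r => [|i r ih].
  rewrite big_nil integral_RnE (intR_ext (g := fun=> 0)); last first.
    by move=> x /=; rewrite big_nil.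
  rewrite (intR_ext (f := Im \o _) (g := fun=> 0)); last first.
    by move=> x /=; rewrite big_nil.
  by rewrite /intR /Rintegral integral0.
rewrite big_cons -ih -(integral_Rn_lin _ (kf i)).
  by congr integral_Rn; apply/funext => x; rewrite big_cons.
elim: (r) => [|j s ihs].
  rewrite (_ : (fun _ => _) = fun=> 0); last by apply/funext => x; rewrite big_nil.
  by split; split=> // x; exact: cst_continuous.
rewrite (_ : (fun _ => _) = fun x => c j * f j x + \sum_(i <- s) c i * f i x).
  by apply: ckc_add => //; exact: ckc_scale.
by apply/funext => x; rewrite big_cons.
Qed.

(** The integral of [h(x) e^(-2 i pi x.u)] against the product Fejer kernel at [x + a] is evaluated
    twice: concentration of the kernel gives the finite sum over lattice points, expansion of the
    kernel gives Cesaro means of the Fourier side, which is dominated by a weight. *)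
Lemma poisson_hassum n (A : R) (a u : 'rV[R]_n) (P : nat) (h : 'rV[R]_n -> C) w c :
  ckc A h -> (forall i, A + `|a 0 i| <= P%:R) -> weight w -> 0 <= c ->
  (forall k : 'rV[int]_n, cabs (fourier h (u + intv k)) <= c * w k) ->
  hassum (fun k : 'rV[int]_n => fourier h (u + intv k) * cis (- dot (intv k) a))
    (\sum_(p <- box n P) h (latpt p a) * cis (- dot (latpt p a) u)).
Proof.
move=> kh aP ww c0 fw.
have fw' k : cabs (fourier h (u + intv k) * cis (- dot (intv k) a)) <= c * w k.
  by rewrite cabsM cabs_cis mulr1.
have [|s hs] := @hassum_ex R _ (fun k => c * w k) _ _ fw'.
  have [w0 [W hW]] := ww; split=> [k|]; first by rewrite mulr_ge0.
  by exists (c * W) => B uB; rewrite -mulr_sumr ler_wpM2l// hW.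
suff -> : \sum_(p <- box n P) h (latpt p a) * cis (- dot (latpt p a) u) = s by [].
apply/eqP; rewrite -subr_eq0; apply/eqP/cabs_le_eq0 => e e0.
have e20 : 0 < e / 2 by rewrite divr_gt0.
have [N1 h1] := hassum_fejer ww hs fw' c0 e20.
have kg := ckc_mul kh (ecis_continuous u).
have [N2 h2] := fejer_prod_cvgC kg aP e20.
pose N := maxn N1 N2.
have {}h1 := h1 N (leq_maxl _ _); have {}h2 := h2 N (leq_maxr _ _).
apply: le_trans (cabs_triangle
  (integral_Rn (fun x => h x * cis (- dot x u) * (fejer_prod N a x)%:C%C)) _ _) _.
rewrite [leRHS]splitr; apply: lerD; first by rewrite cabsB.
rewrite (_ : integral_Rn _ = \sum_(k <- box n N) (boxweight N k)%:C%C *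
  (fourier h (u + intv k) * cis (- dot (intv k) a)))//.
rewrite (_ : (fun x => _) = (fun x => \sum_(k <- box n N)
   ((boxweight N k)%:C%C * cis (- dot (intv k) a)) * (h x * cis (- dot x (u + intv k))))).
  rewrite (@integral_Rn_sum _ A); last first.
    by move=> k; exact: (ckc_mul kh (ecis_continuous _)).
  by apply: eq_bigr => k _; rewrite -mulrA; congr (_ * _); rewrite mulrC.
apply/funext => x; rewrite fejer_prodE mulr_sumr; apply: eq_bigr => k _.
rewrite !dotDr opprD cisD opprD cisD (dotC (intv k) x); ring.
Qed.

End Poisson.

(** * Lifts of Mobius transformations *)

Section MobiusLift.
Context {R : realType}.
Local Notation C := R[i].

Section Fixed.
Variable a : R.
Hypothesis ha : `|a| < 1.

(* For [w = cis x], [(w - a) / (1 - a w) = w (1 - a w^-1) / (1 - a w)] and the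
   last quotient has argument [2 arctan (a sin / (1 - a cos))]. *)
Definition mob (x : R) : R :=
  x + pi^-1 * atan (a * sin (2 * pi * x) / (1 - a * cos (2 * pi * x))).

(** The Poisson kernel of the disc at the point [a]; it is the derivative of the lift, and its
    bounds make the lift a bi-Lipschitz map of the line. *)
Definition dmob (x : R) : R :=
  (1 - a ^+ 2) / (1 - 2 * a * cos (2 * pi * x) + a ^+ 2).

Lemma mob_den_gt0 x : 0 < 1 - a * cos (2 * pi * x).
Proof.
rewrite subr_gt0; apply: le_lt_trans (ler_norm _) _; rewrite normrM.
by apply: le_lt_trans ha; rewrite ler_piMr// cos_bound.
Qed.

Lemma poisson_den_bounds x :
  (1 - `|a|) ^+ 2 <= 1 - 2 * a * cos (2 * pi * x) + a ^+ 2 <= (1 + `|a|) ^+ 2.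
Proof.
have : `|a * cos (2 * pi * x)| <= `|a|.
  by rewrite normrM ler_piMr// cos_bound.
have aa : `|a| * `|a| = a * a by rewrite -!expr2 real_normK// num_real.
rewrite !expr2 ler_norml; move: aa; set c := cos _; move=> aa hc.
by apply/andP; split; nra.
Qed.

Lemma dmob_bounds x :
  (1 - `|a|) / (1 + `|a|) <= dmob x <= (1 + `|a|) / (1 - `|a|).
Proof.
have /andP[h1 h2] := poisson_den_bounds x.
have a1 : 0 < 1 - `|a| by rewrite subr_gt0.
have a2 : 0 < 1 + `|a| by rewrite ltr_wpDr.
have d0 : 0 < 1 - 2 * a * cos (2 * pi * x) + a ^+ 2.
  by apply: lt_le_trans h1; rewrite exprn_gt0.
have aa : 1 - a ^+ 2 = (1 - `|a|) * (1 + `|a|).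
  by rewrite -subr_sqr expr1n real_normK// num_real.
rewrite /dmob aa; move: h1 h2 a1 a2 d0.
move: (1 - `|a|) (1 + `|a|) (1 - _ + _) => p q D h1 h2 p0 q0 D0.
apply/andP; split; rewrite ler_pdivrMr// mulrAC ler_pdivlMr//.
  by rewrite -mulrA ler_wpM2l ?(ltW p0)// -expr2.
by rewrite (mulrC p) -mulrA ler_wpM2l ?(ltW q0)// -expr2.
Qed.

Lemma is_derive_mob x : is_derive x (1 : R) mob (dmob x).
Proof.
have p0 := mob_den_gt0 x.
have /andP[h1 _] := poisson_den_bounds x.
have d0 : 0 < 1 - 2 * a * cos (2 * pi * x) + a ^+ 2.
  by apply: lt_le_trans h1; rewrite exprn_gt0// subr_gt0.
have pi0 := @pi_gt0 R.
pose q (y : R) := a * sin (2 * pi * y); pose p (y : R) := 1 - a * cos (2 * pi * y).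
have dq : is_derive x (1 : R) q (a * (2 * pi * cos (2 * pi * x))).
  by have := @is_deriveZ _ _ _ _ a _ _ _ (is_derive_sinl (2 * pi) x).
have dp : is_derive x (1 : R) p (a * (2 * pi * sin (2 * pi * x))).
  have h := is_deriveB (is_derive_cst (1 : R) x (1 : R))
    (@is_deriveZ _ _ _ _ a _ _ _ (is_derive_cosl (2 * pi) x)).
  by apply: is_derive_eq h _; rewrite /GRing.scale/= sub0r mulrN opprK.
have dpV := @is_deriveV _ p x _ _ (lt0r_neq0 p0) dp.
have dqp := is_deriveM dq dpV.
have dat := @is_derive1_comp _ (@atan R) (q * (fun y => (p y)^-1)) x _ _
  (is_derive1_atan _) dqp.
have dpa := @is_deriveZ _ _ _ _ (pi^-1) _ _ _ dat.
have dm := is_deriveD (is_derive_id x (1 : R)) dpa.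
apply: is_derive_eq dm _.
rewrite /GRing.scale/= /q /p /dmob.
set c := cos _ in p0 d0 *; set s := sin _.
have cs : s ^+ 2 = 1 - c ^+ 2 by rewrite -(cos2Dsin2 (2 * pi * x)) addrAC subrr add0r.
have p1 : 1 - a * c != 0 by rewrite gt_eqF.
have d1 : 1 - 2 * a * c + a ^+ 2 != 0 by rewrite gt_eqF.
have E1 : 1 + (a * s * (1 - a * c)^-1) ^+ 2 =
    (1 - 2 * a * c + a ^+ 2) / (1 - a * c) ^+ 2.
  by rewrite !exprMn cs; field.
have E2 : a * s * (- (1 - a * c) ^- 2 * (a * (2 * pi * s))) +
    (1 - a * c)^-1 * (a * (2 * pi * c)) = 2 * pi * (a * c - a ^+ 2) / (1 - a * c) ^+ 2.
  rewrite (_ : a * s * _ = - (a ^+ 2 * (2 * pi)) * s ^+ 2 / (1 - a * c) ^+ 2); last by field.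
  by rewrite cs; field.
have E3 w : w != 0 -> 1 + w^-1 * (((1 - 2 * a * c + a ^+ 2) / (1 - a * c) ^+ 2)^-1 *
    (2 * w * (a * c - a ^+ 2) / (1 - a * c) ^+ 2)) = (1 - a ^+ 2) / (1 - 2 * a * c + a ^+ 2).
  by move=> w0; field; rewrite p1 d1.
by rewrite [(_ * _) x]/(_ * _) E1 E2 E3// gt_eqF.
Qed.

Lemma mob_int x (k : int) : mob (x + k%:~R) = mob x + k%:~R.
Proof.
rewrite /mob.
have h := cisD x k%:~R; rewrite cis_int mulr1 in h.
have -> : sin (2 * pi * (x + k%:~R)) = sin (2 * pi * x) :> R.
  exact: (congr1 (@complex.Im R) h).
have -> : cos (2 * pi * (x + k%:~R)) = cos (2 * pi * x) :> R.
  exact: (congr1 (@complex.Re R) h).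
by rewrite addrAC.
Qed.

(** With [w = e^(2 i pi x)] and [u = a sin / (1 - a cos)] one has
    [1 - a w^-1 = (1 - a cos)(1 + i u)] and [1 - a w = (1 - a cos)(1 - i u)], and the angle
    [2 arctan u] is the argument of [(1 + i u) / (1 - i u)]. *)
Lemma cis_mob x : cis (mob x) = (cis x - a%:C%C) / (1 - a%:C%C * cis x).
Proof.
have p0 := mob_den_gt0 x.
have d0 : 1 - a%:C%C * cis x != 0.
  apply/eqP => /(congr1 (@complex.Re R)); rewrite ReD ReN ReM /= mul0r subr0.
  by move=> h; move: p0; rewrite h ltxx.
rewrite /mob cisD -[X in _ / X]mulr1 -[LHS]mulr1; apply: (mulIf d0).
rewrite mulr1 mulr1 divfK//.
set u := a * sin _ / _.
have -> : cis (pi^-1 * atan u) = Complex ((1 - u ^+ 2) / (1 + u ^+ 2)) (2 * u / (1 + u ^+ 2)).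
  have u0 : 1 + u ^+ 2 != 0 by rewrite gt_eqF// ltr_wpDr ?sqr_ge0.
  have cy : cos (atan u) != 0 by rewrite cos_atan invr_eq0 sqrtr_eq0 -ltNge ltr_wpDr ?sqr_ge0.
  have sy : sin (atan u) = u * cos (atan u).
    by apply: (canRL (divfK cy)); rewrite -/(tan _) atanK.
  have cc : cos (atan u) ^+ 2 = (1 + u ^+ 2)^-1.
    apply: (mulfI u0); rewrite mulfV// mulrDl mul1r -exprMn -sy.
    exact: cos2Dsin2.
  have E : 2 * pi * (pi^-1 * atan u) = atan u *+ 2.
    by rewrite mulrA mulfK ?gt_eqF ?pi_gt0// mulr_natl.
  rewrite /cis E cos_mulr2n sin_mulr2n sy (mulrC u) mulrA -expr2 cc.
  by apply: cplx_eq => /=; field.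
have cs := cos2Dsin2 (2 * pi * x).
have p1 : 1 - a * cos (2 * pi * x) != 0 by rewrite gt_eqF.
rewrite /u; set c := cos _ in p1 cs *; set s := sin _ in cs *.
have D0 : (1 - a * c) ^+ 2 + (a * s) ^+ 2 != 0.
  by rewrite gt_eqF// ltr_wpDr ?sqr_ge0// exprn_even_gt0.
set X := (1 - _ ^+ 2) / _; set Y := 2 * _ / _.
have E0 : 1 + (a * s / (1 - a * c)) ^+ 2 = ((1 - a * c) ^+ 2 + (a * s) ^+ 2) / (1 - a * c) ^+ 2.
  by field.
(* With [p = 1 - a c] and [q = a s], [X + i Y = (p + i q) / (p - i q)]; [E1] and [E2] are the real
   and imaginary parts of [(X + i Y)(p - i q) = p + i q]. *)
have E1 : X * (1 - a * c) + Y * (a * s) = 1 - a * c.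
  by rewrite /X /Y E0; field; rewrite p1 D0.
have E2 : Y * (1 - a * c) - X * (a * s) = a * s.
  by rewrite /X /Y E0; field; rewrite p1 D0.
have E3 : c * (1 - a * c) - s * (a * s) = c - a.
  by transitivity (c - a * (c ^+ 2 + s ^+ 2)); [ring|rewrite cs mulr1].
apply: cplx_eq; rewrite !(ReM, ImM, ReD, ImD, ReN, ImN) /cis /= -/c -/s.
  transitivity (c * (X * (1 - a * c) + Y * (a * s)) - s * (Y * (1 - a * c) - X * (a * s))).
    by ring.
  by rewrite E1 E2 E3; ring.
transitivity (s * (X * (1 - a * c) + Y * (a * s)) + c * (Y * (1 - a * c) - X * (a * s))).
  by ring.
by rewrite E1 E2; ring.
Qed.

End Fixed.
End MobiusLift.

(** * Growth and complex-valued integrals *)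

Section Growth.
Context {R : realType}.

Lemma growth_max n (k : nat) (x : 'rV[R]_n) : exists t : R,
  [/\ 1 <= t, forall j, `|x 0 j| <= t & t ^+ k <= growth k x].
Proof.
suff [t [t1 ht tk]] : exists t : R, [/\ 1 <= t,
    forall j, j \in index_enum 'I_n -> `|x 0 j| <= t &
    t ^+ k <= 1 + \sum_(j <- index_enum 'I_n) `|x 0 j| ^+ k].
  by exists t; split=> // j; apply: ht; exact: mem_index_enum.
elim: (index_enum _) => [|i r [t [t1 ht tk]]].
  by exists 1; split=> //; rewrite big_nil addr0 expr1n.
have s0 : 0 <= \sum_(j <- r) `|x 0 j| ^+ k by rewrite sumr_ge0// => j _; rewrite exprn_ge0.
have [ti|/ltW ti] := leP t `|x 0 i|.
  exists `|x 0 i|; split; first exact: le_trans ti.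
    by move=> j; rewrite inE => /orP[/eqP ->//|/ht h]; exact: le_trans ti.
  by rewrite big_cons addrCA lerDl addr_ge0.
exists t; split=> //.
  by move=> j; rewrite inE => /orP[/eqP ->//|/ht].
by rewrite big_cons addrCA ler_wpDl// exprn_ge0.
Qed.

(** [1 / rho q] is the product of the [1 + q_i^2], hence at most a polynomial of degree [2 m] in [x]
    once [q] is bounded linearly by [x]. This converts decay at the points into summability over the
    indices. *)
Lemma growth_dominates m n (K : R) : 0 <= K -> exists2 c : R, 0 < c &
  forall (q : 'rV[int]_m) (x : 'rV[R]_n),
    (forall i, `|(q 0 i)%:~R : R| <= K * (1 + \sum_j `|x 0 j|)) ->
    (growth (2 * m) x)^-1 <= c * rho q.
Proof.
move=> K0.
exists ((1 + K ^+ 2) ^+ m * n.+1%:R ^+ (2 * m)).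
  by rewrite mulr_gt0// exprn_gt0// ltr_wpDr// sqr_ge0.
move=> q x hq; have [t [t1 ht tk]] := growth_max (2 * m) x.
have t0 : 0 < t by apply: lt_le_trans t1.
have S1 : 1 + \sum_j `|x 0 j| <= n.+1%:R * t.
  rewrite -natr1 mulrDl mul1r addrC lerD//.
  apply: (@le_trans _ _ (\sum_(j < n) t)); first exact: ler_sum.
  by rewrite sumr_const card_ord mulr_natl.
have S0 : 1 <= 1 + \sum_j `|x 0 j| by rewrite lerDl sumr_ge0.
set S := 1 + _ in hq S1 S0.
rewrite -[X in X <= _]mul1r ler_pdivrMr ?growth_gt0//.
have rq : (rho q)^-1 <= ((1 + K ^+ 2) * S ^+ 2) ^+ m.
  rewrite /rho -prodfV; apply: (@le_trans _ _ (\prod_(i < m) ((1 + K ^+ 2) * S ^+ 2))).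
    apply: ler_prod => i _; rewrite /rho1 invrK addr_ge0 ?sqr_ge0//=.
    have : (q 0 i)%:~R ^+ 2 <= (K * S) ^+ 2.
      rewrite -[leLHS]real_normK ?num_real// ler_sqr ?nnegrE//.
      by rewrite mulr_ge0// (le_trans _ S0).
    rewrite mulrDl mul1r -exprMn => h; apply: lerD => //.
    by rewrite expr_ge1// (le_trans _ S0).
  by rewrite prodr_const card_ord.
have : (rho q)^-1 <= (1 + K ^+ 2) ^+ m * n.+1%:R ^+ (2 * m) * growth (2 * m) x.
  apply: le_trans rq _; rewrite exprMn -mulrA; apply: ler_wpM2l.
    by rewrite exprn_ge0// addr_ge0// sqr_ge0.
  rewrite -exprM; apply: le_trans (_ : (n.+1%:R * t) ^+ (2 * m) <= _).
    by apply: lerXn2r; rewrite ?nnegrE// ?mulr_ge0// ?(ltW t0)// (le_trans _ S0).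
  by rewrite exprMn ler_wpM2l// exprn_ge0.
rewrite -[X in X <= _ -> _]mul1r ler_pdivrMr ?rho_gt0// => h.
by apply: le_trans h _; rewrite mulrAC.
Qed.

End Growth.

(** * Complex-valued integrals over symmetric intervals *)

Section ComplexIntegral.
Context {R : realType}.
Local Notation C := R[i].
Local Notation cabs := (@ComplexField.Normc.normc R).
Local Notation Re := (@complex.Re R).
Local Notation Im := (@complex.Im R).
Local Notation lam := (@lebesgue_measure R).

Definition ccont (f : R -> C) := continuous (Re \o f) /\ continuous (Im \o f).

Lemma ccontM f g : ccont f -> ccont g -> ccont (fun x => f x * g x).
Proof.
move=> [fr fi] [gr gi]; split.
  rewrite (_ : Re \o _ = fun x => Re (f x) * Re (g x) + (-1) * (Im (f x) * Im (g x))).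
    by apply: contD; [exact: contM|apply: contM; [exact: cont_cst|exact: contM]].
  by apply/funext => x /=; rewrite ReM mulN1r.
rewrite (_ : Im \o _ = fun x => Re (f x) * Im (g x) + Im (f x) * Re (g x)).
  by apply: contD; exact: contM.
by apply/funext => x /=; rewrite ImM.
Qed.

Lemma ccontD f g : ccont f -> ccont g -> ccont (fun x => f x + g x).
Proof.
move=> [fr fi] [gr gi]; split.
  rewrite (_ : Re \o _ = fun x => Re (f x) + Re (g x)); first exact: contD.
  by apply/funext => x /=; rewrite ReD.
rewrite (_ : Im \o _ = fun x => Im (f x) + Im (g x)); first exact: contD.
by apply/funext => x /=; rewrite ImD.
Qed.

Lemma ccont_cst (c : C) : ccont (fun=> c).
Proof. by split; exact: cont_cst. Qed.

Lemma ccont_real (f : R -> R) : continuous f -> ccont (fun x => (f x)%:C%C).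
Proof. by move=> cf; split => //; exact: cont_cst. Qed.

Lemma ccont_cis (f : R -> R) : continuous f -> ccont (fun x => cis (f x)).
Proof.
move=> cf; split=> x.
  exact: (@continuous_comp _ _ _ f _ x (cf x) (@continuous_cosl R (2 * pi) _)).
exact: (@continuous_comp _ _ _ f _ x (cf x) (@continuous_sinl R (2 * pi) _)).
Qed.

Lemma ccont_sum (I : Type) (r : seq I) (F : I -> R -> C) :
  (forall i, ccont (F i)) -> ccont (fun x => \sum_(i <- r) F i x).
Proof.
move=> h; elim: r => [|i r ih].
  rewrite (_ : (fun _ => _) = fun=> 0); first exact: ccont_cst.
  by apply/funext => x; rewrite big_nil.
rewrite (_ : (fun _ => _) = fun x => F i x + \sum_(j <- r) F j x); first exact: ccontD.
by apply/funext => x; rewrite big_cons.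
Qed.

Definition cintegral (W : R) (f : R -> C) : C :=
  Complex (\int[lam]_(x in `[- W, W]) Re (f x)) (\int[lam]_(x in `[- W, W]) Im (f x)).

Lemma eq_cintegral W f g : (forall x, - W <= x <= W -> f x = g x) ->
  cintegral W f = cintegral W g.
Proof.
move=> fg; rewrite /cintegral; congr Complex; apply: eq_Rintegral => x;
  by rewrite inE/= in_itv/= => hx; rewrite fg.
Qed.

Lemma cintegral_lin W c f g : ccont f -> ccont g ->
  cintegral W (fun x => c * f x + g x) = c * cintegral W f + cintegral W g.
Proof.
move=> [fr fi] [gr gi].
have L (u v : R -> R) (d : R) : continuous u -> continuous v ->
    \int[lam]_(x in `[- W, W]) (d * u x + v x) =
    d * \int[lam]_(x in `[- W, W]) u x + \int[lam]_(x in `[- W, W]) v x.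
  move=> cu cv; rewrite RintegralD//; last 2 first.
  - by apply: continuous_itv_integrable; apply: contM => //; exact: cont_cst.
  - exact: continuous_itv_integrable.
  by rewrite RintegralZl//; exact: continuous_itv_integrable.
have cz (d : R) (u : R -> R) : continuous u -> continuous (fun x => d * u x).
  by move=> cu; apply: contM => //; exact: cont_cst.
rewrite /cintegral.
under eq_Rintegral => x _ do rewrite ReD ReM -addrA -mulNr.
rewrite L//; last by apply: contD => //; exact: cz.
rewrite L//.
under [X in Complex _ X]eq_Rintegral => x _ do rewrite ImD ImM -addrA.
rewrite L//; last by apply: contD => //; exact: cz.
rewrite L//.
by apply: cplx_eq; rewrite ?ReD ?ImD ?ReM ?ImM /= addrA ?mulNr.
Qed.

Lemma cintegral0 W : cintegral W (fun=> 0) = 0.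
Proof. by rewrite /cintegral /Rintegral integral0. Qed.

Lemma cintegral_sum W (I : Type) (r : seq I) (c : I -> C) (F : I -> R -> C) :
  (forall i, ccont (F i)) ->
  cintegral W (fun x => \sum_(i <- r) c i * F i x) = \sum_(i <- r) c i * cintegral W (F i).
Proof.
move=> h; elim: r => [|i r ih].
  by rewrite big_nil -[RHS](cintegral0 W); apply: eq_cintegral => x _; rewrite big_nil.
rewrite big_cons -ih -cintegral_lin//; last first.
  by apply: ccont_sum => j; apply: ccontM; [exact: ccont_cst|exact: h].
by apply: eq_cintegral => x _; rewrite big_cons.
Qed.

Lemma Rintegral_le_itv (f g : R -> R) (a b : R) : continuous f -> continuous g ->
  (forall x, a <= x <= b -> `|f x| <= g x) ->
  `|\int[lam]_(x in `[a, b]) f x| <= \int[lam]_(x in `[a, b]) g x.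
Proof.
move=> cf cg fg.
apply: le_trans (le_normr_Rintegral _ (@continuous_itv_integrable _ _ _ _ cf)) _ => //.
apply: le_Rintegral => //.
- exact: (integrable_norm (@continuous_itv_integrable _ _ _ _ cf)).
- exact: continuous_itv_integrable.
Qed.

Lemma cintegral_le W f (g : R -> R) : ccont f -> continuous g ->
  (forall x, - W <= x <= W -> cabs (f x) <= g x) ->
  cabs (cintegral W f) <= 2 * \int[lam]_(x in `[- W, W]) g x.
Proof.
move=> [fr fi] cg fg; apply: le_trans (cabs_le_ReIm _) _.
rewrite mulr_natl mulr2n; apply: lerD; apply: Rintegral_le_itv => // x /fg.
  by apply: le_trans; exact: Re_le_cabs.
by apply: le_trans; exact: Im_le_cabs.
Qed.

(** The length [2 W] appears doubled because real and imaginary parts are estimated separately. *)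
Lemma cintegral_bound W f (c : R) : 0 <= W -> ccont f ->
  (forall x, - W <= x <= W -> cabs (f x) <= c) ->
  cabs (cintegral W f) <= 4 * W * c.
Proof.
move=> W0 cf fc; apply: le_trans (cintegral_le cf (@cont_cst _ c) fc) _.
by rewrite Rintegral_cst_itv; [rewrite opprK; lra|lra].
Qed.

Lemma fejer_sum_cvgC (W : nat) (f : R -> C) (a : R) (P : nat) : ccont f ->
  (forall x, W%:R < `|x| -> f x = 0) -> W%:R + `|a| <= P%:R -> forall e : R, 0 < e ->
  exists N0 : nat, forall N, (N0 <= N)%N ->
  cabs (cintegral W%:R (fun x => f x * (fejer N (x + a))%:C%C) -
        \sum_(j <- ibox P) f (j%:~R - a)) <= e.
Proof.
move=> [fr fi] f0 WP e e0.
have key (g : R -> R) : continuous g -> (forall x, W%:R < `|x| -> g x = 0) ->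
    exists N0 : nat, forall N, (N0 <= N)%N ->
    `|\int[lam]_(x in `[- W%:R, W%:R]) (g x * fejer N (x + a)) -
        \sum_(j <- ibox P) g (j%:~R - a)| <= e / 2.
  move=> cg g0.
  pose g1 (u : 'rV[R]_1) : R := g (u 0 0).
  have kg : kc W%:R g1.
    split=> [u|u i hi].
      exact: (@continuous_comp _ _ _ (fun u : 'rV[R]_1 => u 0 0) g u
        (@coord_continuous R 1 1 ord0 ord0 u) (cg _)).
    by apply: g0; move: hi; rewrite (ord1 i).
  have [M M0 hM] := kc_bounded kg.
  have /choice[w hw] : forall d : R, exists w : R, 0 < d -> 0 < w /\
      forall x y : R, `|x - y| <= w -> `|g x - g y| <= d.
    move=> d; have [d0|] := ltP 0 d; last by exists 0.
    have [w w0 hw] := kc_ucont kg d0; exists w => _; split=> // x y xy.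
    have := hw (\row__ x) (\row__ y); rewrite /g1 !mxE; apply=> i.
    by rewrite !mxE.
  have [||N0 h0] := @fejer_sum_cvg R W%:R M w a P _ WP (e / 2).
  - by move=> d /hw[].
  - by rewrite divr_gt0.
  exists N0 => N NN; rewrite -(@Rintegral_kc1 _ _ W%:R)//; last first.
    by move=> x hx; rewrite g0// mul0r.
  apply: h0 => //.
    by move=> x; have := hM (\row__ x); rewrite /g1 mxE.
  by move=> d x y d0 xy; have [_ h1] := hw d d0; exact: h1.
have [N1 h1] := key _ fr (fun x hx => congr1 Re (f0 x hx)).
have [N2 h2] := key _ fi (fun x hx => congr1 Im (f0 x hx)).
exists (maxn N1 N2) => N; rewrite geq_max => /andP[/h1 {}h1 /h2 {}h2].
apply: le_trans (cabs_le_ReIm _) _; rewrite [leRHS]splitr.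
rewrite ReD ImD ReN ImN Re_sum Im_sum /=; apply: lerD.
  under eq_Rintegral => x _ do rewrite ReM /= mulr0 subr0.
  exact: h1.
under eq_Rintegral => x _ do rewrite ImM /= mulr0 add0r.
exact: h2.
Qed.

End ComplexIntegral.

(** * Poisson summation along a transversal curve *)

Section Foliation.
Context {R : realType}.
Local Notation C := R[i].
Local Notation cabs := (@ComplexField.Normc.normc R).
Local Notation Re := (@complex.Re R).
Local Notation Im := (@complex.Im R).

Variables (n : nat) (b : 'rV[R]_n) (A : 'I_n -> R -> R) (A0 : R -> R).
Variables (dA : 'I_n -> R -> R) (dA0 : R -> R) (m M : R).
Hypothesis b0 : forall i, 0 < b 0 i.
Hypothesis m0 : 0 < m.
Hypothesis AP : forall i (x : R), is_derive x (1 : R) (A i) (dA i x).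
Hypothesis A0P : forall x : R, is_derive x (1 : R) A0 (dA0 x).
Hypothesis dA_bounds : forall i x, m <= dA i x <= M.
Hypothesis dA0_bounds : forall x, m <= dA0 x <= M.

(** A lift [y] of a point of [psi(R^n)] can be chosen with [y_m + b.(y_1, ..., y_n) = 0], so this
    linear form labels the leaves in the universal cover; [trans] is its value along the lifted
    curve. *)
Definition trans (x : R) : R := A0 x + \sum_i b 0 i * A i x.

Definition dtrans (x : R) : R := dA0 x + \sum_i b 0 i * dA i x.

Lemma is_derive_trans (x : R) : is_derive x (1 : R) trans (dtrans x).
Proof.
apply: (@is_deriveD R R R A0 (fun x => \sum_i b 0 i * A i x)).
apply: (@is_derive_bigsum R 'I_n (index_enum 'I_n) (fun i y => b 0 i * A i y)
  (fun i y => b 0 i * dA i y) x).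
Qed.

Lemma dtrans_ge x : m <= dtrans x.
Proof.
rewrite /dtrans; have /andP[h _] := dA0_bounds x; apply: ler_wpDr => //.
apply: sumr_ge0 => i _; apply: mulr_ge0; first exact: ltW.
by have /andP[h1 _] := dA_bounds i x; rewrite (le_trans _ h1)// ltW.
Qed.

Lemma dtrans_le x : dtrans x <= M + \sum_i b 0 i * M.
Proof.
rewrite /dtrans; have /andP[_ h] := dA0_bounds x; apply: lerD => //.
apply: ler_sum => i _; apply: ler_wpM2l; first exact: ltW.
by have /andP[] := dA_bounds i x.
Qed.

Lemma trans_incr x y : x <= y -> m * (y - x) <= trans y - trans x.
Proof.
move=> xy; have h z : m <= dtrans z <= M + \sum_i b 0 i * M.
  by rewrite dtrans_ge dtrans_le.
by have /andP[] := mvt_bound is_derive_trans h xy.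
Qed.

Lemma trans_surj w : exists x, trans x = w.
Proof.
pose N := `|w - trans 0| / m.
have N0 : 0 <= N by rewrite divr_ge0// ltW.
have mN : m * N = `|w - trans 0| by rewrite /N mulrC divfK// gt_eqF.
have h1 : w <= trans N.
  have := trans_incr N0; rewrite subr0 mN; have := ler_norm (w - trans 0); lra.
have h2 : trans (- N) <= w.
  have NN : - N <= 0 by rewrite oppr_le0.
  have := trans_incr NN; rewrite sub0r opprK mN.
  have := ler_norm (- (w - trans 0)); rewrite normrN; lra.
have NN : - N <= N by rewrite (@le_trans _ _ 0)// oppr_le0.
have [||c _ hc] := @IVT R trans (- N) N w NN.
- exact/continuous_subspaceT/is_derive_continuous/is_derive_trans.
- by rewrite ge_min h2 le_max h1 orbT.
by exists c.
Qed.

Definition Theta (w : R) : R := xget 0 [set x | trans x = w].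

Lemma ThetaK w : trans (Theta w) = w.
Proof.
rewrite /Theta; case: xgetP => [x _ //|h]; have [x hx] := trans_surj w.
by case: (h x).
Qed.

Lemma trans_inj : injective trans.
Proof.
move=> x y xy; apply/eqP; rewrite eq_le.
suff h u v : trans u = trans v -> v <= u by rewrite !h.
move=> uv; rewrite leNgt; apply/negP => vu.
have := trans_incr (ltW vu); rewrite uv subrr; apply/negP; rewrite -ltNge.
by rewrite mulr_gt0// subr_gt0.
Qed.

Lemma transK x : Theta (trans x) = x.
Proof. by apply: trans_inj; rewrite ThetaK. Qed.

Lemma Theta_lip x y : `|Theta x - Theta y| <= `|x - y| / m.
Proof.
rewrite ler_pdivlMr// mulrC.
suff h u v : Theta u <= Theta v -> m * `|Theta u - Theta v| <= `|u - v|.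
  have [xy|/ltW yx] := leP (Theta x) (Theta y); first exact: h.
  by rewrite distrC (distrC x); exact: h.
move=> uv; have := trans_incr uv; rewrite !ThetaK => h.
rewrite distrC ger0_norm ?subr_ge0//; apply: le_trans h _.
by rewrite distrC ler_norm.
Qed.

Lemma Theta_continuous : continuous Theta.
Proof.
move=> x; apply/cvgrPdist_le => e e0; near=> y.
apply: le_trans (Theta_lip _ _) _; rewrite ler_pdivrMr//.
near: y; apply: cvgr_dist_le; last by rewrite mulr_gt0.
exact: cvg_id.
Unshelve. all: by end_near. Qed.

Definition tent (x : R) : R := Num.max 0 (1 - `|x|).

Lemma tent_ge0 x : 0 <= tent x.
Proof. by rewrite le_max lexx. Qed.

Lemma tent_le1 x : tent x <= 1.
Proof. by rewrite ge_max ler01 gerBl normr_ge0. Qed.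

Lemma tent_out x : 1 <= `|x| -> tent x = 0.
Proof. by move=> h; apply/max_idPl; rewrite subr_le0. Qed.

Lemma tent_in x : `|x| <= 1 -> tent x = 1 - `|x|.
Proof. by move=> h; apply/max_idPr; rewrite subr_ge0. Qed.

Lemma tent_lip x y : `|tent x - tent y| <= `|x - y|.
Proof.
apply: le_trans (ler_dist_dist x y); rewrite /tent.
by case: (leP 0 (1 - `|x|)) => h1; case: (leP 0 (1 - `|y|)) => h2; rewrite ler_norml; apply/andP; split;
  have := ler_norm (`|x| - `|y|); have := ler_norm (- (`|x| - `|y|));
  rewrite normrN; move: h1 h2; lra.
Qed.

Lemma tent_continuous : continuous tent.
Proof.
move=> x; apply/cvgrPdist_le => e e0; near=> y.
apply: le_trans (tent_lip _ _) _; near: y; exact: cvgr_dist_le.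
Unshelve. all: by end_near. Qed.

(* [chiT] below vanishes outside [-Wbound, Wbound]. *)
Definition Wbound : nat := (Num.truncn (`|trans 1| + `|trans (-1)|)).+1.

Local Notation W := (Wbound%:R : R).

Lemma Theta_out w : W < `|w| -> 1 < `|Theta w|.
Proof.
move=> hw; rewrite ltNge; apply/negP; rewrite ler_norml => /andP[h1 h2].
have W1 : `|trans 1| + `|trans (-1)| <= W by exact/ltW/truncnS_gt.
have := trans_incr h1; have := trans_incr h2; rewrite ThetaK => h3 h4.
have h5 : 0 <= m * (1 - Theta w) by rewrite mulr_ge0 ?subr_ge0// ltW.
have h6 : 0 <= m * (Theta w - -1) by rewrite mulr_ge0 ?subr_ge0// ltW.
move: hw; apply/negP; rewrite -leNgt ler_norml.
have := ler_norm (trans 1); have := ler_norm (- trans (-1)); rewrite normrN.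
have := normr_ge0 (trans 1); have := normr_ge0 (trans (-1)).
by move: h3 h4 h5 h6 W1; lra.
Qed.

Definition chiT (w : R) : R := tent (Theta w).

Lemma chiT_out w : W < `|w| -> chiT w = 0.
Proof. by move=> /Theta_out/ltW; exact: tent_out. Qed.

Lemma chiT_continuous : continuous chiT.
Proof.
move=> w; exact: (@continuous_comp _ _ _ Theta tent w (@Theta_continuous w)
  (@tent_continuous _)).
Qed.

Lemma chiT_bound w : `|chiT w| <= 1.
Proof. by rewrite ger0_norm ?tent_ge0// tent_le1. Qed.

Definition alpha (w : R) : 'rV[R]_n := \row_i A i (Theta w).

Lemma alpha_continuous i : continuous (fun w => alpha w 0 i).
Proof.
rewrite (_ : (fun w => _) = A i \o Theta); last by apply/funext => w; rewrite /= mxE.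
move=> w; exact: (@continuous_comp _ _ _ Theta (A i) w (@Theta_continuous w)
  (is_derive_continuous (AP i) (x := _))).
Qed.

Lemma A0T_continuous : continuous (fun w => A0 (Theta w)).
Proof.
move=> w; exact: (@continuous_comp _ _ _ Theta A0 w (@Theta_continuous w)
  (is_derive_continuous A0P (x := _))).
Qed.

(** Eliminating [A_m] in this way turns the phase [l A_m + p.A] into [l w + (p - l b).alpha w], in
    which the dual point [p - l b] appears. *)
Lemma trans_alpha w : A0 (Theta w) = w - dot b (alpha w).
Proof.
apply/eqP; rewrite eq_sym subr_eq -[X in X == _]ThetaK /trans /dot; apply/eqP.
by congr (_ + _); apply: eq_bigr => i _; rewrite mxE.
Qed.

Lemma continuous_bounded_itv (f : R -> R) : continuous f ->
  exists2 K : R, 0 <= K & forall w, - W <= w <= W -> `|f w| <= K.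
Proof.
move=> cf; have : bounded_set (f @` `[- W, W]).
  apply: compact_bounded; apply: continuous_compact; last exact: segment_compact.
  exact: continuous_subspaceT.
move=> [K [_ hK]]; exists (`|K| + 1) => [|w hw]; first by rewrite addr_ge0.
apply: hK; last by exists w => //=; rewrite in_itv.
by rewrite (le_lt_trans (ler_norm _))// ltrDl.
Qed.

Lemma alpha_bounded : exists2 K : R, 0 <= K &
  forall i w, - W <= w <= W -> `|alpha w 0 i| <= K.
Proof.
have /choice[K hK] : forall i : 'I_n, exists K : R, 0 <= K /\
    forall w, - W <= w <= W -> `|alpha w 0 i| <= K.
  by move=> i; have [K K0 hK] := continuous_bounded_itv (@alpha_continuous i); exists K.
exists (\sum_i K i) => [|i w hw]; first by apply: sumr_ge0 => i _; have [] := hK i.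
have [_ /(_ w hw) h] := hK i; apply: le_trans h _.
rewrite (bigD1 i)//= lerDl sumr_ge0// => j _; by have [] := hK j.
Qed.

(* An index [q] stands for the pair [(j, k)] (resp. [(l, p)]) of its head [q 0 0] and its
   tail [qtl q]. *)
Definition qtl (q : 'rV[int]_n.+1) : 'rV[int]_n := \row_i q 0 (lift ord0 i).

Definition muarg (q : 'rV[int]_n.+1) : R := (q 0 0)%:~R - dot b (intv (qtl q)).

Definition mupt q : 'rV[R]_n := alpha (muarg q) + intv (qtl q).

Definition nupt (q : 'rV[int]_n.+1) : 'rV[R]_n := latpt (qtl q) ((q 0 0)%:~R *: b).

Definition nucoef (q : 'rV[int]_n.+1) : C := cintegral W (fun w =>
  (chiT w)%:C%C * cis (- ((q 0 0)%:~R * A0 (Theta w) + dot (intv (qtl q)) (alpha w)))).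

Lemma qtl_cons j p : qtl (consv j p) = p.
Proof. by apply/rowP => i; rewrite mxE consvS. Qed.

Lemma dot_alpha_continuous (y : 'rV[R]_n) : continuous (fun w => dot y (alpha w)).
Proof.
rewrite /dot; elim: (index_enum _) => [|i r ih].
  rewrite (_ : (fun _ => _) = fun=> 0); first exact: cont_cst.
  by apply/funext => x; rewrite big_nil.
rewrite (_ : (fun _ => _) = fun w => y 0 i * alpha w 0 i + \sum_(j <- r) y 0 j * alpha w 0 j).
  apply: contD => //; apply: contM; [exact: cont_cst|exact: alpha_continuous].
by apply/funext => x; rewrite big_cons.
Qed.

Lemma phase_ccont (l : R) (y : 'rV[R]_n) :
  ccont (fun w => cis (- (l * A0 (Theta w) + dot y (alpha w))) : C).
Proof.
apply: ccont_cis.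
rewrite (_ : (fun w => _) = fun w => (-1) * (l * A0 (Theta w) + dot y (alpha w))).
  apply: contM; first exact: cont_cst.
  apply: contD; last exact: dot_alpha_continuous.
  by apply: contM; [exact: cont_cst|exact: A0T_continuous].
by apply/funext => w; rewrite mulN1r.
Qed.

Lemma nucoef_bound q : cabs (nucoef q) <= 4 * W.
Proof.
rewrite -[leRHS]mulr1; apply: cintegral_bound => //.
  by apply: ccontM; [exact/ccont_real/chiT_continuous|exact: phase_ccont].
by move=> w _; rewrite cabsM cabs_cis mulr1 cabs_real chiT_bound.
Qed.

(** Change of variable [w = F x]. The interval [[-W, W]] contains the image of [-1, 1] and [f]
    vanishes on the two excess pieces. *)
Lemma Rintegral_trans (f : R -> R) : continuous dtrans -> continuous f ->
  (forall w, 1 <= `|Theta w| -> f w = 0) ->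
  \int[@lebesgue_measure R]_(w in `[- W, W]) f w =
  \int[@lebesgue_measure R]_(x in `[- 1, 1]) (f (trans x) * dtrans x).
Proof.
move=> cd cf f0.
have ct := is_derive_continuous is_derive_trans.
have t11 : trans (-1) <= trans 1.
  have N11 : -1 <= 1 :> R by rewrite (@le_trans _ _ 0).
  rewrite -subr_ge0; apply: le_trans (trans_incr N11).
  by rewrite mulr_ge0 ?ltW// subr_ge0.
have WT : `|trans 1| + `|trans (-1)| <= W by exact/ltW/truncnS_gt.
have WN : - W <= trans (-1).
  have := ler_norm (- trans (-1)); rewrite normrN.
  have := normr_ge0 (trans 1); move: WT; lra.
have WP : trans 1 <= W.
  have := ler_norm (trans 1); have := normr_ge0 (trans (-1)); move: WT; lra.
have z a c : (forall w, a <= w <= c -> 1 <= `|Theta w|) ->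
    \int[@lebesgue_measure R]_(w in `[a, c]) f w = 0.
  move=> h; transitivity (\int[@lebesgue_measure R]_(w in `[a, c]) (0 : R)).
    by apply: eq_Rintegral => w; rewrite inE/= in_itv/= => /h/f0.
  by rewrite /Rintegral integral0.
have tle x y : trans x <= trans y -> x <= y.
  move=> xy; rewrite leNgt; apply/negP => yx; have := trans_incr (ltW yx).
  apply/negP; rewrite -ltNge (@le_lt_trans _ _ 0) ?subr_le0// mulr_gt0// subr_gt0//.
rewrite (Rintegral_chasles cf WN (le_trans t11 WP)) (Rintegral_chasles cf t11 WP).
rewrite z ?add0r; last first.
  move=> w /andP[_]; rewrite -{1}(ThetaK w) => /tle h.
  by rewrite ler0_norm; lra.
rewrite [X in _ + X]z ?addr0; last first.
  move=> w /andP[]; rewrite -{1}(ThetaK w) => /tle h _.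
  by rewrite ger0_norm; lra.
have N11 : -1 <= 1 :> R by lra.
have dE : trans^`()%classic = dtrans.
  by apply/funext => x; rewrite derive1E; have [_] := is_derive_trans x.
rewrite /Rintegral (integration_by_substitution_increasing (F := trans) N11).
- by rewrite dE.
- move=> x y _ _ xy; rewrite -subr_gt0; apply: lt_le_trans (trans_incr (ltW xy)).
  by rewrite mulr_gt0// subr_gt0.
- by move=> x _; rewrite dE; exact: cd.
- by apply/cvg_ex; exists (dtrans (-1)); rewrite dE; apply: cvg_at_right_filter; exact: cd.
- by apply/cvg_ex; exists (dtrans 1); rewrite dE; apply: cvg_at_left_filter; exact: cd.
- split; first by move=> x _; have [] := is_derive_trans x.
  + by apply: cvg_at_right_filter; exact: ct.
  + by apply: cvg_at_left_filter; exact: ct.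
- exact: continuous_subspaceT.
Qed.

Lemma nucoef_trans q : continuous dtrans -> nucoef q = cintegral 1 (fun x =>
  (tent x)%:C%C * (cis (- ((q 0 0)%:~R * A0 x + \sum_i (qtl q 0 i)%:~R * A i x)) *
    (dtrans x)%:C%C)).
Proof.
move=> cd; have c1 := ccont_real chiT_continuous.
have [cr ci] := ccontM c1 (phase_ccont (q 0 0)%:~R (intv (qtl q))).
have out (w : R) (z : C) : 1 <= `|Theta w| -> (chiT w)%:C%C * z = 0.
  by move=> h; rewrite /chiT tent_out// mul0r.
have E x : (chiT (trans x))%:C%C * cis (- ((q 0 0)%:~R * A0 (Theta (trans x)) +
    dot (intv (qtl q)) (alpha (trans x)))) = (tent x)%:C%C *
    cis (- ((q 0 0)%:~R * A0 x + \sum_i (qtl q 0 i)%:~R * A i x)) :> C.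
  rewrite /chiT transK; congr (_ * cis (- (_ + _))).
  by rewrite /dot; apply: eq_bigr => i _; rewrite !mxE transK.
rewrite /nucoef /cintegral; congr Complex.
  rewrite [LHS](Rintegral_trans cd cr) => [|w hw]; last by rewrite /comp out.
  apply: eq_Rintegral => x _; rewrite /comp E mulrA [in RHS]ReM.
  by rewrite mulr0 subr0.
rewrite [LHS](Rintegral_trans cd ci) => [|w hw]; last by rewrite /comp out.
apply: eq_Rintegral => x _; rewrite /comp E mulrA [in RHS]ImM.
by rewrite mulr0 add0r.
Qed.

(** Beyond the bounds on derivatives, this is the only property of the curve entering the duality.
    For lifts of Blaschke factors it is supplied by [nucoef_vanish]. *)
Hypothesis vanish : forall q : 'rV[int]_n.+1,
  (forall i, 1 <= q 0 i) \/ (forall i, q 0 i <= -1) -> nucoef q = 0.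

(** A nonzero weight forces the leaf parameter into [-W, W], where [alpha] is bounded: [k] is then
    close to the point, and [j] is the parameter plus [b.k]. *)
Lemma mupt_growth : exists2 K : R, 0 <= K & forall q : 'rV[int]_n.+1,
  chiT (muarg q) != 0 -> forall i, `|(q 0 i)%:~R : R| <= K * (1 + \sum_j `|mupt q 0 j|).
Proof.
have [K K0 hK] := alpha_bounded.
have sb : 0 <= \sum_j b 0 j by apply: sumr_ge0 => j _; exact: ltW.
exists ((1 + K) * (1 + \sum_j b 0 j) + W) => [|q].
  by rewrite addr_ge0// mulr_ge0// addr_ge0.
set S := 1 + \sum_j `|mupt q 0 j|.
have S1 : 1 <= S by rewrite lerDl sumr_ge0.
move=> hq; have Wq : `|muarg q| <= W.
  by rewrite leNgt; apply: contra hq => /chiT_out ->.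
have kj j : `|(qtl q 0 j)%:~R : R| <= (1 + K) * S.
  have -> : (qtl q 0 j)%:~R = mupt q 0 j - alpha (muarg q) 0 j :> R.
    by rewrite !mxE addrAC subrr add0r.
  apply: le_trans (ler_normB _ _) _; rewrite mulrDl mul1r; apply: lerD.
    by rewrite /S (bigD1 j)//= addrCA lerDl addr_ge0// sumr_ge0.
  apply: (@le_trans _ _ K); first by apply: hK; rewrite -ler_norml.
  by rewrite ler_peMr.
have p1 : 0 <= (1 + K) * S by rewrite mulr_ge0// ?addr_ge0 ?sumr_ge0.
move=> i; case: (unliftP ord0 i) => [j ->|->].
  have := kj j; rewrite mxE => h; apply: le_trans h _.
  rewrite ler_wpM2r ?(le_trans _ S1)//.
  by rewrite mulrDr mulr1 -addrA lerDl addr_ge0// mulr_ge0// addr_ge0.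
have -> : (q 0 ord0)%:~R = muarg q + dot b (intv (qtl q)) by rewrite subrK.
apply: le_trans (ler_normD _ _) _.
have h2 : `|dot b (intv (qtl q))| <= (\sum_j b 0 j) * ((1 + K) * S).
  rewrite /dot mulr_suml; apply: le_trans (ler_norm_sum _ _ _) _.
  apply: ler_sum => j _; rewrite normrM (gtr0_norm (b0 j)) [intv _ _ _]mxE.
  by apply: ler_wpM2l; [exact: ltW|exact: kj].
have h3 : W <= W * S by rewrite ler_peMr.
apply: le_trans (lerD Wq h2) _.
have -> : ((1 + K) * (1 + \sum_j b 0 j) + W) * S =
  W * S + (\sum_j b 0 j) * ((1 + K) * S) + (1 + K) * S by ring.
by rewrite -[X in X <= _]addr0 lerD// lerD.
Qed.

(** If [l > 0] and the coefficient is nonzero, some [p_i <= 0], so [|p_i - l b_i| >= l b_i]: one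
    coordinate of the dual point already bounds [l], hence all of [p]. The case [l < 0] is
    symmetric, and for [l = 0] the point is [p] itself. *)
Lemma nupt_growth : exists2 K : R, 0 <= K & forall q : 'rV[int]_n.+1,
  nucoef q != 0 -> forall i, `|(q 0 i)%:~R : R| <= K * (1 + \sum_j `|nupt q 0 j|).
Proof.
pose B := \sum_j (b 0 j)^-1; pose Sb := \sum_j b 0 j.
have B0 : 0 <= B by apply: sumr_ge0 => j _; rewrite invr_ge0 ltW.
have Sb0 : 0 <= Sb by apply: sumr_ge0 => j _; rewrite ltW.
exists (1 + B + B * Sb) => [|q hq]; first by rewrite !addr_ge0// mulr_ge0.
set S := \sum_j `|nupt q 0 j|.
have S0 : 0 <= S by rewrite sumr_ge0.
have yS j : `|nupt q 0 j| <= S by rewrite /S (bigD1 j)//= lerDl sumr_ge0.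
have bB j : (b 0 j)^-1 <= B.
  by rewrite /B (bigD1 j)//= lerDl sumr_ge0// => i _; rewrite invr_ge0 ltW.
have bS j : b 0 j <= Sb by rewrite /Sb (bigD1 j)//= lerDl sumr_ge0// => i _; rewrite ltW.
have yE j : nupt q 0 j = (q 0 (lift ord0 j))%:~R - (q 0 0)%:~R * b 0 j by rewrite !mxE.
have key j : `|(q 0 0)%:~R : R| * b 0 j <= `|nupt q 0 j| -> `|(q 0 0)%:~R : R| <= B * S.
  move=> h; have {h} : `|(q 0 0)%:~R : R| * b 0 j <= S by exact: le_trans h (yS j).
  rewrite -ler_pdivlMr// => h; apply: le_trans h _; rewrite mulrC.
  by apply: ler_wpM2r.
have hl : `|(q 0 0)%:~R : R| <= B * S.
  have [l0|l0|->] := ltgtP (q 0 0) 0; last by rewrite mulr0z normr0 mulr_ge0.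
    have l1 : q 0 ord0 < 0 by exact: l0.
    have [i hi] : exists i, ~ (q 0 i <= -1).
      apply/existsNP.
      by move=> h; move/eqP: hq; apply; apply: vanish; right.
    case: (unliftP ord0 i) hi => [j ->|->] hi; last by exfalso; apply: hi; lia.
    apply: (key j); rewrite yE.
    have h1 : 0 <= (q 0 (lift ord0 j))%:~R :> R by rewrite ler0z; move: hi => /negP; lia.
    have h2 : (q 0 0)%:~R <= 0 :> R by rewrite lerz0 ltW.
    rewrite (ler0_norm h2) mulNr; apply: le_trans (ler_norm _); lra.
  have l1 : 0 < q 0 ord0 by exact: l0.
  have [i hi] : exists i, ~ (1 <= q 0 i).
      apply/existsNP.
    by move=> h; move/eqP: hq; apply; apply: vanish; left.
  case: (unliftP ord0 i) hi => [j ->|->] hi; last by exfalso; apply: hi; lia.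
  apply: (key j); rewrite yE.
  have h1 : (q 0 (lift ord0 j))%:~R <= 0 :> R by rewrite lerz0; move: hi => /negP; lia.
  have h2 : 0 <= (q 0 0)%:~R :> R by rewrite ler0z ltW.
  rewrite (ger0_norm h2) distrC; apply: le_trans (ler_norm _); lra.
move=> i; apply: (@le_trans _ _ ((1 + B + B * Sb) * S)); last first.
  by apply: ler_wpM2l; [rewrite !addr_ge0// mulr_ge0|rewrite lerDr].
case: (unliftP ord0 i) => [j ->|->]; last first.
  apply: le_trans hl _; apply: ler_wpM2r => //.
  by rewrite addrAC lerDr addr_ge0// mulr_ge0.
have -> : (q 0 (lift ord0 j))%:~R = nupt q 0 j + (q 0 0)%:~R * b 0 j by rewrite yE subrK.
apply: le_trans (ler_normD _ _) _; rewrite normrM (gtr0_norm (b0 j)).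
have -> : (1 + B + B * Sb) * S = S + (B * S) * Sb + B * S by ring.
rewrite -[X in X <= _]addr0 lerD ?mulr_ge0// lerD//.
by apply: ler_pM => //; exact: ltW.
Qed.

Lemma fourier_continuous (h : 'rV[R]_n -> C) : testfun h -> ccontinuous (fourier h).
Proof.
move=> [_ [D kh]]; have [N N0 hN] := ckc_bounded kh.
have E (y : 'rV[R]_n) (e : R) : 0 < e -> exists2 d : R, 0 < d & forall y' : 'rV[R]_n,
    (forall i, `|y 0 i - y' 0 i| < d) -> cabs (fourier h y - fourier h y') <= e.
  (* [4 pi] is the Lipschitz constant used for [cis], [n |D|] bounds the sum of the [|x_i|] on the
     support, and [N] bounds [|h|]; [H] adds the volume and the doubling from real and imaginary
     parts. *)
  move=> e0; pose G := 4 * pi * (n%:R * `|D|) * N.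
  have G0 : 0 <= G by rewrite !mulr_ge0 ?pi_ge0// ltW.
  have V0 : 0 <= vcube n D by rewrite fine_ge0.
  pose H := G * vcube n D + G * vcube n D.
  have H0 : 0 <= H by rewrite addr_ge0// mulr_ge0.
  exists (e / (H + 1)) => [|y' yy']; first by rewrite divr_gt0// ltr_wpDl.
  have k1 := ckc_mul kh (ecis_continuous y').
  have k2 := ckc_mul kh (ecis_continuous y).
  rewrite cabsB -mulN1r addrC /fourier -(integral_Rn_lin (-1) k2 k1).
  have k3 := ckc_add (ckc_scale (-1) k2) k1.
  apply: le_trans (integral_Rn_bound (M := G * (e / (H + 1))) k3 _) _; last first.
    rewrite (_ : _ + _ = H * (e / (H + 1))); last by rewrite /H; ring.
    by rewrite mulrA ler_pdivrMr ?ltr_wpDl// mulrC ler_wpM2l ?(ltW e0)// lerDl.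
  have e1 : 0 <= e / (H + 1) by rewrite divr_ge0 ?(ltW e0)// addr_ge0.
  move=> x; have [xK|xK] := pselect (forall i, `|x 0 i| <= D); last first.
    have /existsNP[i /negP] := xK; rewrite -ltNge => hi.
    by rewrite (((ckcP _ _).1 kh).2 x i hi) !mul0r mulr0 addr0 cabs0 mulr_ge0.
  rewrite mulN1r addrC -mulrBr cabsM mulrC.
  rewrite /G mulrAC; apply: ler_pM => //; rewrite ?cabs_ge0//.
  apply: le_trans (cis_lip _ _) _; rewrite -[X in _ <= X]mulrA; apply: ler_wpM2l.
    by rewrite mulr_ge0// pi_ge0.
  rewrite opprK addrC !(dotC x).
  apply: le_trans (dot_diff (d := e / (H + 1)) _ _) _.
    by move=> i; apply: ltW; exact: yy'.
  rewrite mulrC ler_wpM2r//.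
  apply: (@le_trans _ _ (\sum_(i < n) `|D|)); last by rewrite sumr_const card_ord mulr_natl.
  by apply: ler_sum => i _; rewrite (le_trans (xK i))// ler_norm.
split; apply/rV_continuousP => y e e0; have [d d0 hd] := E y e e0;
  exists d => // y' /hd; apply: le_trans.
  by have := Re_le_cabs (fourier h y - fourier h y'); rewrite ReD ReN.
by have := Im_le_cabs (fourier h y - fourier h y'); rewrite ImD ImN.
Qed.

Lemma alpha_comp_continuous (f : 'rV[R]_n -> R) (u : 'rV[R]_n) : continuous f ->
  continuous (fun w => f (alpha w + u)).
Proof.
move=> /rV_continuousP cf w; apply/cvgrPdist_le => e e0.
have [d d0 hd] := cf (alpha w + u) e e0; near=> w'; apply: hd.
near: w'; apply: filter_forall => i.
have := @alpha_continuous i w => /cvgrPdist_lt/(_ d d0); apply: filterS => w' hw'.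
by move: hw'; rewrite !mxE opprD addrACA subrr addr0.
Unshelve. all: by end_near. Qed.

(** * Double Poisson summation against a fixed test function *)

Section TestFunction.
Variables (h : 'rV[R]_n -> C) (D : R).
Hypothesis th : testfun h.
Hypothesis kh : ckc D h.

Lemma fourier_alpha_decay : exists2 c : R, 0 <= c & forall w (k : 'rV[int]_n),
  - W <= w <= W -> cabs (fourier h (alpha w + intv k)) <= c * rho k.
Proof.
have [K K0 hK] := alpha_bounded.
have [N N0 hN] := fourier_decay (2 * n) th.
have K1 : 0 <= K + 1 by rewrite addr_ge0.
have [c c0 hc] := growth_dominates n n K1.
exists (N * c) => [|w k hw]; first by rewrite mulr_ge0// ltW.
apply: le_trans (hN _) _; rewrite -mulrA; apply: ler_wpM2l => //.
apply: hc => i; set x := alpha w + intv k.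
have -> : (k 0 i)%:~R = x 0 i - alpha w 0 i :> R.
  by rewrite !mxE addrAC subrr add0r.
apply: le_trans (ler_normB _ _) _; rewrite mulrDl mul1r addrC; apply: lerD.
  by apply: le_trans (hK i w hw) _; rewrite ler_peMr// lerDl sumr_ge0.
by rewrite (bigD1 i)//= addrCA lerDl addr_ge0// sumr_ge0.
Qed.

(** For fixed [k], the curve-side summand as a function of a real leaf parameter: the terms of index
    [(j, k)] are its values at [w = j - b.k]. *)
Definition slice (k : 'rV[int]_n) (w : R) : C :=
  (chiT w)%:C%C * fourier h (alpha w + intv k).

Lemma slice_ccont k : ccont (slice k).
Proof.
apply: ccontM; first exact/ccont_real/chiT_continuous.
have [c1 c2] := fourier_continuous th.
split; [exact: (alpha_comp_continuous (f := Re \o fourier h))|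
        exact: (alpha_comp_continuous (f := Im \o fourier h))].
Qed.

Lemma slice_out k w : W < `|w| -> slice k w = 0.
Proof. by move=> hw; rewrite /slice chiT_out// mul0r. Qed.

(** The half-side of a box containing every [p] for which [p - l b] can lie in the support of
    [h]. *)
Definition dualsum (l : int) : nat :=
  (Num.truncn (`|D| + `|l%:~R : R| * \sum_i b 0 i)).+1.

Lemma dualsumP l P : (dualsum l <= P)%N -> forall i, D + `|(l%:~R *: b) 0 i| <= P%:R.
Proof.
move=> hP i; apply: (@le_trans _ _ (dualsum l)%:R); last by rewrite ler_nat.
apply: le_trans (ltW (truncnS_gt _)); apply: lerD; first exact: ler_norm.
rewrite mxE normrM (gtr0_norm (b0 i)); apply: ler_wpM2l => //.
by rewrite (bigD1 i)//= lerDl sumr_ge0// => j _; exact: ltW.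
Qed.

(** Poisson summation over [k] under the integral in [w], for one fixed frequency [l]: the factor
    [e^(-2 i pi l b.k)] plays the role of the shift by [l b]. The tails are uniform in [w] over
    [-W, W], which justifies integrating term by term. *)
Lemma hassum_slice l P : (dualsum l <= P)%N ->
  hassum (fun k : 'rV[int]_n => cintegral W (fun w =>
     slice k w * cis (- (l%:~R * (w + dot b (intv k))))))
    (\sum_(p <- box n P) nucoef (consv l p) * h (nupt (consv l p))).
Proof.
move=> lP.
have [c c0 hc] := fourier_alpha_decay.
pose a := l%:~R *: b.
pose s w := \sum_(p <- box n P) h (latpt p a) * cis (- dot (latpt p a) (alpha w)).
have ps w : - W <= w <= W ->
    hassum (fun k : 'rV[int]_n => fourier h (alpha w + intv k) * cis (- dot (intv k) a)) (s w).
  move=> hw; apply: (poisson_hassum kh (dualsumP lP) (weight_rho n) c0) => k.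
  exact: hc.
have pc p : ccont (fun w => (chiT w)%:C%C *
    cis (- (l%:~R * A0 (Theta w) + dot (intv p) (alpha w))) : C).
  by apply: ccontM; [exact/ccont_real/chiT_continuous|exact: phase_ccont].
have sc k : ccont (fun w => slice k w * cis (- (l%:~R * (w + dot b (intv k))))).
  apply: ccontM; first exact: slice_ccont.
  apply: ccont_cis.
  rewrite (_ : (fun w => _) = fun w => (- l%:~R) * (w + dot b (intv k))).
    apply: contM; first exact: cont_cst.
    by apply: contD; [move=> x; exact: cvg_id|exact: cont_cst].
  by apply/funext => w; rewrite mulNr.
have -> : \sum_(p <- box n P) nucoef (consv l p) * h (nupt (consv l p)) =
    cintegral W (fun w => \sum_(p <- box n P) h (latpt p a) * ((chiT w)%:C%C *
    cis (- (l%:~R * A0 (Theta w) + dot (intv p) (alpha w))))).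
  rewrite cintegral_sum//; apply: eq_bigr => p _.
  by rewrite mulrC /nucoef /nupt consv0 qtl_cons.
move=> e e0.
have W0 : 0 < W by [].
pose e' := e / (4 * W) / (c + 1).
have c1 : 0 < c + 1 by rewrite ltr_wpDl.
have e'0 : 0 < e' by rewrite !divr_gt0// mulr_gt0.
have [B uB hB] := hassum_tail (@weight_rho R n) e'0.
exists B => B' uB' BB'.
have -> : \sum_(k <- B') cintegral W (fun w =>
     slice k w * cis (- (l%:~R * (w + dot b (intv k))))) =
   cintegral W (fun w => \sum_(k <- B') 1 *
     (slice k w * cis (- (l%:~R * (w + dot b (intv k)))))).
  by rewrite cintegral_sum//; apply: eq_bigr => k _; rewrite mul1r.
rewrite addrC -mulN1r -cintegral_lin; last 2 first.
- by apply: ccont_sum => p; apply: ccontM; [exact: ccont_cst|exact: pc].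
- by apply: ccont_sum => k; apply: ccontM; [exact: ccont_cst|exact: sc].
apply: le_trans (cintegral_bound (c := c * e') _ _ _) _ => //.
- apply: ccontD; first apply: ccontM; first exact: ccont_cst.
  + by apply: ccont_sum => p; apply: ccontM; [exact: ccont_cst|exact: pc].
  + by apply: ccont_sum => k; apply: ccontM; [exact: ccont_cst|exact: sc].
- move=> w hw.
  have -> : \sum_(p <- box n P) h (latpt p a) * ((chiT w)%:C%C *
    cis (- (l%:~R * A0 (Theta w) + dot (intv p) (alpha w)))) =
    (chiT w)%:C%C * cis (- (l%:~R * w)) * s w.
    rewrite /s mulr_sumr; apply: eq_bigr => p _.
    have -> : - (l%:~R * A0 (Theta w) + dot (intv p) (alpha w)) =
        - (l%:~R * w) + - dot (latpt p a) (alpha w).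
      rewrite trans_alpha (_ : latpt p a = intv p + (- l%:~R) *: b).
        rewrite dotDl (_ : dot (- l%:~R *: b) (alpha w) = - l%:~R * dot b (alpha w)).
          by ring.
        by rewrite /dot mulr_sumr; apply: eq_bigr => i _; rewrite mxE mulrA.
      by apply/rowP => i; rewrite !mxE mulNr.
    by rewrite cisD; ring.
  have -> : \sum_(k <- B') 1 * (slice k w * cis (- (l%:~R * (w + dot b (intv k))))) =
    (chiT w)%:C%C * cis (- (l%:~R * w)) *
    \sum_(k <- B') fourier h (alpha w + intv k) * cis (- dot (intv k) a).
    rewrite mulr_sumr; apply: eq_bigr => k _; rewrite mul1r /slice.
    have -> : - (l%:~R * (w + dot b (intv k))) = - (l%:~R * w) + - dot (intv k) a.
      rewrite (_ : dot (intv k) a = l%:~R * dot b (intv k)); first by ring.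
      by rewrite /dot mulr_sumr; apply: eq_bigr => i _; rewrite !mxE; ring.
    by rewrite cisD; ring.
  rewrite mulN1r addrC -mulrBr cabsM cabsM cabs_cis mulr1 cabs_real.
  rewrite -[leRHS]mul1r; apply: ler_pM => //; first exact: cabs_ge0.
    exact: chiT_bound.
  rewrite cabsB; apply: hB => //; first exact: ps.
  by move=> k; rewrite cabsM cabs_cis mulr1; exact: hc.
have -> : 4 * W * (c * e') = c * (e / (c + 1)).
  by rewrite /e'; field; rewrite !gt_eqF.
by rewrite mulrA ler_pdivrMr// mulrC ler_wpM2l ?(ltW e0)// lerDl.
Qed.

Lemma slice_fejer N k : cintegral W (fun w => slice k w * (fejer N (w + dot b (intv k)))%:C%C) =
  \sum_(l <- ibox N) (fweight N l)%:C%C * cintegral W (fun w =>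
     slice k w * cis (- (l%:~R * (w + dot b (intv k))))).
Proof.
rewrite -cintegral_sum; last first.
  move=> l; apply: ccontM; first exact: slice_ccont.
  apply: ccont_cis.
  rewrite (_ : (fun w => _) = fun w => (- l%:~R) * (w + dot b (intv k))).
    apply: contM; first exact: cont_cst.
    by apply: contD; [move=> x; exact: cvg_id|exact: cont_cst].
  by apply/funext => w; rewrite mulNr.
apply: eq_cintegral => w _; rewrite -fejerN fejerE mulr_sumr; apply: eq_bigr => l _.
by rewrite mulrN; ring.
Qed.

(** Positivity of the kernel and its mass [2 W] on [-W, W] give a majorant in [k] valid for all [N],
    as partial sums of the Fourier series would not. *)
Lemma slice_fejer_bound : exists2 c : R, 0 <= c & forall N k, (0 < N)%N ->
  cabs (cintegral W (fun w => slice k w * (fejer N (w + dot b (intv k)))%:C%C)) <= c * rho k.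
Proof.
have [c c0 hc] := fourier_alpha_decay.
exists (4 * W * c) => [|N k N0]; first by rewrite mulr_ge0// mulr_ge0.
have cf := @fejer_continuous R N (dot b (intv k)).
have cg : continuous (fun w => c * rho k * fejer N (w + dot b (intv k))).
  by apply: contM => //; exact: cont_cst.
apply: le_trans (cintegral_le _ cg _) _.
- by apply: ccontM; [exact: slice_ccont|exact: ccont_real].
- move=> w hw; rewrite cabsM cabs_real (ger0_norm (fejer_ge0 _ _)).
  apply: ler_wpM2r; first exact: fejer_ge0.
  rewrite /slice cabsM cabs_real -[leRHS]mul1r; apply: ler_pM => //.
  + exact: cabs_ge0.
  + exact: chiT_bound.
  + exact: hc.
rewrite RintegralZl//; last exact: continuous_itv_integrable.
have := @Rintegral_fejer_nat R N (2 * Wbound) (dot b (intv k)) (- W) N0.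
rewrite (_ : - W + (2 * Wbound)%:R = W); last by rewrite natrM; ring.
move=> ->; rewrite natrM (_ : 2 * (_ * _) = 4 * W * c * rho k)//; ring.
Qed.

Lemma mu_decay : exists2 c : R, 0 <= c & forall q : 'rV[int]_n.+1,
  cabs ((chiT (muarg q))%:C%C * fourier h (mupt q)) <= c * rho q.
Proof.
have [K K0 hK] := mupt_growth.
have [N N0 hN] := fourier_decay (2 * n.+1) th.
have [c c0 hc] := growth_dominates n.+1 n K0.
exists (N * c) => [|q]; first by rewrite mulr_ge0// ltW.
have [->|nq] := eqVneq (chiT (muarg q)) 0.
  by rewrite mul0r cabs0 !mulr_ge0// ?ltW// rho_gt0.
rewrite cabsM cabs_real -mulrA -[leRHS]mul1r; apply: ler_pM => //.
- exact: cabs_ge0.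
- exact: chiT_bound.
apply: le_trans (hN _) _; apply: ler_wpM2l => //.
by apply: hc => i; exact: hK.
Qed.

Lemma hassum_mu : exists T, hassum (fun q : 'rV[int]_n.+1 =>
  (chiT (muarg q))%:C%C * fourier h (mupt q)) T.
Proof.
have [c c0 hc] := mu_decay.
apply: (hassum_ex (w := fun q => c * rho q)); last exact: hc.
have [w0 [X hX]] := @weight_rho R n.+1; split=> [q|]; first by rewrite mulr_ge0.
by exists (c * X) => B uB; rewrite -mulr_sumr ler_wpM2l// hX.
Qed.

(** A bounded dual point with nonzero coefficient has a bounded index, by [nupt_growth]; compact
    support of [h] thus leaves finitely many terms. *)
Lemma nu_support : exists Q : nat, forall q : 'rV[int]_n.+1, q \notin box n.+1 Q ->
  nucoef q * h (nupt q) = 0.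
Proof.
have [K K0 hK] := nupt_growth.
exists (Num.truncn (K * (1 + n%:R * `|D|))) => q hq.
have [->|nq] := eqVneq (nucoef q) 0; first by rewrite mul0r.
have [->|hn] := eqVneq (h (nupt q)) 0; first by rewrite mulr0.
exfalso; move/negP: hq; apply; rewrite mem_box; apply/forallP => i.
rewrite truncn_ge_nat; last by rewrite mulr_ge0// addr_ge0// mulr_ge0.
rewrite natr_absz intr_norm; apply: le_trans (hK q nq i) _; apply: ler_wpM2l => //.
rewrite lerD2l; apply: (@le_trans _ _ (\sum_(j < n) `|D|)).
  apply: ler_sum => j _; rewrite leNgt; apply/negP => hj.
  move/eqP: hn; apply; apply: (((ckcP _ _).1 kh).2 (nupt q) j).
  by apply: le_lt_trans hj; exact: ler_norm.
by rewrite sumr_const card_ord mulr_natl.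
Qed.

(** The integrals of the slices against the order-[N] kernel are the pivot. For each [k] they tend
    to the sum over [j]; expanded in frequencies and summed over [k] they give Fejer means of the
    dual sums [Cl l], which vanish for [|l| > Q]. The bound of [slice_fejer_bound], uniform in [N],
    reconciles the two. *)
Lemma fourier_identity : exists T,
  hassum (fun q : 'rV[int]_n.+1 => (chiT (muarg q))%:C%C * fourier h (mupt q)) T /\
  hassum (fun q : 'rV[int]_n.+1 => nucoef q * h (nupt q)) T.
Proof.
have [T hT] := hassum_mu; exists T; split=> //.
have [Q hQ] := nu_support.
(* [hassum_slice] asks for a box depending on [l]; since no term outside the box of size [Q]
   contributes, enlarging it changes nothing, as [ClE] records. *)
pose Cl (l : int) := \sum_(p <- box n (maxn Q (dualsum l))) nucoef (consv l p) * h (nupt (consv l p)).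
have ClE l : Cl l = \sum_(p <- box n Q) nucoef (consv l p) * h (nupt (consv l p)).
  rewrite /Cl (sum_subset _ (uniq_box n Q) (uniq_box _ _)); last first.
    move=> p; rewrite !mem_box => /forallP hp; apply/forallP => i.
    by apply: leq_trans (hp i) _; exact: leq_maxl.
  rewrite [X in _ + X]big1 ?addr0// => p hp; apply: hQ; apply: contra hp.
  by rewrite !mem_box => /forallP hp; apply/forallP => i; have := hp (lift ord0 i); rewrite consvS.
have Cl0 l : (Q < `|l|)%N -> Cl l = 0.
  move=> Ql; rewrite ClE big1// => p _; apply: hQ; rewrite mem_box; apply/negP => /forallP/(_ ord0).
  by rewrite consv0 leqNgt Ql.
have -> : T = \sum_(q <- box n.+1 Q) nucoef q * h (nupt q); last first.
  by apply: hassum_finite => //; exact: uniq_box.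
rewrite sum_box_cons; under eq_bigr do rewrite -ClE.
apply/eqP; rewrite -subr_eq0; apply/eqP/cabs_le_eq0 => e0 e00.
have [c c0 hc] := mu_decay; have [d d0 hd] := slice_fejer_bound.
pose Z := \sum_(l <- ibox Q) cabs (Cl l).
have Z0 : 0 <= Z by apply: sumr_ge0 => l _; exact: cabs_ge0.
(* Four errors are chained: [c e] for truncating the curve side, [e] for the kernel on finitely many
   slices, [d e] for the remaining slices, [Z e] for replacing the Fejer weights by 1. *)
pose G := c + d + 1 + Z.
have G0 : 0 < G by rewrite /G ltr_wpDr// ltr_wpDl// addr_ge0.
pose e := e0 / G.
have ep : 0 < e by rewrite divr_gt0.
have -> : e0 = G * e by rewrite mulrC divfK// gt_eqF.
have [A1 uA1 hA1] := hassum_tail (@weight_rho R n.+1) ep.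
have [A2 uA2 hA2] := hassum_tail (@weight_rho R n) ep.
(* The slices kept must serve two tails at once: the set [A2] of vectors [k], and the tails of the
   indices in [A1], so that [A1] lies in the product of an interval with [K]. *)
pose K := undup (A2 ++ [seq qtl q | q <- A1]).
have uK : uniq K by exact: undup_uniq.
have A2K : {subset A2 <= K} by move=> k kA; rewrite mem_undup mem_cat kA.
have [P0 hP0] := sub_box A1.
have [P1 hP1] : exists P1 : nat, forall k, k \in K -> W + `|dot b (intv k)| <= P1%:R.
  elim: K {uK A2K} => [|k K [P1 hP1]]; first by exists 0%N.
  exists (maxn (Num.truncn (W + `|dot b (intv k)|)).+1 P1) => k'.
  rewrite inE => /orP[/eqP ->|/hP1 h1].
    by apply: le_trans (ltW (truncnS_gt _)) _; rewrite ler_nat leq_maxl.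
  by apply: le_trans h1 _; rewrite ler_nat leq_maxr.
pose P := maxn P0 P1.
pose B := [seq consv j k | j <- ibox P, k <- K].
have uB : uniq B.
  apply: allpairs_uniq => //; first exact: uniq_ibox.
  by move=> [j p] [k q] _ _ /= hh; have [-> ->] := consv_inj hh.
have A1B : {subset A1 <= B}.
  move=> q qA; apply/allpairsP; exists (q 0 0, qtl q) => /=; split.
  - have := hP0 P (leq_maxl _ _) q qA; rewrite mem_box mem_ibox => /forallP; exact.
  - by rewrite mem_undup mem_cat; apply/orP; right; apply/mapP; exists q.
  - exact: consv_eta.
have hTB : cabs (T - \sum_(k <- K) \sum_(j <- ibox P) slice k (j%:~R - dot b (intv k))) <= c * e.
  have E : \sum_(q <- B) (chiT (muarg q))%:C%C * fourier h (mupt q) =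
      \sum_(k <- K) \sum_(j <- ibox P) slice k (j%:~R - dot b (intv k)).
    rewrite big_allpairs_dep exchange_big/=.
    apply: eq_bigr => k _; apply: eq_bigr => j _.
    by rewrite /slice /mupt /muarg consv0 qtl_cons.
  by rewrite -E; exact: hA1.
have [N1 hN1] : exists N1, forall N, (N1 <= N)%N -> cabs (
    \sum_(k <- K) cintegral W (fun w => slice k w * (fejer N (w + dot b (intv k)))%:C%C) -
    \sum_(k <- K) \sum_(j <- ibox P) slice k (j%:~R - dot b (intv k))) <= e.
  have {hP1} hP1 k : k \in K -> W + `|dot b (intv k)| <= P%:R.
    by move=> /hP1 h1; apply: le_trans h1 _; rewrite ler_nat leq_maxr.
  elim: K {uK A2K B uB A1B hTB} e ep {hA1 hA2} hP1 => [|k K ih] e ep hP1.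
    by exists 0%N => N _; rewrite !big_nil subr0 cabs0 ltW.
  have e2 : 0 < e / 2 by rewrite divr_gt0.
  have [|N1 h1] := ih _ e2.
    by move=> k' hk'; apply: hP1; rewrite inE hk' orbT.
  have [|N2 h2] := fejer_sum_cvgC (slice_ccont k) (@slice_out k) (hP1 k _) e2.
    by rewrite inE eqxx.
  exists (maxn N1 N2) => N; rewrite geq_max => /andP[/h1 {}h1 /h2 {}h2].
  rewrite [X in X - _]big_cons [X in _ - X]big_cons opprD addrACA.
  apply: le_trans (cabsD _ _) _.
  by rewrite [leRHS]splitr lerD.
have [N2 hN2] : exists N2, forall N, (N2 <= N)%N -> forall l, l \in ibox Q -> 1 - e <= fweight N l.
  elim: (ibox Q) => [|l r [N2 h2]]; first by exists 0%N.
  have [N3 h3] := fweight_cvg l ep.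
  exists (maxn N2 N3) => N; rewrite geq_max => /andP[/h2 {}h2 /h3 {}h3] l'.
  by rewrite inE => /orP[/eqP ->|/h2].
pose N := maxn (maxn N1 N2) (maxn Q 1).
have N1N : (N1 <= N)%N by rewrite /N !leq_max ?leqnn ?orbT.
have N2N : (N2 <= N)%N by rewrite /N !leq_max ?leqnn ?orbT.
have QN : (Q <= N)%N by rewrite /N !leq_max ?leqnn ?orbT.
have N0 : (0 < N)%N by rewrite /N !leq_max ?leqnn ?orbT.
pose X := \sum_(l <- ibox N) (fweight N l)%:C%C * Cl l.
pose Y := \sum_(k <- K) cintegral W (fun w => slice k w * (fejer N (w + dot b (intv k)))%:C%C).
have hXY : cabs (X - Y) <= d * e.
  apply: hA2 => //; last by move=> k; exact: hd.
  apply: hassum_eq (_ : hassum (fun k => \sum_(l <- ibox N) (fweight N l)%:C%C *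
    cintegral W (fun w => slice k w * cis (- (l%:~R * (w + dot b (intv k)))))) X).
    by move=> k; rewrite slice_fejer.
  by apply: hassum_sum => l; apply: hassumZ; apply: hassum_slice; exact: leq_maxr.
have hX : cabs (X - \sum_(l <- ibox Q) Cl l) <= Z * e.
  have -> : X = \sum_(l <- ibox Q) (fweight N l)%:C%C * Cl l.
    rewrite /X (sum_subset _ (uniq_ibox Q) (uniq_ibox N)); last first.
      by move=> l; rewrite !mem_ibox => hl; exact: leq_trans QN.
    rewrite [X in _ + X]big1 ?addr0// => l; rewrite mem_ibox -ltnNge => /Cl0 ->.
    by rewrite mulr0.
  rewrite -sumrB; apply: le_trans (cabs_sum _ _ _) _.
  rewrite /Z mulr_suml big_seq [leRHS]big_seq; apply: ler_sum => l lQ.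
  rewrite -[X in _ - X]mul1r -mulrBl -RCB cabsM cabs_real mulrC; apply: ler_wpM2l.
    exact: cabs_ge0.
  have f1 := hN2 N N2N l lQ; have f2 := @fweight_le1 R N l.
  rewrite distrC ger0_norm ?subr_ge0//.
  by rewrite lerBlDr addrC -lerBlDr.
set U := \sum_(k <- K) \sum_(j <- _) _ in hTB hN1.
apply: le_trans (cabs_triangle U _ _) _.
apply: le_trans (lerD (lexx _) (cabs_triangle Y _ _)) _.
apply: le_trans (lerD (lexx _) (lerD (lexx _) (cabs_triangle X _ _))) _.
have hUY : cabs (U - Y) <= e by rewrite cabsB; exact: hN1.
have hYX : cabs (Y - X) <= d * e by rewrite cabsB.
have -> : G * e = c * e + (e + (d * e + Z * e)) by rewrite /G; ring.
by apply: lerD => //; apply: lerD => //; exact: lerD.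
Qed.

End TestFunction.

End Foliation.

(** * Boundary values of holomorphic functions *)

Section Hardy.
Context {R : realType}.
Local Notation C := R[i].
Local Notation cabs := (@ComplexField.Normc.normc R).
Local Notation Re := (@complex.Re R).
Local Notation Im := (@complex.Im R).
Local Notation lam := (@lebesgue_measure R).

(* Boundary values of the disc algebra: uniform limits of polynomials in
   [cis x]. *)
Definition hardy (f : R -> C) := forall e : R, 0 < e ->
  exists P : {poly C}, forall x, cabs (f x - P.[cis x]) <= e.

Lemma horner_cis_bound (P : {poly C}) : exists2 M : R, 0 <= M &
  forall x : R, cabs P.[cis x] <= M.
Proof.
exists (\sum_(i < size P) cabs P`_i) => [|x].
  by apply: sumr_ge0 => i _; exact: cabs_ge0.
rewrite horner_coef; apply: le_trans (cabs_sum _ _ _) _.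
by apply: ler_sum => i _; rewrite cabsM -cis_natmul cabs_cis mulr1.
Qed.

Lemma hardy_bound f : hardy f -> exists2 M : R, 0 <= M & forall x, cabs (f x) <= M.
Proof.
move=> /(_ 1 ltr01)[P hP]; have [M M0 hM] := horner_cis_bound P.
exists (1 + M) => [|x]; first exact: addr_ge0.
by rewrite -(subrK P.[cis x] (f x)) (le_trans (cabsD _ _))// lerD.
Qed.

Lemma hardyM f g : hardy f -> hardy g -> hardy (fun x => f x * g x).
Proof.
move=> hf hg e e0; have [M M0 hM] := hardy_bound hf.
have M1 : 0 < M + 1 by rewrite ltr_wpDl.
have [|Q hQ] := hg (e / 2 / (M + 1)); first by rewrite !divr_gt0.
have [N N0 hN] := horner_cis_bound Q.
have N1 : 0 < N + 1 by rewrite ltr_wpDl.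
have [|P hP] := hf (e / 2 / (N + 1)); first by rewrite !divr_gt0.
exists (P * Q) => x; rewrite hornerM.
have -> : f x * g x - P.[cis x] * Q.[cis x] =
  f x * (g x - Q.[cis x]) + Q.[cis x] * (f x - P.[cis x]) by ring.
apply: le_trans (cabsD _ _) _; rewrite !cabsM [leRHS]splitr; apply: lerD.
  apply: (@le_trans _ _ ((M + 1) * (e / 2 / (M + 1)))).
    by apply: ler_pM; rewrite ?cabs_ge0// (le_trans (hM x))// lerDl.
  by rewrite mulrC divfK// gt_eqF.
apply: (@le_trans _ _ ((N + 1) * (e / 2 / (N + 1)))).
  by apply: ler_pM; rewrite ?cabs_ge0// (le_trans (hN x))// lerDl.
by rewrite mulrC divfK// gt_eqF.
Qed.

Lemma hardy_horner (P : {poly C}) : hardy (fun x => P.[cis x]).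
Proof. by move=> e e0; exists P => x; rewrite subrr cabs0 ltW. Qed.

Lemma hardy_cst (c : C) : hardy (fun=> c).
Proof. by move=> e e0; exists c%:P => x; rewrite hornerC subrr cabs0 ltW. Qed.

Lemma hardyD f g : hardy f -> hardy g -> hardy (fun x => f x + g x).
Proof.
move=> hf hg e e0; have e2 : 0 < e / 2 by rewrite divr_gt0.
have [P hP] := hf _ e2; have [Q hQ] := hg _ e2; exists (P + Q) => x.
rewrite hornerD opprD addrACA; apply: le_trans (cabsD _ _) _.
by rewrite [leRHS]splitr lerD.
Qed.

Lemma hardy_exp f k : hardy f -> hardy (fun x => f x ^+ k).
Proof.
move=> hf; elim: k => [|k ih].
  by under eq_fun do rewrite expr0; exact: hardy_cst.
by under eq_fun do rewrite exprS; exact: hardyM.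
Qed.

Lemma hardy_prod (I : Type) (r : seq I) (F : I -> R -> C) :
  (forall i, hardy (F i)) -> hardy (fun x => \prod_(i <- r) F i x).
Proof.
move=> h; elim: r => [|i r ih].
  by under eq_fun do rewrite big_nil; exact: hardy_cst.
by under eq_fun do rewrite big_cons; exact: hardyM.
Qed.

Lemma hardy_cis k : hardy (fun x => cis x ^+ k).
Proof. by under eq_fun do rewrite -hornerXn; exact: hardy_horner. Qed.

(** Truncating the geometric series after [K] terms leaves [z^K / (1 - z)] with [|z| = |a|], of
    modulus at most [|a|^K / (1 - |a|)] uniformly in [x]. *)
Lemma hardy_geom (a : R) (g : nat) : `|a| < 1 ->
  hardy (fun x => (1 - a%:C%C * cis x ^+ g)^-1).
Proof.
move=> a1 e e0.
have a2 : 0 < 1 - `|a| by rewrite subr_gt0.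
have [K hK] : exists K, `|a| ^+ K <= e * (1 - `|a|).
  have := cvg_expr (_ : `| `|a| | < 1); rewrite normr_id => /(_ a1).
  move=> /cvgrPdist_le/(_ (e * (1 - `|a|))); rewrite mulr_gt0// => /(_ isT)[K _ hK].
  by exists K; have := hK K (leqnn K); rewrite sub0r normrN ger0_norm ?exprn_ge0.
exists (\sum_(k < K) (a%:C%C ^+ k)%:P * 'X^(g * k)) => x.
set z := a%:C%C * cis x ^+ g.
have zn : cabs z = `|a|.
  by rewrite /z cabsM cabs_real -cis_natmul cabs_cis mulr1.
have z1 : 1 - z != 0.
  apply/eqP => /eqP; rewrite subr_eq0 => /eqP h; move: zn; rewrite -h.
  by rewrite ComplexField.Normc.normc1 => h1; move: a1; rewrite -h1 ltxx.
have -> : (\sum_(k < K) (a%:C%C ^+ k)%:P * 'X^(g * k)).[cis x] = \sum_(k < K) z ^+ k.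
  rewrite horner_sum; apply: eq_bigr => k _.
  by rewrite hornerM hornerC hornerXn /z exprMn exprM.
have -> : (1 - z)^-1 - \sum_(k < K) z ^+ k = z ^+ K / (1 - z).
  apply: (mulIf z1); rewrite mulrBl mulVf// divfK//.
  by rewrite (_ : _ * (1 - z) = - (z ^+ K - 1)); [ring|rewrite subrX1; ring].
have z2 : 1 - `|a| <= cabs (1 - z).
  rewrite -zn -(@ComplexField.Normc.normc1 R).
  by have := cabsD (1 - z) z; rewrite subrK; lra.
have zK : cabs (z ^+ K) = `|a| ^+ K.
  elim: (K) => [|k ih]; first by rewrite !expr0 ComplexField.Normc.normc1.
  by rewrite !exprS cabsM ih zn.
rewrite cabsM zK ComplexField.Normc.normcV ler_pdivrMr; last exact: lt_le_trans z2.
by apply: le_trans hK _; apply: ler_wpM2l => //; exact: ltW.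
Qed.

(** [F] and [G] are primitives for the two affine halves of the tent. *)
Lemma Rintegral_tent (f F G : R -> R) : continuous f ->
  (forall x : R, is_derive x (1 : R) F ((1 + (-1) * x) * f x)) ->
  (forall x : R, is_derive x (1 : R) G ((1 + 1 * x) * f x)) ->
  \int[lam]_(x in `[- 1, 1]) (tent x * f x) = F 1 - F 0 + (G 0 - G (- 1)).
Proof.
move=> cf dF dG.
have c0 : continuous (fun x => tent x * f x) by apply: contM => //; exact: tent_continuous.
have cid : continuous (fun x : R => x) by move=> x; exact: cvg_id.
rewrite (Rintegral_chasles (x := 0) c0) ?lerN10// addrC; congr (_ + _).
  rewrite -(Rintegral_deriv ler01 dF); last first.
    apply: contM => //; apply: contD; first exact: cont_cst.
    by apply: contM => //; exact: cont_cst.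
  apply: eq_Rintegral => x; rewrite inE/= in_itv/= => /andP[x0 x1].
  by rewrite tent_in ger0_norm// mulN1r.
rewrite -(Rintegral_deriv (lerN10 _) dG); last first.
  apply: contM => //; apply: contD; first exact: cont_cst.
  by apply: contM => //; exact: cont_cst.
apply: eq_Rintegral => x; rewrite inE/= in_itv/= => /andP[x0 x1].
by rewrite tent_in ler0_norm ?opprK ?mul1r// lerNl.
Qed.

(** The Fourier transform of the tent is [(sin (pi y) / (pi y))^2], which vanishes at nonzero
    integers. The proof uses explicit primitives, with [s = -1] and [s = 1] for the two slopes. *)
Lemma tent_cis0 k : cintegral 1 (fun x => (tent x)%:C%C * cis x ^+ k.+1) = 0 :> C.
Proof.
pose K : R := 2 * pi * k.+1%:R.
have K0 : K != 0 by rewrite gt_eqF// !mulr_gt0// pi_gt0.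
have E x : cis x ^+ k.+1 = Complex (cos (K * x)) (sin (K * x)) :> C.
  by rewrite -cis_natmul -[x *+ _]mulr_natl /cis /K !mulrA.
have cK : cos K = 1 :> R.
  by have := congr1 Re (@cis_int R k.+1%:Z); rewrite /cis /=.
have sK : sin K = 0 :> R.
  by have := congr1 Im (@cis_int R k.+1%:Z); rewrite /cis /=.
have d1 s (x : R) : is_derive x (1 : R) (fun y => 1 + s * y) s.
  by apply: is_derive_eq (is_deriveD (is_derive_cst (1 : R) x 1) (is_derive_lin s x)) _; rewrite add0r.
rewrite /cintegral.
under eq_Rintegral => x _ do rewrite E ReM /= mul0r subr0.
under [X in Complex _ X]eq_Rintegral => x _ do rewrite E ImM /= mul0r addr0.
have dc s (x : R) : is_derive x (1 : R)
    (fun y => K^-1 * ((1 + s * y) * sin (K * y)) + (s / K ^+ 2) * cos (K * y))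
    ((1 + s * x) * cos (K * x)).
  have h := is_deriveD
    (@is_deriveZ _ _ _ _ K^-1 _ _ _ (is_deriveM (d1 s x) (is_derive_sinl K x)))
    (@is_deriveZ _ _ _ _ (s / K ^+ 2) _ _ _ (is_derive_cosl K x)).
  by apply: is_derive_eq h _; rewrite /GRing.scale/=; field.
have ds s (x : R) : is_derive x (1 : R)
    (fun y => - K^-1 * ((1 + s * y) * cos (K * y)) + (s / K ^+ 2) * sin (K * y))
    ((1 + s * x) * sin (K * x)).
  have h := is_deriveD
    (@is_deriveZ _ _ _ _ (- K^-1) _ _ _ (is_deriveM (d1 s x) (is_derive_cosl K x)))
    (@is_deriveZ _ _ _ _ (s / K ^+ 2) _ _ _ (is_derive_sinl K x)).
  by apply: is_derive_eq h _; rewrite /GRing.scale/=; field.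
rewrite (Rintegral_tent (@continuous_cosl R K) (dc (-1)) (dc 1)).
rewrite (Rintegral_tent (@continuous_sinl R K) (ds (-1)) (ds 1)).
rewrite !mulr1 !mulr0 !mulrN1 cosN sinN cos0 sin0 cK sK.
by apply: cplx_eq => /=; ring.
Qed.

(** The extra factor [cis x] raises every exponent of an approximating polynomial to at least 1, so
    each monomial integrates to 0; uniform approximation does the rest. *)
Lemma tent_hardy0 f : ccont f -> hardy f ->
  cintegral 1 (fun x => (tent x)%:C%C * (cis x * f x)) = 0 :> C.
Proof.
move=> cf hf; apply: cabs_le_eq0 => e e0.
have [|P hP] := hf (e / 4); first by rewrite divr_gt0.
have ct := ccont_real (@tent_continuous R).
have cc : ccont (fun x : R => cis x : C) by apply: ccont_cis => x; exact: cvg_id.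
have cX k : ccont (fun x : R => cis x ^+ k : C).
  elim: k => [|k ih]; first by under eq_fun do rewrite expr0; exact: ccont_cst.
  by under eq_fun do rewrite exprS; exact: ccontM.
have E x : P.[cis x] = \sum_(i < size P) P`_i * cis x ^+ i by rewrite horner_coef.
have cP : ccont (fun x => (tent x)%:C%C * (cis x * P.[cis x])).
  apply: ccontM => //; apply: ccontM => //.
  under eq_fun do rewrite E.
  by apply: ccont_sum => i; apply: ccontM => //; exact: ccont_cst.
have cF : ccont (fun x => (tent x)%:C%C * (cis x * f x)).
  by apply: ccontM => //; exact: ccontM.
have -> : cintegral 1 (fun x => (tent x)%:C%C * (cis x * f x)) =
   cintegral 1 (fun x => (-1) * ((tent x)%:C%C * (cis x * P.[cis x])) +
     (tent x)%:C%C * (cis x * f x)).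
  rewrite cintegral_lin// [X in _ = _ * X + _](_ : _ = 0) ?mulr0 ?add0r//.
  transitivity (cintegral 1 (fun x : R => \sum_(i < size P) P`_i * ((tent x)%:C%C * cis x ^+ i.+1))).
    apply: eq_cintegral => x _; rewrite E !mulr_sumr; apply: eq_bigr => i _.
    by rewrite exprS; ring.
  rewrite cintegral_sum; last by move=> i; exact: ccontM.
  by rewrite big1// => i _; rewrite tent_cis0 mulr0.
have -> : e = 4 * 1 * (e / 4) by field.
apply: cintegral_bound => //.
  by apply: ccontD => //; apply: ccontM => //; exact: ccont_cst.
move=> x _; rewrite (_ : _ + _ = (tent x)%:C%C * (cis x * (f x - P.[cis x]))); last by ring.
rewrite !cabsM cabs_real cabs_cis mul1r -[leRHS]mul1r; apply: ler_pM => //.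
  exact: cabs_ge0.
by rewrite ger0_norm ?tent_ge0// tent_le1.
Qed.

(** * Blaschke factors and their lifts *)

Section BlaschkeProduct.
Variables (m : nat) (a : 'I_m -> R) (g : 'I_m -> nat).
Hypothesis ha : forall j, `|a j| < 1.
Hypothesis hg : forall j, (0 < g j)%N.

Definition blift (j : 'I_m) (x : R) : R := mob (a j) ((g j)%:R * x).

Definition dblift (j : 'I_m) (x : R) : R := (g j)%:R * dmob (a j) ((g j)%:R * x).

Lemma is_derive_blift j (x : R) : is_derive x (1 : R) (blift j) (dblift j x).
Proof.
have h := @is_derive1_comp _ (mob (a j)) (fun y : R => (g j)%:R * y) x _ _
  (is_derive_mob (ha j) _) (is_derive_lin _ x).
by apply: is_derive_eq h _; rewrite mulrC.
Qed.

Lemma blift_continuous j : continuous (blift j).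
Proof. exact: is_derive_continuous (is_derive_blift j). Qed.

Lemma dmob_continuous (c : R) : `|c| < 1 -> continuous (dmob c).
Proof.
move=> hc; rewrite /dmob; apply: contM; first exact: cont_cst.
move=> x; apply: cvgV.
  have /andP[h _] := poisson_den_bounds c x.
  by rewrite gt_eqF// (lt_le_trans _ h)// exprn_gt0// subr_gt0.
have h : continuous (fun x : R => 1 - 2 * c * cos (2 * pi * x) + c ^+ 2).
  apply: contD; last exact: cont_cst.
  rewrite (_ : (fun x => _) = (fun x => 1 + (- (2 * c)) * cos (2 * pi * x))).
    apply: contD; first exact: cont_cst.
    by apply: contM; [exact: cont_cst|exact: continuous_cosl].
  by apply/funext => y; rewrite mulNr.
exact: h.
Qed.

Lemma dblift_continuous j : continuous (dblift j).
Proof.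
apply: contM; first exact: cont_cst.
have cl : continuous (fun x : R => (g j)%:R * x).
  by apply: contM; [exact: cont_cst|move=> x; exact: cvg_id].
move=> x; exact: (@continuous_comp _ _ _ (fun x : R => (g j)%:R * x) (dmob (a j)) x (cl x)
  (@dmob_continuous _ (ha j) _)).
Qed.

Definition blaschke j (x : R) : C :=
  (cis x ^+ g j - (a j)%:C%C) / (1 - (a j)%:C%C * cis x ^+ g j).

Lemma cis_blift j x : cis (blift j x) = blaschke j x.
Proof. by rewrite /blift (cis_mob (ha j)) mulr_natl cis_natmul. Qed.

Lemma hardy_blaschke j : hardy (blaschke j).
Proof.
apply: hardyM; last exact: hardy_geom.
by apply: hardyD; [exact: hardy_cis|exact: hardy_cst].
Qed.

(** This is [B A' = z B'(z)], from differentiating [B = e^(2 i pi A)], together with [B'(z) = g (1 -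
    a^2) z^(g-1) / (1 - a z^g)^2]. The left side involves the real function [A'], which is not a
    boundary value; the right side is [cis x] times one. *)
Lemma blaschke_dblift j x : blaschke j x * (dblift j x)%:C%C =
  cis x * (((g j)%:R * (1 - a j ^+ 2))%:C%C * cis x ^+ (g j).-1 *
    (1 - (a j)%:C%C * cis x ^+ g j)^-1 ^+ 2).
Proof.
rewrite /blaschke /dblift; set y := (g j)%:R * x.
have w0 : cis x ^+ g j = cis y :> C by rewrite /y mulr_natl cis_natmul.
have -> : cis x * (((g j)%:R * (1 - a j ^+ 2))%:C%C * cis x ^+ (g j).-1 *
    (1 - (a j)%:C%C * cis x ^+ g j)^-1 ^+ 2) = cis x ^+ g j *
    (((g j)%:R * (1 - a j ^+ 2))%:C%C * (1 - (a j)%:C%C * cis x ^+ g j)^-1 ^+ 2).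
  have gE : cis x ^+ g j = cis x * cis x ^+ (g j).-1 :> C by rewrite -exprS prednK.
  by move: ((1 - _)^-1 ^+ 2) => d; rewrite gE; ring.
rewrite w0; set c := (a j)%:C%C.
have d0 : 1 - c * cis y != 0.
  apply/eqP => /(congr1 Re); rewrite ReD ReN ReM /= mul0r subr0.
  by move=> h; have := mob_den_gt0 (ha j) y; rewrite h ltxx.
have den : (1 - 2 * a j * cos (2 * pi * y) + a j ^+ 2)%:C%C =
    (1 - c * cis y) * (1 - c * cis (- y)).
  apply: cplx_eq; rewrite !(ReM, ImM, ReD, ImD, ReN, ImN) /c /cis /= mulrN cosN sinN.
    have cs := cos2Dsin2 (2 * pi * y).
    transitivity (1 - 2 * a j * cos (2 * pi * y) + a j ^+ 2 *
      (cos (2 * pi * y) ^+ 2 + sin (2 * pi * y) ^+ 2)); last by ring.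
    by rewrite cs mulr1.
  by ring.
have d1 : 1 - c * cis (- y) != 0.
  apply/eqP => /(congr1 Re); rewrite ReD ReN ReM /= mul0r subr0 mulrN cosN.
  by move=> h; have := mob_den_gt0 (ha j) y; rewrite h ltxx.
have num : cis y - c = cis y * (1 - c * cis (- y)).
  by rewrite mulrBr mulr1 mulrCA -cisD subrr cis0 mulr1.
rewrite /dmob !RCM RCV den num; field.
by rewrite d0 d1.
Qed.

(** In the term carrying [dblift i], one of the [N i] factors [blaschke i] is spent on absorbing it;
    this is where each exponent must be at least 1. What remains is [cis x] times an element of the
    disc algebra. *)
Lemma blaschke_vanish (N : 'I_m -> nat) (u : 'I_m -> R) : (forall j, (0 < N j)%N) ->
  cintegral 1 (fun x => (tent x)%:C%C *
    (cis (\sum_j (N j)%:R * blift j x) * (\sum_j u j * dblift j x)%:C%C)) = 0 :> C.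
Proof.
move=> hN.
pose G i x : C := ((g i)%:R * (1 - a i ^+ 2))%:C%C * cis x ^+ (g i).-1 *
    (1 - (a i)%:C%C * cis x ^+ g i)^-1 ^+ 2 *
    (blaschke i x ^+ (N i).-1 * \prod_(j | j != i) blaschke j x ^+ N j).
have cisE x : cis (\sum_j (N j)%:R * blift j x) = \prod_j blaschke j x ^+ N j.
  rewrite (big_morph _ cisD cis0); apply: eq_bigr => j _.
  by rewrite mulr_natl cis_natmul cis_blift.
have GE i x : cis x * G i x = cis (\sum_j (N j)%:R * blift j x) * (dblift i x)%:C%C.
  rewrite cisE (bigD1 i)//= -[in RHS](prednK (hN i)) exprS /G.
  move: (blaschke i x ^+ _) (\prod_(j | _) _) => B P; rewrite mulrA -blaschke_dblift.
  by ring.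
have hG i : hardy (G i).
  apply: hardyM; last first.
    apply: hardyM; first exact: hardy_exp (@hardy_blaschke i).
    under eq_fun do rewrite big_mkcond; apply: hardy_prod => j.
    by case: (j != i); [exact: hardy_exp (@hardy_blaschke j)|exact: hardy_cst].
  apply: hardyM; last by apply: hardy_exp; exact: hardy_geom.
  by apply: hardyM; [exact: hardy_cst|exact: hardy_cis].
have csum : continuous (fun x => \sum_j (N j)%:R * blift j x).
  by apply: cont_sum => j; apply: contM; [exact: cont_cst|exact: blift_continuous].
have cG i : ccont (G i).
  rewrite (_ : G i = fun x => cis (- x) *
    (cis (\sum_j (N j)%:R * blift j x) * (dblift i x)%:C%C)); last first.
    by apply/funext => x; rewrite -GE mulrA cisNM mul1r.
  apply: ccontM.
    by apply: ccont_cis => x; apply: cvgN; exact: cvg_id.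
  by apply: ccontM; [exact: ccont_cis|apply: ccont_real; exact: dblift_continuous].
transitivity (cintegral 1 (fun x => \sum_i (u i)%:C%C * ((tent x)%:C%C * (cis x * G i x)))).
  apply: eq_cintegral => x _; rewrite RC_sum !mulr_sumr; apply: eq_bigr => i _.
  by rewrite GE RCM; ring.
rewrite cintegral_sum; last first.
  move=> i; apply: ccontM; first exact/ccont_real/tent_continuous.
  by apply: ccontM => //; apply: ccont_cis => x; exact: cvg_id.
by rewrite big1// => i _; rewrite tent_hardy0// mulr0.
Qed.

Lemma dblift_bounds : exists m M, 0 < m /\ forall j x, m <= dblift j x <= M.
Proof.
pose lo j := (1 - `|a j|) / (1 + `|a j|); pose hi j := (g j)%:R * ((1 + `|a j|) / (1 - `|a j|)).
have p1 j : 0 < 1 - `|a j| by rewrite subr_gt0.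
have p2 j : 0 < 1 + `|a j| by rewrite ltr_pwDl.
exists (\big[Num.min/1]_j lo j), (\sum_j hi j); split.
  by apply: lt_bigmin => // j _; rewrite divr_gt0.
move=> j x; have /andP[h1 h2] := dmob_bounds (ha j) ((g j)%:R * x).
have d0 : 0 <= dmob (a j) ((g j)%:R * x) by rewrite (le_trans _ h1)// divr_ge0// ltW.
apply/andP; split; rewrite /dblift.
  apply: le_trans (bigmin_le _ _ _) _ => //; apply: le_trans h1 _.
  by rewrite ler_peMl// ler1n.
apply: (@le_trans _ _ (hi j)); first by rewrite /hi ler_wpM2l.
rewrite (bigD1 j)//= lerDl sumr_ge0// => i _.
by rewrite mulr_ge0// divr_ge0// ltW.
Qed.

Lemma blift_int j x (k : int) : blift j (x + k%:~R) = blift j x + ((g j)%:Z * k)%:~R.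
Proof. by rewrite /blift mulrDr -mob_int intrM. Qed.

End BlaschkeProduct.

(** The phase carries a minus sign, so exponents [<= -1] give a product of positive powers directly.
    Exponents [>= 1] give its complex conjugate, the other factors being real. *)
Lemma blaschke_vanish_sign (m : nat) (a : 'I_m -> R) (g : 'I_m -> nat) (Q : 'I_m -> int)
    (u : 'I_m -> R) : (forall j, `|a j| < 1) -> (forall j, (0 < g j)%N) ->
  (forall j, 1 <= Q j) \/ (forall j, Q j <= -1) ->
  cintegral 1 (fun x => (tent x)%:C%C * (cis (- \sum_j (Q j)%:~R * blift a g j x) *
    (\sum_j u j * dblift a g j x)%:C%C)) = 0 :> C.
Proof.
move=> ha hg hQ.
have V := blaschke_vanish ha hg (N := fun j => `|Q j|%N) u; case: hQ => hQ; last first.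
  rewrite -[RHS]V; last by move=> j; have := hQ j; lia.
  apply: eq_cintegral => x _; congr (_ * (cis _ * _)); rewrite -sumrN.
  apply: eq_bigr => j _; rewrite -mulNr; congr (_ * _).
  by rewrite -mulrNz -[RHS]/((`|Q j|%N : int)%:~R); congr (_%:~R); have := hQ j; lia.
have {V} : cintegral 1 (fun x => (tent x)%:C%C * (cis (\sum_j (Q j)%:~R * blift a g j x) *
    (\sum_j u j * dblift a g j x)%:C%C)) = 0 :> C.
  rewrite -[RHS]V; last by move=> j; have := hQ j; lia.
  apply: eq_cintegral => x _; congr (_ * (cis _ * _)).
  apply: eq_bigr => j _; congr (_ * _).
  by rewrite -[RHS]/((`|Q j|%N : int)%:~R); congr (_%:~R); have := hQ j; lia.
have cs (v : 'I_m -> R) (F : 'I_m -> R -> R) : (forall j, continuous (F j)) ->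
    continuous (fun x => \sum_j v j * F j x).
  by move=> cF; apply: cont_sum => j; apply: contM; [exact: cont_cst|exact: cF].
set S := fun x => \sum_j (Q j)%:~R * blift a g j x.
set d := fun x => \sum_j u j * dblift a g j x.
have cS : continuous S by apply: cs => j; exact: blift_continuous.
have cd : continuous d by apply: cs => j; exact: dblift_continuous.
move=> V.
transitivity (conjc (0 : C)); last by rewrite conjc0.
rewrite -V /cintegral /=; apply: cplx_eq => /=.
  apply: eq_Rintegral => x _; rewrite !mulrN cosN sinN; ring.
rewrite -mulN1r -RintegralZl//; last first.
  apply: continuous_itv_integrable.
  apply: (ccontM (ccont_real tent_continuous) (ccontM (ccont_cis cS) (ccont_real cd))).2.
by apply: eq_Rintegral => x _; rewrite !mulrN cosN sinN; ring.
Qed.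

End Hardy.

(** * Discrete measures from lattice families *)

Section Families.
Context {R : realType} {n : nat}.
Local Notation C := R[i].
Local Notation cabs := (@ComplexField.Normc.normc R).
Local Notation Re := (@complex.Re R).
Local Notation Im := (@complex.Im R).
Local Notation Rn := 'rV[R]_n.
Local Notation J := 'rV[int]_n.+1.

(** Coefficients are bounded, and an index with nonzero coefficient is controlled linearly by its
    position. The second condition yields at once local finiteness of the positions and the
    polynomial growth behind temperedness. *)
Definition admissible (c : J -> C) (x : J -> Rn) :=
  (exists2 B : R, 0 <= B & forall q, cabs (c q) <= B) /\
  exists2 K : R, 0 <= K & forall q, c q != 0 ->
    forall i, `|(q 0 i)%:~R : R| <= K * (1 + \sum_j `|x q 0 j|).

Definition famsum (c : J -> C) (x : J -> Rn) (f : Rn -> C) : C :=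
  usum (fun q => c q * f (x q)).

Lemma admissible_decay c x : admissible c x -> exists2 k : R, 0 < k &
  forall (f : Rn -> C) (M : R), 0 <= M ->
    (forall y, cabs (f y) <= M / growth (2 * n.+1) y) ->
    forall q, cabs (c q * f (x q)) <= M * k * rho q.
Proof.
move=> [[B B0 hB] [K K0 hK]]; have [k k0 hk] := growth_dominates n.+1 n K0.
exists ((B + 1) * k) => [|f M M0 hf q]; first by rewrite mulr_gt0// ltr_wpDl.
have [->|cq] := eqVneq (c q) 0.
  by rewrite mul0r cabs0 !mulr_ge0 ?addr_ge0// ltW// rho_gt0.
rewrite cabsM (_ : _ * rho q = (B + 1) * (M * (k * rho q))); last by ring.
apply: ler_pM; rewrite ?cabs_ge0//; first by rewrite (le_trans (hB q))// lerDl.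
by apply: le_trans (hf _) _; apply: ler_wpM2l => //; apply: hk; exact: hK.
Qed.

(** [growth r] is a sum of [n + 1] terms, each the modulus of a monomial, so [n + 1] seminorms
    without derivatives suffice. *)
Lemma seminorm_decay (f : Rn -> C) (r : nat) (d : R) :
  seminorm_le (fun=> 0%N) [::] f d ->
  (forall i, seminorm_le (fun j => if j == i then r else 0%N) [::] f d) ->
  forall y, cabs (f y) <= n.+1%:R * d / growth r y.
Proof.
move=> h0 h y; rewrite ler_pdivlMr ?growth_gt0// /growth mulrDr mulr1 mulr_sumr.
rewrite -natr1 mulrDl mul1r addrC; apply: lerD.
  rewrite -[n in n%:R]card_ord mulr_natl -sumr_const; apply: ler_sum => i _.
  have := h i y; rewrite /monomial (bigD1 i)//= eqxx.
  by rewrite big1 ?mulr1 ?normrX 1?mulrC// => j /negPf ->; rewrite expr0.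
by have := h0 y; rewrite /monomial big1 ?normr1 ?mul1r// => i _; rewrite expr0.
Qed.

Lemma schwartz_decay (f : Rn -> C) (r : nat) : schwartz f ->
  exists2 M : R, 0 <= M & forall y, cabs (f y) <= M / growth r y.
Proof.
move=> [_ hf]; have [B0 hB0] := hf (fun=> 0%N) [::].
have /choice[B hB] : forall i : 'I_n, exists B : R,
    seminorm_le (fun j => if j == i then r else 0%N) [::] f B by move=> i; exact: hf.
pose d := `|B0| + \sum_i `|B i|.
have S0 : 0 <= \sum_i `|B i| by exact: sumr_ge0.
exists (n.+1%:R * d); first by rewrite mulr_ge0// addr_ge0.
apply: seminorm_decay => [y|i y].
  apply: le_trans (hB0 y) _; apply: le_trans (ler_norm _) _; by rewrite lerDl.
apply: le_trans (hB i y) _; apply: le_trans (ler_norm _) _.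
by rewrite /d (bigD1 i)//= addrCA lerDl addr_ge0// sumr_ge0.
Qed.

Lemma hassum_famsum c x f M : admissible c x -> 0 <= M ->
  (forall y, cabs (f y) <= M / growth (2 * n.+1) y) ->
  hassum (fun q => c q * f (x q)) (famsum c x f).
Proof.
move=> adm M0 hM; have [k k0 hk] := admissible_decay adm.
have [|s hs] := hassum_ex (w := fun q => M * k * rho q) _ (hk f M M0 hM).
  have [w0 [X hX]] := @weight_rho R n.+1.
  have Mk : 0 <= M * k by rewrite mulr_ge0// ltW.
  split=> [q|]; first by rewrite mulr_ge0.
  by exists (M * k * X) => B uB; rewrite -mulr_sumr ler_wpM2l// hX.
by rewrite /famsum (usumE hs).
Qed.

Lemma tempered_famsum c x : admissible c x -> tempered_distribution (famsum c x).
Proof.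
move=> adm; have H f : schwartz f -> hassum (fun q => c q * f (x q)) (famsum c x f).
  by move=> /(schwartz_decay (2 * n.+1))[M M0 hM]; exact: hassum_famsum hM.
split=> [a f g /H hf /H hg|f /H hf e e0].
  apply: usumE; apply: hassum_eq (hassum_lin a hf hg) => q; ring.
have [k k0 hk] := admissible_decay adm.
have [M M0 hM] := hassum_bound (@weight_rho R n.+1).
(* Chosen so that the final estimate [(n + 1) d k M] equals [e / 2], strictly below [e]; [2 (n + 1)]
   is the order that makes the index family summable. *)
pose d := e / 2 / (n.+1%:R * k * M).
have K0 : 0 < n.+1%:R * k * M by rewrite !mulr_gt0.
have d0 : 0 < d by rewrite !divr_gt0.
exists (2 * n.+1)%N, d => // g /H hg hd.
have {}hd : forall q, cabs (c q * (g \- f) (x q)) <= n.+1%:R * d * k * rho q.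
  apply: hk; first by apply: mulr_ge0 => //; exact: ltW.
  apply: seminorm_decay => [|i]; apply: hd => //; first by rewrite big1.
  by rewrite -big_mkcond big_pred1_eq.
have h : hassum (fun q => c q * (g \- f) (x q)) (famsum c x g - famsum c x f).
  have := hassum_lin (-1) hf hg; rewrite mulN1r addrC; apply: hassum_eq => q /=.
  by ring.
apply: le_lt_trans (hM (n.+1%:R * d * k) _ _ _ h hd) _.
  by apply: mulr_ge0 (ltW k0); apply: mulr_ge0 => //; exact: ltW.
rewrite (_ : _ * M = d * (n.+1%:R * k * M)); last by ring.
by rewrite divfK ?gt_eqF// ltr_pdivrMr// ltr_pMr// ltr1n.
Qed.

Lemma famsum_finite c x (A : R) : admissible c x -> exists P : nat,
  (forall q, c q != 0 -> (forall i, `|x q 0 i| <= A) -> q \in box n.+1 P) /\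
  forall f, ckc A f -> famsum c x f = \sum_(q <- box n.+1 P) c q * f (x q).
Proof.
move=> [_ [K K0 hK]].
pose P := Num.truncn (K * (1 + n%:R * `|A|)); exists P.
have h q : c q != 0 -> (forall i, `|x q 0 i| <= A) -> q \in box n.+1 P.
  move=> cq hq; rewrite mem_box; apply/forallP => i; rewrite truncn_ge_nat; last first.
    by rewrite mulr_ge0// addr_ge0// mulr_ge0.
  rewrite natr_absz intr_norm; apply: le_trans (hK q cq i) _; apply: ler_wpM2l => //.
  rewrite lerD2l; apply: (@le_trans _ _ (\sum_(j < n) `|A|)).
    by apply: ler_sum => j _; rewrite (le_trans (hq j))// ler_norm.
  by rewrite sumr_const card_ord mulr_natl.
split=> // f /ckcP[_ bf]; apply: usumE; apply: hassum_finite; first exact: uniq_box.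
move=> q hq; have [->|cq] := eqVneq (c q) 0; first by rewrite mul0r.
have [/(h q cq)|/existsNP[i hi]] := pselect (forall i, `|x q 0 i| <= A).
  by rewrite (negPf hq).
by rewrite (bf _ i) ?mulr0// ltNge; apply/negP.
Qed.

Lemma coord_le_norm (x : Rn) i : `|x 0 i| <= `|x|.
Proof.
by rewrite [leRHS]/Num.norm /= mx_normrE; apply/bigmax_geP; right; exists (ord0, i).
Qed.

Lemma Cc_ckc (f : Rn -> C) : Cc f -> exists A, ckc A f.
Proof.
move=> [cf /compact_bounded[M [_ hM]]]; exists (`|M| + 1); apply/ckcP; split=> // x i hx.
apply/eqP/negPn/negP => fx; have : `|x| <= `|M| + 1.
  apply: hM; first by rewrite (le_lt_trans (ler_norm _))// ltrDl.
  exact: subset_closure.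
by apply/negP; rewrite -ltNge; apply: lt_le_trans (coord_le_norm x i).
Qed.

Lemma ckc_Cc A (f : Rn -> C) : ckc A f -> Cc f.
Proof.
move=> /ckcP[cf bf]; split=> //.
have cA := @compact_cube R n A.
have clA : closed [set v : Rn | forall i, `[- A, A]%classic (v ord0 i)].
  apply: compact_closed cA; exact: norm_hausdorff.
apply: subclosed_compact cA _; first exact: closed_closure.
rewrite [X in _ `<=` X]((closure_id _).1 clA); apply: closureS => x /= fx i.
rewrite in_itv/= -ler_norml leNgt; apply/negP => /bf h; by rewrite h eqxx in fx.
Qed.

Definition disc (D : set Rn) (d : Rn -> C) (f : Rn -> C) : C := \sum_(y \in D) d y * f y.

Definition locfin (D : set Rn) := forall A : R, exists2 E : seq Rn, uniq E &
  forall y, (y \in E) <-> D y /\ forall i, `|y 0 i| <= A.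

Lemma disc_finite (D : set Rn) (d f : Rn -> C) (A : R) (E : seq Rn) :
  (forall (y : Rn) i, A < `|y 0 i| -> f y = 0) ->
  uniq E -> (forall y, (y \in E) <-> D y /\ forall i, `|y 0 i| <= A) ->
  disc D d f = \sum_(y <- E) d y * f y.
Proof.
move=> bf uE hE; rewrite /disc (fsbigE E)//; last 2 first.
- by move=> y /= /hE[].
- move=> y Dy yE; suff -> : f y = 0 by rewrite mulr0.
  have [h|/existsNP[i hi]] := pselect (forall i, `|y 0 i| <= A).
    by move/negP: yE; case; apply/hE.
  by apply: (bf y i); rewrite ltNge; apply/negP.
rewrite big_seq_cond [RHS]big_seq; apply: eq_bigl => y.
by apply: andb_idr => /hE[Dy _]; rewrite inE.
Qed.

Lemma separated (E : seq Rn) (t : Rn) : exists2 d : R, 0 < d &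
  forall y, y \in E -> y != t -> d <= `|y - t|.
Proof.
elim: E => [|z E [d d0 hd]]; first by exists 1.
have [zt|zt] := eqVneq z t.
  exists d => // y; rewrite inE => /orP[/eqP ->|]; last exact: hd.
  by rewrite zt eqxx.
exists (Num.min d `|z - t|) => [|y]; first by rewrite lt_min d0 normr_gt0 subr_eq0.
rewrite inE => /orP[/eqP -> _|yE yt]; first by rewrite ge_min lexx orbT.
by rewrite ge_min hd.
Qed.

Lemma separated2 (E : seq Rn) : exists2 d : R, 0 < d &
  forall y z, y \in E -> z \in E -> y != z -> d <= `|y - z|.
Proof.
suff [d d0 hd] : exists2 d : R, 0 < d & forall F : seq Rn, {subset F <= E} ->
    forall y z, y \in E -> z \in F -> y != z -> d <= `|y - z|.
  by exists d => // y z yE zE; apply: (hd E).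
suff h : forall F : seq Rn, exists2 d : R, 0 < d &
    forall y z, y \in E -> z \in F -> y != z -> d <= `|y - z|.
  by have [d d0 hd] := h E; exists d => // F FE y z yE /FE; exact: hd.
elim=> [|t F [d d0 hd]]; first by exists 1.
have [d' d'0 hd'] := separated E t.
exists (Num.min d d') => [|y z yE]; first by rewrite lt_min d0.
rewrite inE => /orP[/eqP ->|zF] yz; rewrite ge_min; first by rewrite hd' ?orbT.
by rewrite hd.
Qed.

Lemma locfin_limit_point D : locfin D -> limit_point D = set0.
Proof.
move=> lf; apply/seteqP; split=> // t ht.
have [E uE hE] := lf (`|t| + 1).
have [d d0 hd] := separated E t.
have [|y [yt Dy]] := ht (ball t (Num.min d 1)).
  by apply: nbhsx_ballx; rewrite lt_min d0 ltr01.
rewrite -ball_normE /= lt_min => /andP[h1 h2].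
have yE : y \in E.
  apply/hE; split=> // i; apply: le_trans (coord_le_norm y i) _.
  rewrite -(subrK t y); apply: le_trans (ler_normD _ _) _.
  by rewrite addrC lerD2l distrC ltW.
by move: (hd y yE yt); rewrite leNgt distrC h1.
Qed.

Lemma disc_linear D d : locfin D -> linear_on (@Cc R n) (disc D d).
Proof.
move=> lf a f g /Cc_ckc[A /ckcP[_ bf]] /Cc_ckc[B /ckcP[_ bg]].
pose X := Num.max A B; have [E uE hE] := lf X.
have {}bf (y : Rn) i : X < `|y 0 i| -> f y = 0.
  by move=> h; apply: (bf _ i); apply: le_lt_trans h; rewrite le_max lexx.
have {}bg (y : Rn) i : X < `|y 0 i| -> g y = 0.
  by move=> h; apply: (bg _ i); apply: le_lt_trans h; rewrite le_max lexx orbT.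
rewrite !(@disc_finite D d _ X E)//; last first.
  by move=> y i hy; rewrite (bf y i)// (bg y i)// mulr0 addr0.
rewrite mulr_sumr -big_split/=; apply: eq_bigr => y _; ring.
Qed.

Lemma supp_out (K : set Rn) : compact K -> exists A : R, forall f : Rn -> C,
  supp f `<=` K -> forall (y : Rn) i, A < `|y 0 i| -> f y = 0.
Proof.
move=> /compact_bounded[M [_ hM]]; exists (`|M| + 1) => f fK y i hy.
apply/eqP/negPn/negP => fx; have : `|y| <= `|M| + 1.
  apply: hM; first by rewrite (le_lt_trans (ler_norm _))// ltrDl.
  by apply: fK; exact: subset_closure.
by apply/negP; rewrite -ltNge; apply: lt_le_trans (coord_le_norm y i).
Qed.

Lemma disc_radon D d : locfin D -> radon (disc D d).
Proof.
move=> lf; split; first exact: disc_linear.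
move=> K f /supp_out[A hA] _ fK e e0; have [E uE hE] := lf A.
pose S := \sum_(y <- E) cabs (d y).
have S0 : 0 <= S by apply: sumr_ge0 => y _; exact: cabs_ge0.
have S1 : 0 < S + 1 by rewrite ltr_wpDl.
exists (e / (S + 1)) => [|g _ gK hg]; first by rewrite divr_gt0.
rewrite !(@disc_finite D d _ A E)//; [|exact: hA..].
rewrite -sumrB; apply: le_lt_trans (cabs_sum _ _ _) _.
apply: (@le_lt_trans _ _ (S * (e / (S + 1)))).
  rewrite /S mulr_suml; apply: ler_sum => y _; rewrite -mulrBr cabsM.
  by apply: ler_wpM2l => //; exact: cabs_ge0.
by rewrite mulrA ltr_pdivrMr// mulrC ltr_pM2l// ltrDl.
Qed.

Lemma disc_discrete D d : locfin D -> (forall y, D y -> d y != 0) ->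
  discrete_measure (disc D d).
Proof. by move=> lf h; exists D, d; split => //; exact: locfin_limit_point. Qed.

Definition supported (c : J -> C) (x : J -> Rn) (D : set Rn) :=
  forall y, D y <-> exists2 q, c q != 0 & x q = y.

Lemma locfin_supported c x D : admissible c x -> supported c x D -> locfin D.
Proof.
move=> adm hD A; have [P [hP _]] := famsum_finite A adm.
exists (undup [seq x q | q <- box n.+1 P & (c q != 0) && [forall i, `|x q 0 i| <= A]]).
  exact: undup_uniq.
move=> y; rewrite mem_undup; split.
  move=> /mapP[q]; rewrite mem_filter => /andP[/andP[cq /forallP hq] _] ->.
  by split=> //; apply/hD; exists q.
move=> [/hD[q cq <-] hq]; apply: map_f; rewrite mem_filter cq hP// andbT.
exact/forallP.
Qed.

(** The mass [d y] is the sum of the coefficients over the fibre above [y]. The list [S] must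
    contain the indices of nonzero coefficient in the fibre and may contain others from it. *)
Definition aggregates (c : J -> C) (x : J -> Rn) (D : set Rn) (d : Rn -> C) :=
  forall y, D y -> exists S : seq J, [/\ uniq S, forall q, q \in S -> x q = y,
    forall q, c q != 0 -> x q = y -> q \in S & \sum_(q <- S) c q = d y].

Lemma disc_famsum c x D d f : admissible c x -> supported c x D ->
  aggregates c x D d -> Cc f -> disc D d f = famsum c x f.
Proof.
move=> adm hD agg /Cc_ckc[A kf]; have [_ bf] := (ckcP _ _).1 kf.
have [E uE hE] := locfin_supported adm hD A.
have [P [hP hf]] := famsum_finite A adm.
rewrite (disc_finite d bf uE hE) hf//.
transitivity (\sum_(q <- box n.+1 P) \sum_(y <- E | x q == y) c q * f y); last first.
  apply: eq_bigr => q _; have [xE|xE] := boolP (x q \in E).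
    rewrite big_mkcond (bigD1_seq (x q))//= eqxx big1 ?addr0// => y.
    by rewrite eq_sym => /negPf ->.
  rewrite big_seq_cond big_pred0; last first.
    by move=> y; apply/negP => /andP[yE /eqP xy]; rewrite xy yE in xE.
  have [->|cq] := eqVneq (c q) 0; first by rewrite mul0r.
  have [h|/existsNP[i hi]] := pselect (forall i, `|x q 0 i| <= A).
    move/negP: xE; case; apply/hE; split => //; by apply/hD; exists q.
  by rewrite (bf _ i) ?mulr0// ltNge; apply/negP.
rewrite (exchange_big_dep xpredT)//= big_seq [RHS]big_seq.
apply: eq_bigr => y /hE[Dy yA]; rewrite -mulr_suml; congr (_ * _).
have [S [uS Sx Sc <-]] := agg y Dy.
(* Indices of zero coefficient are dropped on both sides, after which the box and [S] list the same
   part of the fibre. *)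
have nz (F : seq J) (p : pred J) : \sum_(q <- F | p q) c q =
    \sum_(q <- [seq q <- F | p q && (c q != 0)]) c q.
  rewrite big_filter big_mkcondr/=; apply: eq_bigr => q _.
  by case: eqVneq => [->|].
rewrite (nz S predT) [RHS]nz; apply: perm_big; apply: uniq_perm.
- exact: filter_uniq.
- by rewrite filter_uniq// uniq_box.
move=> q; rewrite !mem_filter; case: (eqVneq (c q) 0) => [|cq]; first by rewrite !andbF.
apply/idP/idP; rewrite ?andbT /=.
  by move=> qS; rewrite (Sx q qS) eqxx/= hP// => i; rewrite Sx.
by move=> /andP[/eqP xy _]; exact: Sc.
Qed.

(** * Total variation of a discrete measure *)

Lemma bump_sum_le (E : seq Rn) (r : R) (u : Rn -> C) (x : Rn) : 0 < r -> uniq E ->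
  (forall y z, y \in E -> z \in E -> y != z -> r <= `|y - z|) ->
  (forall y, cabs (u y) <= 1) ->
  cabs (\sum_(y <- E) u y * (tent (2 / r * `|x - y|))%:C%C) <= 1.
Proof.
move=> r0 uE sE hu; pose B y := tent (2 / r * `|x - y|).
have near y : B y != 0 -> `|x - y| < r / 2.
  rewrite ltNge; apply: contra => h; rewrite /B tent_out// ger0_norm.
    by rewrite -ler_pdivrMl ?divr_gt0// mulr1 invf_div.
  by rewrite mulr_ge0// divr_ge0// ltW.
have [/hasP[y yE By]|/hasPn h] := boolP (has (fun y => B y != 0) E); last first.
  rewrite big_seq_cond big1 ?cabs0// => y /andP[/h/negPn/eqP] /=; rewrite /B => -> _.
  by rewrite mulr0.
rewrite (bigD1_seq y)//= big_seq_cond big1 ?addr0.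
  rewrite cabsM cabs_real -[leRHS]mulr1; apply: ler_pM => //; first exact: cabs_ge0.
  by rewrite ger0_norm ?tent_ge0// tent_le1.
move=> z /andP[zE zy]; have [Bz|/near zr] := eqVneq (B z) 0.
  by rewrite -/(B z) Bz mulr0.
have := sE z y zE yE zy; rewrite (_ : z - y = (x - y) - (x - z)); last first.
  by rewrite opprB [RHS]addrC addrA subrK.
move=> h; suff : r < r by rewrite ltxx.
by move: h zr (near y By) (ler_normB (x - y) (x - z)); lra.
Qed.

Lemma bump_sum_continuous (E : seq Rn) (r : R) (u : Rn -> C) :
  ccontinuous (fun x : Rn => \sum_(y <- E) u y * (tent (2 / r * `|x - y|))%:C%C).
Proof.
have ct (y : Rn) : continuous (fun x : Rn => tent (2 / r * `|x - y|)).
  move=> x; apply: (@continuous_comp _ _ _ (fun x : Rn => 2 / r * `|x - y|) tent); last first.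
    exact: tent_continuous.
  apply: continuousM; first exact: cst_continuous.
  apply: (@continuous_comp _ _ _ (fun z : Rn => z - y) (fun z : Rn => `|z|)).
    apply: continuousB; [exact: cvg_id|exact: cst_continuous].
  exact: norm_continuous.
have cs (v : Rn -> R) : continuous (fun x : Rn => \sum_(y <- E) v y * tent (2 / r * `|x - y|)).
  elim: E => [|y E ih].
    by under eq_fun do rewrite big_nil; move=> x; exact: cst_continuous.
  under eq_fun do rewrite big_cons.
  have h (x : Rn) : {for x, continuous (fun x : Rn => v y * tent (2 / r * `|x - y|) +
      \sum_(j <- E) v j * tent (2 / r * `|x - j|))}.
    by apply: continuousD; [apply: continuousM; [exact: cst_continuous|exact: ct]|exact: ih].
  exact: h.
split.
  rewrite (_ : Re \o _ = fun x => \sum_(y <- E) Re (u y) * tent (2 / r * `|x - y|)); first exact: cs.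
  by apply/funext => x /=; rewrite Re_sum; apply: eq_bigr => y _; rewrite ReM /= mulr0 subr0.
rewrite (_ : Im \o _ = fun x => \sum_(y <- E) Im (u y) * tent (2 / r * `|x - y|)); first exact: cs.
by apply/funext => x /=; rewrite Im_sum; apply: eq_bigr => y _; rewrite ImM /= mulr0 add0r.
Qed.

(** The supremum is attained: [f] is multiplied by disjoint bumps around the finitely many points of
    the cube, each carrying the phase that makes the contribution of its point nonnegative. *)
Lemma abs_disc_ge0 D d (f : Rn -> R) (A : R) (E : seq Rn) : kc A f ->
  (forall y, 0 <= f y) ->
  uniq E -> (forall y, (y \in E) <-> D y /\ forall i, `|y 0 i| <= A) ->
  abs_radon_ge0 (disc D d) f = \sum_(y <- E) cabs (d y) * f y.
Proof.
move=> kf f0 uE hE; have [cf bf] := kf.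
set V := \sum_(y <- E) _; rewrite /abs_radon_ge0; set S := [set _ | _ in _].
have ubS : ubound S V.
  move=> _ [g [_ gf] <-].
  have bg (y : Rn) i : A < `|y 0 i| -> g y = 0.
    move=> /bf fy; apply: eq0_cabs; apply/eqP; rewrite eq_le cabs_ge0 andbT.
    by rewrite -fy gf.
  rewrite (disc_finite d bg uE hE); apply: le_trans (cabs_sum _ _ _) _.
  by apply: ler_sum => y _; rewrite cabsM ler_wpM2l// cabs_ge0.
suff SV : S V.
  apply/eqP; rewrite eq_le; apply/andP; split; first by apply: ge_sup => //; exists V.
  by apply: ub_le_sup => //; exists V.
have [r r0 hr] := separated2 E.
(* The phase [|d| / d]; at a point of mass 0 the inverse is 0 by convention, hence only
   [|u| <= 1]. *)
pose u y := (d y)^-1 * (cabs (d y))%:C%C.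
have u1 y : cabs (u y) <= 1.
  rewrite /u cabsM cabs_real ComplexField.Normc.normcV ger0_norm ?cabs_ge0//.
  by have [->|n0] := eqVneq (cabs (d y)) 0; [rewrite mulr0|rewrite mulVf].
pose g x := (f x)%:C%C * \sum_(y <- E) u y * (tent (2 / r * `|x - y|))%:C%C.
have kg : ckc A g.
  apply: ckc_mul (bump_sum_continuous E r u).
  by split=> //; split => // x; exact: cst_continuous.
exists g; first split.
- exact: ckc_Cc kg.
- move=> x; rewrite /g cabsM cabs_real (ger0_norm (f0 x)) -[leRHS]mulr1.
  by apply: ler_wpM2l => //; exact: bump_sum_le.
have [_ bg] := (ckcP _ _).1 kg.
have -> : disc D d g = V%:C%C.
  rewrite (disc_finite d bg uE hE) /V RC_sum big_seq [RHS]big_seq.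
  apply: eq_bigr => y yE; rewrite /g (bigD1_seq y)//= subrr normr0 mulr0.
  rewrite big_seq_cond big1 ?addr0; last first.
    move=> z /andP[zE zy]; rewrite tent_out ?mulr0// ger0_norm; last first.
      by rewrite mulr_ge0// divr_ge0// ltW.
    have := hr y z yE zE; rewrite eq_sym => /(_ zy) h.
    rewrite mulrAC ler_pdivlMr// mul1r; lra.
  rewrite tent_in ?normr0 ?subr0// mulr1 RCM mulrCA mulrC /u mulrA; congr (_ * _).
  have [->|dy] := eqVneq (d y) 0; first by rewrite mul0r mul0r cabs0.
  by rewrite divff// mul1r.
by rewrite cabs_real ger0_norm// sumr_ge0// => y _; rewrite mulr_ge0// cabs_ge0.
Qed.

Lemma abs_disc D d h : locfin D -> Cc h ->
  abs_radon (disc D d) h = disc D (fun y => (cabs (d y))%:C%C) h.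
Proof.
move=> lf /Cc_ckc[A kh]; have [E uE hE] := lf A.
have [[cr br] [ci bi]] := kh; have [_ bh] := (ckcP _ _).1 kh.
have pos (v : Rn -> R) : continuous v -> boxed A v -> kc A v^\+.
  move=> cv bv; split=> [x|x i hx]; last by rewrite /funrpos (bv x i hx) maxxx.
  by apply: continuous_max => //; [exact: cv|exact: cst_continuous].
have neg (v : Rn -> R) : continuous v -> boxed A v -> kc A v^\-.
  move=> cv bv; rewrite -funrposN; apply: pos.
    by move=> x; apply: continuousN; exact: cv.
  by move=> x i hx /=; rewrite (bv x i hx) oppr0.
have key (v : Rn -> R) : continuous v -> boxed A v ->
    abs_radon_ge0 (disc D d) v^\+ - abs_radon_ge0 (disc D d) v^\- =
    \sum_(y <- E) cabs (d y) * v y.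
  move=> cv bv; rewrite (abs_disc_ge0 d (pos v cv bv) _ uE hE); last exact: funrpos_ge0.
  rewrite (abs_disc_ge0 d (neg v cv bv) _ uE hE); last exact: funrneg_ge0.
  rewrite -sumrB; apply: eq_bigr => y _; rewrite -mulrBr; congr (_ * _).
  rewrite /funrpos /funrneg /Order.max; case: ifPn; case: ifPn; lra.
rewrite /abs_radon !key// (disc_finite _ bh uE hE).
apply: cplx_eq; rewrite ?Re_sum ?Im_sum /=; apply: eq_bigr => y _.
  by rewrite ReM /= mul0r subr0.
by rewrite ImM /= mul0r addr0.
Qed.

Lemma schwartz_Cc (h : Rn -> C) : schwartz h -> compact (supp h) -> Cc h.
Proof. by move=> [/(_ [::])[ch _] _] kh. Qed.

Lemma cabs_cabs (z : C) : cabs (cabs z)%:C%C = cabs z.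
Proof. by rewrite cabs_real ger0_norm// cabs_ge0. Qed.

Lemma cabs_eq0 (z : C) : ((cabs z)%:C%C == 0) = (z == 0).
Proof.
apply/eqP/eqP => [h|->]; last by rewrite cabs0.
by apply: eq0_cabs; rewrite -cabs_cabs h cabs0.
Qed.

Lemma admissible_abs c x : admissible c x -> admissible (fun q => (cabs (c q))%:C%C) x.
Proof.
move=> [[B B0 hB] [K K0 hK]]; split; first by exists B => // q; rewrite cabs_cabs.
by exists K => // q; rewrite cabs_eq0; exact: hK.
Qed.

Lemma supported_abs c x D : supported c x D -> supported (fun q => (cabs (c q))%:C%C) x D.
Proof.
move=> hD y; split=> [/hD[q cq xq]|[q cq xq]]; first by exists q => //; rewrite cabs_eq0.
by apply/hD; exists q => //; rewrite -cabs_eq0.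
Qed.

Lemma disc_agree c x D d : admissible c x -> supported c x D -> aggregates c x D d ->
  agree (disc D d) (famsum c x).
Proof. by move=> adm hD agg h sh kh; apply: disc_famsum => //; exact: schwartz_Cc. Qed.

Lemma abs_disc_tempered c x D d : admissible c x -> supported c x D ->
  aggregates (fun q => (cabs (c q))%:C%C) x D (fun y => (cabs (d y))%:C%C) ->
  tempered (abs_radon (disc D d)).
Proof.
move=> adm hD agg; exists (famsum (fun q => (cabs (c q))%:C%C) x).
  exact/tempered_famsum/admissible_abs.
move=> h sh kh; have ch := schwartz_Cc sh kh.
rewrite (abs_disc d (locfin_supported adm hD) ch).
by apply: disc_famsum => //; [exact: admissible_abs|exact: supported_abs].
Qed.

(** The hypotheses on moduli say that no cancellation occurs within a fibre, so that the total
    variation is itself the sum of an admissible family. The duality is demanded for compactly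
    supported smooth functions only, those on which the transform is tested. *)
Lemma quasicrystal_of_families c x D d c' x' D' d' :
  admissible c x -> supported c x D -> aggregates c x D d ->
  aggregates (fun q => (cabs (c q))%:C%C) x D (fun y => (cabs (d y))%:C%C) ->
  (forall y, D y -> d y != 0) ->
  admissible c' x' -> supported c' x' D' -> aggregates c' x' D' d' ->
  aggregates (fun q => (cabs (c' q))%:C%C) x' D' (fun y => (cabs (d' y))%:C%C) ->
  (forall y, D' y -> d' y != 0) ->
  (forall h, testfun h -> exists T,
    hassum (fun q => c q * fourier h (x q)) T /\ hassum (fun q => c' q * h (x' q)) T) ->
  fourier_quasicrystal (disc D d).
Proof.
move=> adm hD agg agga d0 adm' hD' agg' agga' d0' dual.
have lf := locfin_supported adm hD; have lf' := locfin_supported adm' hD'.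
have ft : fourier_transform (disc D d) (disc D' d').
  exists (famsum c x); split; [exact: tempered_famsum|exact: disc_agree|].
  move=> h sh kh; rewrite (disc_agree adm' hD' agg' sh kh).
  have [|T [h1 h2]] := dual h; last by rewrite /famsum (usumE h1) (usumE h2).
  by split; [case: sh|exact/Cc_ckc/schwartz_Cc].
split.
- split; [exact: disc_radon|exact: disc_discrete| |].
    by exists (famsum c x); [exact: tempered_famsum|exact: disc_agree].
  by exists (disc D' d'); split; [exact: disc_radon|exact: disc_discrete|].
- exact: abs_disc_tempered agga.
- exists (disc D' d'); split; [exact: disc_radon|by []|exact: abs_disc_tempered agga'].
Qed.

End Families.

(** * The quasicrystal *)

Section Curve.
Context {R : realType}.
Local Notation C := R[i].
Local Notation cabs := (@ComplexField.Normc.normc R).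
Local Notation Re := (@complex.Re R).

Lemma mob_cis_inj (c x y : R) : `|c| < 1 -> cis (mob c x) = cis (mob c y) ->
  exists k : int, x = y + k%:~R.
Proof.
move=> hc /cis_eq[k]; rewrite -(mob_int c) => xy; exists k.
have inj (u v : R) : mob c u = mob c v -> v <= u.
  move=> uv; rewrite leNgt; apply/negP => lt.
  have /andP[h _] := mvt_bound (is_derive_mob hc) (dmob_bounds hc) (ltW lt).
  move: h; rewrite uv subrr; apply/negP; rewrite -ltNge mulr_gt0 ?subr_gt0//.
  by rewrite divr_gt0 ?subr_gt0// ltr_pwDl.
by apply/eqP; rewrite eq_le !inj.
Qed.

(** The integers [z] with [z d] integral are closed under integer combinations, hence under gcd by
    Bezout. *)
Lemma gcd_int_multiple (I : finType) (f : I -> int) (d : R) :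
  (forall i, exists k : int, (f i)%:~R * d = k%:~R) ->
  exists k : int, (\big[gcdz/0]_i f i)%:~R * d = k%:~R.
Proof.
move=> h; apply: (big_ind (fun z => exists k : int, z%:~R * d = k%:~R)) => [|x y [k hk] [l hl]|i _]; last exact: h.
  by exists 0; rewrite !mulr0z mul0r.
have [u [v <-]] := Bezoutz x y; exists (u * k + v * l).
by rewrite !intrD !intrM mulrDl -!mulrA hk hl.
Qed.

Variables (n : nat) (b : 'rV[R]_n) (a : 'I_(n + 1) -> R) (g : 'I_(n + 1) -> nat) (m M : R).
Hypothesis b0 : forall i, 0 < b 0 i.
Hypothesis ha : forall j, `|a j| < 1.
Hypothesis hg : forall j, (0 < g j)%N.
Hypothesis hgcd : \big[gcdz/0]_j (g j)%:Z = 1.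
Hypothesis m0 : 0 < m.
Hypothesis hm : forall j x, m <= dblift a g j x <= M.

Let A (i : 'I_n) := blift a g (lshift 1 i).
Let A0 := blift a g (rshift n ord0).
Let dA (i : 'I_n) := dblift a g (lshift 1 i).
Let dA0 := dblift a g (rshift n ord0).

Let AP i (x : R) : is_derive x (1 : R) (A i) (dA i x).
Proof. exact: is_derive_blift. Qed.

Let A0P (x : R) : is_derive x (1 : R) A0 (dA0 x).
Proof. exact: is_derive_blift. Qed.

Let hA i x : m <= dA i x <= M. Proof. exact: hm. Qed.

Let hA0 x : m <= dA0 x <= M. Proof. exact: hm. Qed.

Let tr := trans b A A0.
Let Th := Theta b A A0.
Let mu := mupt b A A0.
Let chi q := chiT b A A0 (muarg b q).

Lemma nucoef_vanish (q : 'rV[int]_n.+1) : (forall i, 1 <= q 0 i) \/ (forall i, q 0 i <= -1) ->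
  nucoef b A A0 q = 0.
Proof.
move=> hq; rewrite (nucoef_trans b0 m0 AP A0P hA hA0); last first.
  rewrite /dtrans.
  have h : continuous (fun x => \sum_i b 0 i * dA i x).
    by apply: cont_sum => i; apply: contM; [exact: cont_cst|exact: dblift_continuous].
  by apply: contD => //; exact: dblift_continuous.
(* The index keeps [l] at its head, whereas the corresponding lift is the last coordinate of the
   torus; [Q] reorders accordingly, and [u] lists the weights [b_1, ..., b_n, 1] of [F']. *)
pose Q (j : 'I_(n + 1)) : int := match fintype.split j with inl i => qtl q 0 i | inr _ => q 0 0 end.
pose u (j : 'I_(n + 1)) : R := match fintype.split j with inl i => b 0 i | inr _ => 1 end.
have Ql i : Q (lshift 1 i) = qtl q 0 i.
  by rewrite /Q -[lshift 1 i]/(unsplit (inl i)) unsplitK.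
have Qr : Q (rshift n ord0) = q 0 0.
  by rewrite /Q -[rshift n ord0]/(unsplit (inr ord0)) unsplitK.
have ul i : u (lshift 1 i) = b 0 i.
  by rewrite /u -[lshift 1 i]/(unsplit (inl i)) unsplitK.
have ur : u (rshift n ord0) = 1.
  by rewrite /u -[rshift n ord0]/(unsplit (inr ord0)) unsplitK.
rewrite -[RHS](@blaschke_vanish_sign R _ a g Q u ha hg); last first.
  case: hq => hq; [left|right] => j; rewrite /Q; case: (fintype.split j) => [i|_] //.
    by rewrite mxE.
  by rewrite mxE.
apply: eq_cintegral => x _; rewrite !big_split_ord !big_ord1 /= Qr ur mul1r.
congr (_ * (cis (- _) * _)).
  by rewrite addrC; congr (_ + _); apply: eq_bigr => i _; rewrite Ql.
rewrite /dtrans addrC; congr ((_ + _)%:C%C); apply: eq_bigr => i _; by rewrite ul.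
Qed.

(** The equation [psi(x) = phi_t(e^(2 i pi t))] in coordinates, the parameter [t] here being that of
    the circle; the last row of the matrix produces [-b.x]. *)
Definition onCurve (x : 'rV[R]_n) (t : R) :=
  (forall i, cis (x 0 i) = cis (A i t) :> C) /\ cis (- dot b x) = cis (A0 t) :> C.

Lemma blift_shift j (x : R) (k : int) : cis (blift a g j (x + k%:~R)) = cis (blift a g j x) :> C.
Proof. by rewrite blift_int cisD cis_int mulr1. Qed.

Lemma onCurve_shift x t (k : int) : onCurve x t -> onCurve x (t + k%:~R).
Proof. by move=> [h1 h2]; split=> [i|]; rewrite blift_shift. Qed.

(** Each lift [mob] is strictly monotone and commutes with integer translations, so [g_j (t' - t)]
    is an integer for every [j]; gcd 1 makes [t' - t] itself an integer. *)
Lemma onCurve_unique x t t' : onCurve x t -> onCurve x t' ->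
  exists k : int, t' = t + k%:~R.
Proof.
move=> [h1 h2] [h1' h2'].
have E j : cis (blift a g j t') = cis (blift a g j t) :> C.
  case: (fintype.splitP j) => [i ji|i ji].
    have -> : j = lshift 1 i by exact: val_inj.
    by rewrite -[LHS](h1' i) h1.
  have -> : j = rshift n ord0 by apply: val_inj; rewrite /= ji (ord1 i).
  by rewrite -[LHS]h2' h2.
have [|k] := @gcd_int_multiple _ (fun j => (g j)%:Z) (t' - t).
  move=> j; have [k hk] := mob_cis_inj (ha j) (E j).
  by exists k; rewrite mulrBr -[((g j)%:Z)%:~R]/((g j)%:R : R) hk addrAC subrr add0r.
by rewrite hgcd mul1r => h; exists k; rewrite -h addrC subrK.
Qed.

Lemma onCurve_mupt q : onCurve (mu q) (Th (muarg b q)).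
Proof.
split=> [i|].
  by rewrite /mu /mupt !mxE cisD cis_int mulr1.
have h := trans_alpha b0 m0 AP A0P hA hA0 (muarg b q).
rewrite /Th h -[LHS]mulr1 -[1](@cis_int R (q 0 0)) -cisD; congr cis.
by rewrite /mu /mupt dotDr /muarg; ring.
Qed.

Lemma onCurve_lift x t : onCurve x t ->
  exists q : 'rV[int]_n.+1, muarg b q = tr t /\ mu q = x.
Proof.
move=> [h1 h2].
have /choice[k hk] : forall i, exists k : int, x 0 i = A i t + k%:~R.
  by move=> i; exact: cis_eq.
(* From [x = A(t) + k] and [-b.x = A_m(t) + j] follows [F(t) = -j - b.k]: hence the opposite sign at
   the head of [q]. *)
have [j hj] := cis_eq h2; pose q := consv (- j) (\row_i k i).
have xE : x = (\row_i A i t) + intv (\row_i k i).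
  by apply/rowP => i; rewrite !mxE hk.
have Eq : muarg b q = tr t.
  rewrite /muarg qtl_cons consv0 mulrNz /tr /trans.
  have -> : \sum_i b 0 i * A i t = dot b (\row_i A i t).
    by apply: eq_bigr => i _; rewrite mxE.
  by move: hj; rewrite {1}xE dotDr => hj; lra.
exists q; split=> //; rewrite /mu /mupt Eq qtl_cons xE; congr (_ + _).
by apply/rowP => i; rewrite !mxE /tr (transK b0 m0 AP A0P hA hA0).
Qed.

Lemma intv_inj (k l : 'rV[int]_n) : intv k = intv l :> 'rV[R]_n -> k = l.
Proof.
move=> h; apply/rowP => i; have /rowP/(_ i) := h; rewrite !mxE => /eqP.
by rewrite eqr_int => /eqP.
Qed.

Lemma mupt_inj q q' : muarg b q = muarg b q' -> mu q = mu q' -> q = q'.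
Proof.
move=> hq; rewrite /mu /mupt hq => /addrI/intv_inj ht.
rewrite (consv_eta q) (consv_eta q') -!/(qtl _) ht; congr consv.
by move: hq; rewrite /muarg ht => /addIr/eqP; rewrite eqr_int => /eqP.
Qed.

Lemma onCurve_fract x t : onCurve x t -> exists2 u, 0 <= u < 1 & onCurve x u.
Proof.
move=> h; exists (t + (- Num.floor t)%:~R); last exact: onCurve_shift.
have /andP[h1 h2] := floor_itv t; move: h1 h2.
by rewrite intrD mulrNz subr_ge0 => -> /=; rewrite ltrBlDl mulr1z.
Qed.

Definition curveSet : set 'rV[R]_n := [set x | exists t, onCurve x t].

Lemma chi_tent q t : muarg b q = tr t -> chi q = tent t.
Proof. by move=> h; rewrite /chi /chiT h /tr (transK b0 m0 AP A0P hA hA0). Qed.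

Lemma chi_ge0 q : 0 <= chi q. Proof. exact: tent_ge0. Qed.

Lemma supported_mu : supported (fun q => (chi q)%:C%C) mu curveSet.
Proof.
move=> y; split=> [[t0 /onCurve_fract[t /andP[t1 t2] ht]]|[q _ <-]]; last first.
  by exists (Th (muarg b q)); exact: onCurve_mupt.
have [q [q1 q2]] := onCurve_lift ht; exists q => //; rewrite (chi_tent q1).
rewrite tent_in ger0_norm//; last exact: ltW.
by apply/eqP => /(congr1 Re) /= h; move: t2; lra.
Qed.

(** A point of the curve set has exactly one parameter [t] in [0, 1), its other parameters being the
    integer translates. Only [t] and [t - 1] can meet the open support of the tent, with weights
    [1 - t] and [t]. *)
Lemma aggregates_mu : aggregates (fun q => (chi q)%:C%C) mu curveSet (fun=> 1).
Proof.
move=> y [t0 /onCurve_fract[t /andP[t1 t2] ht]].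
have ht' := onCurve_shift (-1) ht.
have [q [q1 q2]] := onCurve_lift ht; have [q' [q1' q2']] := onCurve_lift ht'.
have tI := trans_inj b0 m0 AP A0P hA hA0.
exists [:: q; q']; split.
- rewrite /= inE andbT; apply/eqP => qq.
  by move: q1'; rewrite -qq q1 => /tI; rewrite mulrNz; lra.
- by move=> p; rewrite !inE => /orP[] /eqP ->.
- move=> p cp py; have hp : onCurve y (Th (muarg b p)) by rewrite -py; exact: onCurve_mupt.
  have [k hk] := onCurve_unique ht hp.
  have hp1 : `|Th (muarg b p)| < 1.
    rewrite ltNge; apply/negP => h; move: cp.
    by rewrite /chi /chiT tent_out// eqxx.
  have pE : muarg b p = tr (t + k%:~R).
    by rewrite -hk /tr /Th (ThetaK b0 m0 AP A0P hA hA0).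
  move: hp1; rewrite hk ltr_norml => /andP[k1 k2].
  have k0 : k < 1 by rewrite -(ltr_int R); lra.
  have k3 : -2 < k by rewrite -(ltr_int R) mulrNz; lra.
  have [k00|k01] : k = 0 \/ k = -1 by lia.
    rewrite !inE; apply/orP; left; apply/eqP/mupt_inj; last by rewrite py.
    by rewrite pE k00 addr0 q1.
  rewrite !inE; apply/orP; right; apply/eqP/mupt_inj; last by rewrite py.
  by rewrite pE k01 q1'.
- rewrite !big_cons big_nil addr0 (chi_tent q1) (chi_tent q1') -RCD mulrNz.
  rewrite !tent_in; [|by rewrite ler_norml; lra..].
  rewrite ger0_norm// ler0_norm; last by lra.
  by apply: cplx_eq => //=; lra.
Qed.

Lemma admissible_mu : admissible (fun q => (chi q)%:C%C) mu.
Proof.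
split; first by exists 1 => // q; rewrite cabs_real; exact: chiT_bound.
have [K K0 hK] := mupt_growth b0 m0 AP A0P hA hA0; exists K => // q hq; apply: hK.
by apply: contra hq => /eqP h; rewrite /chi h.
Qed.

Lemma admissible_nu : admissible (nucoef b A A0) (nupt b).
Proof.
split; last exact: nupt_growth b0 m0 nucoef_vanish.
exists (4 * (Wbound b A A0)%:R) => [|q]; first by rewrite mulr_ge0.
exact: nucoef_bound b0 m0 AP A0P hA hA0 q.
Qed.

Lemma aggregates_inj k (c : 'rV[int]_k.+1 -> C) (x : 'rV[int]_k.+1 -> 'rV[R]_k)
    (D : set 'rV[R]_k) (d : 'rV[R]_k -> C) :
  injective x -> supported c x D -> (forall q, d (x q) = c q) -> aggregates c x D d.
Proof.
move=> xI hD hd y /hD[q cq <-]; exists [:: q]; split=> //.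
- by move=> p; rewrite inE => /eqP ->.
- by move=> p _ /xI ->; rewrite inE.
- by rewrite big_seq1 hd.
Qed.

Hypothesis nupt_inj : injective (nupt b).

(** No cancellation on either side: the curve weights equal their moduli, and injectivity of [nupt]
    leaves one coefficient per dual point. *)
Lemma curve_quasicrystal : fourier_quasicrystal_set curveSet.
Proof.
split; first exact: locfin_limit_point (locfin_supported admissible_mu supported_mu).
pose D' := [set y | exists2 q, nucoef b A A0 q != 0 & nupt b q = y].
(* Injectivity makes the chosen preimage the only one; the default index is taken only at points
   that are not of the form [p - l b]. *)
pose d' y := nucoef b A A0 (xget 0 [set q | nupt b q = y]).
have sD : supported (nucoef b A A0) (nupt b) D' by [].
have dE q : d' (nupt b q) = nucoef b A A0 q.
  rewrite /d'; case: xgetP => [p _ /nupt_inj -> //|/(_ q)]; by case.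
have abs1 : (fun q => (cabs (chi q)%:C%C)%:C%C) = fun q => (chi q)%:C%C :> C.
  by apply/funext => q; rewrite cabs_real ger0_norm// chi_ge0.
rewrite (_ : dirac_comb curveSet = disc curveSet (fun=> 1)); last first.
  apply/funext => f; rewrite /disc /dirac_comb; apply: eq_fsbigr => y _.
  by rewrite mul1r.
apply: (quasicrystal_of_families admissible_mu supported_mu aggregates_mu _ _
  admissible_nu sD (aggregates_inj nupt_inj sD dE)).
- by rewrite abs1 ComplexField.Normc.normc1; exact: aggregates_mu.
- by move=> y _; exact: oner_neq0.
- by apply: (aggregates_inj nupt_inj (supported_abs sD)) => q; rewrite dE.
- by move=> y [q cq <-]; rewrite dE.
- move=> h th; have [_ [B kB]] := th.
  exact: fourier_identity b0 m0 AP A0P hA hA0 nucoef_vanish h B th kB.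
Qed.

End Curve.

(** * Identification of the set and linear independence *)

Section Lambda.
Context {R : realType}.
Local Notation C := R[i].

(** Equality of the [i]-th coordinates is the integer relation [(p'_i - p_i) + (l - l') b_i = 0], so
    a single coordinate already determines both [l] and [p_i]; [n >= 1] provides a coordinate from
    which to read [l]. *)
Lemma lin_indep_nupt_inj n (b : 'cV[R]_n) : (1 <= n)%N -> lin_indep_Z b ->
  injective (nupt (b^T : 'rV[R]_n)).
Proof.
move=> n0 hb q q' qq'.
have key i : q 0 0 = q' 0 0 /\ q 0 (lift ord0 i) = q' 0 (lift ord0 i).
  have /rowP/(_ i) := qq'; rewrite !mxE => h.
  have [] := hb (q' 0 (lift ord0 i) - q 0 (lift ord0 i))
    (fun j => if j == i then q 0 0 - q' 0 0 else 0).
    rewrite (bigD1 i)//= eqxx big1 => [|j /negPf ->]; last by rewrite mulr0z mul0r.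
    by rewrite addr0 !intrB; move: h; lra.
  by move=> h1 /(_ i); rewrite eqxx; lia.
apply/rowP => i; case: (unliftP ord0 i) => [j ->|->]; first by case: (key j).
by case: (key (Ordinal n0)).
Qed.

Lemma unit_circleP (z : C) : unit_circle z <-> exists x : R, z = cis x.
Proof.
have normE (w : C) : `|w| = (ComplexField.Normc.normc w)%:C%C by [].
split=> [|[x ->]]; last by rewrite /unit_circle /= normE cabs_cis.
by rewrite /unit_circle /= normE => /complexI/cis_surj.
Qed.

Lemma psiE n (b : 'cV[R]_n) (x : 'rV[R]_n) :
  (forall i, psi b x 0 (lshift 1 i) = cis (x 0 i)) /\
  psi b x 0 (rshift n ord0) = cis (- dot b^T x).
Proof.
split=> [i|]; rewrite /psi mxE /Mmat mul_col_mx.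
  by rewrite col_mxEu mul1mx mxE.
by rewrite col_mxEd mulNmx !mxE; congr (cis (- _)); apply: eq_bigr => i _; rewrite !mxE.
Qed.

Lemma LambdaE n (b : 'cV[R]_n) (s : 'I_(n + 1) -> R) (gamma : 'I_(n + 1) -> int) (t : R) :
  (forall j, 0 < gamma j) -> (forall j, `|t * s j| < 1) ->
  Lambda b s gamma t = curveSet b^T (fun j => t * s j) (fun j => `|gamma j|%N).
Proof.
move=> hg ha.
have phiE (x : R) j : phi s gamma t (cis x) 0 j =
    cis (blift (fun j => t * s j) (fun j => `|gamma j|%N) j x).
  have e : cis x ^ gamma j = cis x ^+ `|gamma j|%N :> C by rewrite -[in LHS](gtz0_abs (hg j)).
  by rewrite cis_blift// /phi /blaschke mxE e.
apply/seteqP; split=> x.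
  move=> [z /unit_circleP[u ->] hz]; exists u; have [h1 h2] := psiE b x.
  by split=> [i|]; rewrite -?h1 -?h2 -hz phiE.
move=> [u [h1 h2]]; exists (cis u); first by apply/unit_circleP; exists u.
apply/rowP => j; rewrite phiE; have [e1 e2] := psiE b x.
case: (fintype.splitP j) => [i ji|i ji].
  have -> : j = lshift 1 i by exact: val_inj.
  by rewrite e1 h1.
have -> : j = rshift n ord0 by apply: val_inj; rewrite /= ji (ord1 i).
by rewrite e2 h2.
Qed.

End Lambda.

Theorem theorem1 (R : realType) (n : nat) (b : 'cV[R]_n)
  (s : 'I_(n + 1) -> R) (gamma : 'I_(n + 1) -> int) (tau : R)
  (hn : (1 <= n)%N)
  (hb : forall i, 0 < b i 0)
  (hbZ : lin_indep_Z b)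
  (hs : forall j, -1 < s j < 1)
  (hs_inj : injective s)
  (hgamma : forall j, 0 < gamma j)
  (hgcd : \big[gcdz/0]_j gamma j = 1)
  (htau : 0 < tau <= 1)
  (htrans : forall t : R, 0 <= t <= tau -> transverse b s gamma t)
  (t : R) (ht : 0 <= t <= tau) :
  fourier_quasicrystal_set (Lambda b s gamma t).
Proof.
have ha j : `|t * s j| < 1.
  have /andP[t0 t1] := ht; have /andP[_ t2] := htau; have s1 : `|s j| < 1 by rewrite ltr_norml.
  rewrite normrM ger0_norm//; apply: le_lt_trans s1.
  by rewrite ler_piMl// (le_trans t1).
have hg j : (0 < `|gamma j|)%N by rewrite absz_gt0 gt_eqF.
rewrite (LambdaE b hgamma ha).
have [m [M [m0 hm]]] := dblift_bounds ha hg.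
have hgcd' : \big[gcdz/0]_j (`|gamma j|%N)%:Z = 1.
  by rewrite -[RHS]hgcd; apply: eq_bigr => j _; rewrite gtz0_abs.
apply: (curve_quasicrystal _ ha hg hgcd' m0 hm (lin_indep_nupt_inj hn hbZ)).
by move=> i; rewrite mxE.
Qed.
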